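(* Let $\zeta_5$ be a primitive fifth root of unity. Then $$\widetilde{\mathrm{PP}}(\zeta_5,q)=B_0(q^5)+qB_1(q^5)+q^2B_2(q^5)+q^3B_3(q^5)+q^4B_4(q^5),$$ where \begin{align*} B_0(q) &= -\frac{\zeta_5+\zeta_5^4}{(q^5;q^5)_\infty}\bigl(q^{12}\,\Sigma(7,10,15)+q^{25}\,\Sigma(13,25,15)\bigr),\\ B_1(q) &= -\frac{1}{(q^5;q^5)_\infty}\bigl(q^{13}\,\Sigma(10,10,15)+q^{23}\,\Sigma(10,25,15)\bigr)+\frac{(q^3;q^3)_\infty^3}{(q;q)_\infty(q^5;q^5)_\infty},\\ B_2(q) &= \frac{1+\zeta_5+\zeta_5^4}{(q^5;q^5)_\infty}\bigl(\Sigma(1,-20,15)+q^4\,\Sigma(4,-5,15)\bigr),\\ B_3(q) &= 0,\\ B_4(q) &= 0. \end{align*}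
   Context: Here $q$ is a complex number with $0<|q|<1$. Notation: $(z;q)_\infty=\prod_{k\ge 0}(1-zq^k)$; $(z_1,\dots,z_m;q)_\infty=(z_1;q)_\infty\cdots(z_m;q)_\infty$. Define $$\widetilde{\mathrm{PP}}(z,q)=\sum_{n=1}^\infty \frac{q^n(q^{2n};q)_\infty}{(zq^n,z^{-1}q^n;q)_\infty}.$$ For complex arguments let $\Sigma(z,w,q)=\sum_{n=-\infty}^{\infty}\dfrac{q^{2n(n+1)}w^n}{1-zq^n}$, and for integers $a,b,c$ write $\Sigma(a,b,c)$ for $\Sigma(q^a,q^b,q^c)$, i.e. $\Sigma(a,b,c)=\sum_{n\in\mathbb Z}\dfrac{q^{2cn(n+1)+bn}}{1-q^{a+cn}}$. In $B_i(q^5)$ the variable $q$ is replaced by $q^5$ throughout, including inside the $\Sigma(a,b,c)$. *)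

(* Defs.v *)
From Stdlib Require Import Reals ZArith.
From Coquelicot Require Import Coquelicot.
Open Scope C_scope.

(* Total limit in C: the limit of u when u converges (see CLim_unique),
   an unspecified complex number otherwise. *)
Definition CLim (u : nat -> C) : C :=
  iota (T := CompleteNormedModule.CompleteSpace _ C_CompleteNormedModule)
    (fun l : C => filterlim u eventually (locally l)).

Definition CSeries (a : nat -> C) : C := CLim (sum_n a).

Lemma CLim_unique (u : nat -> C) (l : C) :
  filterlim u eventually (locally l) -> CLim u = l.
Proof.
intros H.
assert (U : forall l' : C, filterlim u eventually (locally l') -> l = l').
{ intros l' H'.
  exact (filterlim_locally_unique (F := eventually) (V := C_NormedModule)
           u l l' H H'). }
symmetry; apply U.
apply (iota_correct (V := C_CompleteNormedModule)
         (fun x : C => filterlim u eventually (locally x))).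
now exists l.
Qed.

Lemma CSeries_unique (a : nat -> C) (l : C) : is_series a l -> CSeries a = l.
Proof. exact (CLim_unique (sum_n a) l). Qed.

Definition Cpowz (z : C) (n : Z) : C :=
  match n with
  | Z0 => 1
  | Zpos p => z ^ Pos.to_nat p
  | Zneg p => / (z ^ Pos.to_nat p)
  end.

(* Both halves are summed separately, n >= 0 and n <= -1. *)
Definition CSeriesZ (a : Z -> C) : C :=
  CSeries (fun n : nat => a (Z.of_nat n)) +
  CSeries (fun n : nat => a (- Z.of_nat (S n))%Z).

Definition primitive_root (n : nat) (z : C) : Prop :=
  (0 < n)%nat /\ z ^ n = 1 /\ forall k : nat, (0 < k < n)%nat -> z ^ k <> 1.

(* prod_(k < n) (1 - z q^k) *)
Fixpoint qpoch_fin (z q : C) (n : nat) : C :=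
  match n with
  | O => 1
  | S m => qpoch_fin z q m * (1 - z * q ^ m)
  end.

Definition qpoch (z q : C) : C := CLim (qpoch_fin z q).

Definition PPt_term (z q : C) (n : nat) : C :=
  q ^ n * qpoch (q ^ (2 * n)) q /
  (qpoch (z * q ^ n) q * qpoch (/ z * q ^ n) q).

(* The sum starts at n = 1. *)
Definition PPt (z q : C) : C := CSeries (fun n : nat => PPt_term z q (S n)).

Definition Sigma (z w q : C) : C :=
  CSeriesZ (fun n : Z =>
    Cpowz q (2 * n * (n + 1)) * Cpowz w n / (1 - z * Cpowz q n)).

Definition SigmaZ (q : C) (a b c : Z) : C :=
  Sigma (Cpowz q a) (Cpowz q b) (Cpowz q c).

Definition B_0 (zeta q : C) : C :=
  - ((zeta + zeta ^ 4) / qpoch (q ^ 5) (q ^ 5)) *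
  (q ^ 12 * SigmaZ q 7 10 15 + q ^ 25 * SigmaZ q 13 25 15).

Definition B_1 (q : C) : C :=
  - (1 / qpoch (q ^ 5) (q ^ 5)) *
  (q ^ 13 * SigmaZ q 10 10 15 + q ^ 23 * SigmaZ q 10 25 15)
  + qpoch (q ^ 3) (q ^ 3) ^ 3 / (qpoch q q * qpoch (q ^ 5) (q ^ 5)).

Definition B_2 (zeta q : C) : C :=
  (1 + zeta + zeta ^ 4) / qpoch (q ^ 5) (q ^ 5) *
  (SigmaZ q 1 (-20) 15 + q ^ 4 * SigmaZ q 4 (-5) 15).

Definition B_3 (q : C) : C := 0.

Definition B_4 (q : C) : C := 0.

(* Main.v *)
(** Partial fractions in z + 1/z of each term of the sum, and the evaluation
    sum_k (-1)^k q^(k(k-1)/2) [M-k; k] of the resulting coefficients as a monomial or 0, give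
      (q;q)_oo PPt(z,q) = sum_n (n | 3) q^((2n^2+1)/3) / (1 - z q^n),
    with n over Z and (n | 3) the Legendre symbol. At z = zeta_5 the denominators become
    1 - q^(5n); splitting n modulo 15 gives thirty sums Sigma(a, 4a+3i-30, 15) in Q = q^5.
    Lagrange's partial fraction formula for truncated products of theta functions in base
    Q^15, in the limit (Tannery), expresses a quotient of two thetas by six thetas as a
    combination of six such sums; six instances reduce the thirty sums to the six of the
    statement, with coefficients G and 1/G, where G = (Q^2,Q^3;Q^5)_oo / (Q,Q^4;Q^5)_oo, plus
    the eta quotient. These add up to the claim multiplied by
      (q;q)_oo = (q^25;q^25)_oo (G - q - q^2/G),
    which follows from the quintuple product identity, itself the limit of a finite identity
    with a WZ certificate. *)
Require Import Defs.
From Stdlib Require Import Reals ZArith Lra Lia List Permutation.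
From Coquelicot Require Import Coquelicot.
Import ListNotations.
Open Scope C_scope.

(** * Limits and bilateral series *)

(** The weight q^(2cn(n+1)) of [Sigma] dictates the shape of the theta quotients. Inverting the
    negative half of a theta product costs a factor whose fourth power has exponent -2Nm(m+1), so
    four more thetas below than above yield exactly this weight: hence six over two. For the
    truncations to a window of radius K, a monomial y^(4K) joins the numerator; the degree bound has
    room for it, and it cancels all dependence on K in the exponents. The thirty sums are
    [Sig15 Q i a] with i from 0 to 5 and a in 1, 4, 7, 10, 13. The reflection n -> -1 - n sends (i,
    a) to (5 - i, 15 - a), so a relation may use poles in all classes prime to 3 and still involve a
    single pair {i, 5 - i}. Each of the three pairs owns ten sums: two survive in a fixed
    combination, and two relations eliminate four others each. The eta quotient enters several
    relations, but in the final combination it survives only in [B_1]. No residue calculus occurs: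
    every infinite identity is the limit of a rational one under a uniform geometric bound. *)

Definition Ccv (u : nat -> C) (l : C) : Prop :=
  is_lim_seq (fun n => Cmod (u n - l)) 0.

Lemma Ccv_eps (u : nat -> C) (l : C) :
  Ccv u l <->
  forall eps : R, (0 < eps)%R ->
  exists N, forall n, (N <= n)%nat -> (Cmod (u n - l) < eps)%R.
Proof.
unfold Ccv; rewrite <- is_lim_seq_spec; split.
- intros H eps He; destruct (H (mkposreal eps He)) as [N HN]; exists N.
  intros n Hn; specialize (HN n Hn); simpl in HN.
  rewrite Rminus_0_r, Rabs_pos_eq in HN by apply Cmod_ge_0; exact HN.
- intros H eps; destruct (H eps (cond_pos eps)) as [N HN]; exists N.
  intros n Hn; rewrite Rminus_0_r, Rabs_pos_eq by apply Cmod_ge_0.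
  now apply HN.
Qed.

(** Convergence is phrased through the real sequence of distances, so that the limit arithmetic of R
    does the work; this is the way back to the [iota]-based [CLim] of the statement. *)
Lemma Ccv_CLim (u : nat -> C) (l : C) : Ccv u l -> CLim u = l.
Proof.
intros H; apply CLim_unique.
apply (filterlim_locally_ball_norm (K := C_AbsRing) (U := C_NormedModule)).
intros eps; destruct (proj1 (Ccv_eps u l) H eps (cond_pos eps)) as [N HN].
exists N; intros n Hn; exact (HN n Hn).
Qed.

Lemma filterlim_Ccv (u : nat -> C) (l : C) :
  filterlim u eventually (locally l) -> Ccv u l.
Proof.
intros H; apply Ccv_eps; intros eps He.
destruct (proj1 (filterlim_locally_ball_norm (K := C_AbsRing)
  (U := C_NormedModule) u l) H (mkposreal eps He)) as [N HN].
exists N; intros n Hn; exact (HN n Hn).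
Qed.

Lemma Ccv_unique (u : nat -> C) (l l' : C) : Ccv u l -> Ccv u l' -> l = l'.
Proof.
intros H H'; rewrite <- (Ccv_CLim _ _ H); exact (Ccv_CLim _ _ H').
Qed.

Lemma Ccv_squeeze (u : nat -> C) (l : C) (v : nat -> R) :
  (forall n, (Cmod (u n - l) <= v n)%R) -> is_lim_seq v 0 -> Ccv u l.
Proof.
intros H Hv; apply (is_lim_seq_le_le (fun _ => 0%R) _ v).
- intros n; split; [apply Cmod_ge_0 | apply H].
- apply is_lim_seq_const.
- exact Hv.
Qed.

Lemma Ccv_eventually (u v : nat -> C) (l : C) (N : nat) :
  (forall n, (N <= n)%nat -> u n = v n) -> Ccv u l -> Ccv v l.
Proof.
intros E H; apply (is_lim_seq_ext_loc (fun n => Cmod (u n - l))); [|exact H].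
exists N; intros n Hn; now rewrite E.
Qed.

Lemma Ccv_ext (u v : nat -> C) (l : C) :
  (forall n, u n = v n) -> Ccv u l -> Ccv v l.
Proof. intros E; apply (Ccv_eventually _ _ _ 0); auto. Qed.

Lemma Ccv_const (c : C) : Ccv (fun _ => c) c.
Proof.
apply Ccv_squeeze with (fun _ => 0%R); [|apply is_lim_seq_const].
intros _; replace (c - c) with (RtoC 0) by ring; rewrite Cmod_0; lra.
Qed.

Lemma Ccv_plus (u v : nat -> C) (l m : C) :
  Ccv u l -> Ccv v m -> Ccv (fun n => u n + v n) (l + m).
Proof.
intros Hu Hv.
apply Ccv_squeeze with (fun n => (Cmod (u n - l)%C + Cmod (v n - m)%C)%R).
- intros n; replace (u n + v n - (l + m)) with ((u n - l) + (v n - m)) by ring.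
  apply Cmod_triangle.
- replace (Finite 0) with (Finite (0 + 0)) by (f_equal; ring).
  now apply is_lim_seq_plus'.
Qed.

Lemma Ccv_bounded (u : nat -> C) (l : C) :
  Ccv u l -> exists M, (0 < M)%R /\ forall n, (Cmod (u n) <= M)%R.
Proof.
intros H; destruct (proj1 (Ccv_eps u l) H 1%R Rlt_0_1) as [N HN].
assert (F : exists M, (0 < M)%R /\ forall n, (n < N)%nat -> (Cmod (u n) <= M)%R).
{ clear HN; induction N as [|N [M [M0 HM]]].
  - exists 1%R; split; [lra | intros; lia].
  - exists (M + Cmod (u N))%R; pose proof (Cmod_ge_0 (u N)); split; [lra|].
    intros n Hn; destruct (Nat.eq_dec n N) as [->|]; [lra|].
    assert (Cmod (u n) <= M)%R by (apply HM; lia); lra. }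
destruct F as [M [M0 HM]]; exists (M + (Cmod l + 1))%R.
pose proof (Cmod_ge_0 l); split; [lra|].
intros n; destruct (le_lt_dec N n) as [Hn|Hn].
- specialize (HN n Hn); replace (u n) with (l + (u n - l)) by ring.
  pose proof (Cmod_triangle l (u n - l)); lra.
- specialize (HM n Hn); lra.
Qed.

Lemma Ccv_mult (u v : nat -> C) (l m : C) :
  Ccv u l -> Ccv v m -> Ccv (fun n => u n * v n) (l * m).
Proof.
intros Hu Hv; destruct (Ccv_bounded v m Hv) as [M [M0 HM]].
apply Ccv_squeeze with (fun n => (Cmod (u n - l)%C * M + Cmod l * Cmod (v n - m)%C)%R).
- intros n; replace (u n * v n - l * m)
    with ((u n - l) * v n + l * (v n - m)) by ring.
  eapply Rle_trans; [apply Cmod_triangle|]; rewrite !Cmod_mult.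
  apply Rplus_le_compat_r, Rmult_le_compat_l; [apply Cmod_ge_0 | apply HM].
- replace (Finite 0) with (Finite (0 * M + Cmod l * 0)) by (f_equal; ring).
  apply is_lim_seq_plus'.
  + apply (is_lim_seq_mult' _ (fun _ => M)); [exact Hu | apply is_lim_seq_const].
  + apply (is_lim_seq_mult' (fun _ => Cmod l)); [apply is_lim_seq_const | exact Hv].
Qed.

Lemma Ccv_scal (c : C) (u : nat -> C) (l : C) :
  Ccv u l -> Ccv (fun n => c * u n) (c * l).
Proof. apply Ccv_mult, Ccv_const. Qed.

Lemma Ccv_opp (u : nat -> C) (l : C) : Ccv u l -> Ccv (fun n => - u n) (- l).
Proof.
intros H; apply (Ccv_ext (fun n => (- (1)) * u n)); [intros; ring|].
replace (- l) with (- (1) * l) by ring; now apply Ccv_scal.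
Qed.

Lemma Ccv_minus (u v : nat -> C) (l m : C) :
  Ccv u l -> Ccv v m -> Ccv (fun n => u n - v n) (l - m).
Proof. intros Hu Hv; apply Ccv_plus; [exact Hu | now apply Ccv_opp]. Qed.

(** Beyond some rank the terms have modulus at least |l|/2; a minimum over the finitely many earlier
    ones settles the rest. Reciprocals thereby become uniformly bounded. *)
Lemma Ccv_away (u : nat -> C) (l : C) :
  Ccv u l -> l <> 0 -> (forall n, u n <> 0) ->
  exists m, (0 < m)%R /\ forall n, (m <= Cmod (u n))%R.
Proof.
intros H L0 U0; apply Cmod_gt_0 in L0.
destruct (proj1 (Ccv_eps u l) H (Cmod l / 2)%R ltac:(lra)) as [N HN].
assert (F : exists m, (0 < m)%R /\ forall n, (n < N)%nat -> (m <= Cmod (u n))%R).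
{ clear HN; induction N as [|N [m [m0 Hm]]].
  - exists 1%R; split; [lra | intros; lia].
  - exists (Rmin m (Cmod (u N))); split.
    + apply Rmin_pos; [lra | apply Cmod_gt_0, U0].
    + intros n Hn; destruct (Nat.eq_dec n N) as [->|]; [apply Rmin_r|].
      eapply Rle_trans; [apply Rmin_l | apply Hm; lia]. }
destruct F as [m [m0 Hm]]; exists (Rmin m (Cmod l / 2)); split.
- apply Rmin_pos; lra.
- intros n; destruct (le_lt_dec N n) as [Hn|Hn].
  + specialize (HN n Hn); eapply Rle_trans; [apply Rmin_r|].
    assert (T := Cmod_triangle (u n) (l - u n)).
    replace (u n + (l - u n)) with l in T by ring.
    replace (l - u n) with (- (u n - l)) in T by ring.
    rewrite Cmod_opp in T; lra.
  + eapply Rle_trans; [apply Rmin_l | now apply Hm].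
Qed.

Lemma Cinv_neq_0 (x : C) : x <> 0 -> / x <> 0.
Proof.
intros H E; apply (Cmod_gt_0 1); [rewrite Cmod_1; lra|].
rewrite <- (Cinv_r x H), E; ring.
Qed.

Lemma Ccv_inv (u : nat -> C) (l : C) :
  Ccv u l -> l <> 0 -> (forall n, u n <> 0) -> Ccv (fun n => / u n) (/ l).
Proof.
intros H L0 U0; destruct (Ccv_away u l H L0 U0) as [m [m0 Hm]].
assert (Ll := proj1 (Cmod_gt_0 l) L0).
apply Ccv_squeeze with (fun n => (Cmod (u n - l)%C * (/ m * / Cmod l))%R).
- intros n; replace (/ u n - / l) with (- (u n - l) * (/ u n * / l))
    by (field; auto).
  rewrite Cmod_mult, Cmod_opp, Cmod_mult, !Cmod_inv by auto.
  apply Rmult_le_compat_l; [apply Cmod_ge_0|].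
  apply Rmult_le_compat_r; [left; now apply Rinv_0_lt_compat|].
  apply Rinv_le_contravar; auto.
- replace (Finite 0) with (Finite (0 * (/ m * / Cmod l))) by (f_equal; ring).
  apply (is_lim_seq_mult' _ (fun _ => (/ m * / Cmod l)%R));
    [exact H | apply is_lim_seq_const].
Qed.

Lemma Ccv_div (u v : nat -> C) (l m : C) :
  Ccv u l -> Ccv v m -> m <> 0 -> (forall n, v n <> 0) ->
  Ccv (fun n => u n / v n) (l / m).
Proof. intros; apply Ccv_mult; [|apply Ccv_inv]; auto. Qed.

Lemma Ccv_subseq (u : nat -> C) (l : C) (phi : nat -> nat) :
  (forall N, exists M, forall n, (M <= n)%nat -> (N <= phi n)%nat) ->
  Ccv u l -> Ccv (fun n => u (phi n)) l.
Proof.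
intros Hphi H; apply Ccv_eps; intros eps He.
destruct (proj1 (Ccv_eps u l) H eps He) as [N HN].
destruct (Hphi N) as [M HM]; exists M; intros n Hn; apply HN, HM, Hn.
Qed.

Lemma Ccv_bound (u : nat -> C) (l : C) (B : R) :
  Ccv u l -> (exists N, forall n, (N <= n)%nat -> (Cmod (u n) <= B)%R) ->
  (Cmod l <= B)%R.
Proof.
intros H [N HB]; apply Rnot_lt_le; intros L.
destruct (proj1 (Ccv_eps u l) H (Cmod l - B)%R ltac:(lra)) as [M HM].
specialize (HM (max M N) ltac:(lia)); specialize (HB (max M N) ltac:(lia)).
assert (T := Cmod_triangle (u (max M N)) (l - u (max M N))).
replace (u (max M N) + (l - u (max M N))) with l in T by ring.
replace (l - u (max M N)) with (- (u (max M N) - l)) in T by ring.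
rewrite Cmod_opp in T; lra.
Qed.

Lemma Ccv_pow0 (q : C) : (Cmod q < 1)%R -> Ccv (fun n => q ^ n) 0.
Proof.
intros H; apply Ccv_squeeze with (fun n => (Cmod q ^ n)%R).
- intros n; replace (q ^ n - 0) with (q ^ n) by ring; rewrite Cmod_pow; lra.
- apply is_lim_seq_geom; rewrite Rabs_pos_eq; [exact H | apply Cmod_ge_0].
Qed.

(** * Finite sums and products over an initial segment *)

Fixpoint csum (f : nat -> C) (n : nat) : C :=
  match n with O => 0 | S m => csum f m + f m end.

Fixpoint cprod (f : nat -> C) (n : nat) : C :=
  match n with O => 1 | S m => cprod f m * f m end.

Lemma csum_ext (f g : nat -> C) (n : nat) :
  (forall k, (k < n)%nat -> f k = g k) -> csum f n = csum g n.
Proof.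
induction n as [|n IH]; intros H; simpl; [reflexivity|].
rewrite IH, H by auto; reflexivity.
Qed.

Lemma cprod_ext (f g : nat -> C) (n : nat) :
  (forall k, (k < n)%nat -> f k = g k) -> cprod f n = cprod g n.
Proof.
induction n as [|n IH]; intros H; simpl; [reflexivity|].
rewrite IH, H by auto; reflexivity.
Qed.

Lemma csum_plus (f g : nat -> C) (n : nat) :
  csum (fun k => f k + g k) n = csum f n + csum g n.
Proof. induction n as [|n IH]; simpl; [|rewrite IH]; ring. Qed.

Lemma csum_scal (c : C) (f : nat -> C) (n : nat) :
  csum (fun k => c * f k) n = c * csum f n.
Proof. induction n as [|n IH]; simpl; [|rewrite IH]; ring. Qed.

Lemma csum_zero (f : nat -> C) (n : nat) :
  (forall k, (k < n)%nat -> f k = 0) -> csum f n = 0.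
Proof.
intros H; rewrite (csum_ext _ (fun k => 0 * f k)), csum_scal; [ring|].
intros k Hk; rewrite (H k Hk); ring.
Qed.

Lemma csum_add (f : nat -> C) (n m : nat) :
  csum f (n + m) = csum f n + csum (fun k => f (n + k)%nat) m.
Proof.
induction m as [|m IH]; [rewrite Nat.add_0_r; simpl; ring|].
rewrite Nat.add_succ_r; simpl; rewrite IH; ring.
Qed.

Lemma csum_shift (f : nat -> C) (n : nat) :
  csum f (S n) = f O + csum (fun k => f (S k)) n.
Proof. change (S n) with (1 + n)%nat; rewrite csum_add; simpl; ring. Qed.

Lemma cprod_mult (f g : nat -> C) (n : nat) :
  cprod (fun k => f k * g k) n = cprod f n * cprod g n.
Proof. induction n as [|n IH]; simpl; [|rewrite IH]; ring. Qed.

Lemma cprod_add (f : nat -> C) (n m : nat) :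
  cprod f (n + m) = cprod f n * cprod (fun k => f (n + k)%nat) m.
Proof.
induction m as [|m IH]; [rewrite Nat.add_0_r; simpl; ring|].
rewrite Nat.add_succ_r; simpl; rewrite IH; ring.
Qed.

Lemma cprod_shift (f : nat -> C) (n : nat) :
  cprod f (S n) = f O * cprod (fun k => f (S k)) n.
Proof. change (S n) with (1 + n)%nat; rewrite cprod_add; simpl; ring. Qed.

Lemma cprod_neq_0 (f : nat -> C) (n : nat) :
  (forall k, (k < n)%nat -> f k <> 0) -> cprod f n <> 0.
Proof.
induction n as [|n IH]; intros H; simpl; [apply C1_nz|].
apply Cmult_neq_0; auto.
Qed.

Lemma cprod_rev (f : nat -> C) (n : nat) :
  cprod f n = cprod (fun k => f (n - S k)%nat) n.
Proof.
revert f; induction n as [|n IH]; intros f; [reflexivity|].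
rewrite cprod_shift; simpl cprod; rewrite IH, Nat.sub_diag, Cmult_comm.
f_equal; apply cprod_ext; intros k Hk; f_equal; lia.
Qed.

Lemma csum_rev (f : nat -> C) (n : nat) :
  csum f n = csum (fun k => f (n - S k)%nat) n.
Proof.
revert f; induction n as [|n IH]; intros f; [reflexivity|].
rewrite csum_shift; simpl csum; rewrite IH, Nat.sub_diag, Cplus_comm.
f_equal; apply csum_ext; intros k Hk; f_equal; lia.
Qed.

Lemma Ccv_csum (f : nat -> nat -> C) (g : nat -> C) (n : nat) :
  (forall k, (k < n)%nat -> Ccv (fun K => f K k) (g k)) ->
  Ccv (fun K => csum (f K) n) (csum g n).
Proof.
induction n as [|n IH]; intros H; simpl; [apply Ccv_const|].
apply Ccv_plus; auto.
Qed.

Lemma sum_n_csum (a : nat -> C) (n : nat) : sum_n a n = csum a (S n).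
Proof.
induction n as [|n IH]; [rewrite sum_O; simpl; ring|].
rewrite sum_Sn, IH; reflexivity.
Qed.

(** * Geometric domination and Tannery's theorem *)

Lemma geom_tail (h : nat -> C) (A r : R) (N M : nat) :
  (0 <= r < 1)%R ->
  (forall n, (N <= n < N + M)%nat -> (Cmod (h n) <= A * r ^ n)%R) ->
  (Cmod (csum h (N + M) - csum h N) <= A * r ^ N * (1 - r ^ M) / (1 - r))%R.
Proof.
intros Hr; induction M as [|M IH]; intros H.
- rewrite Nat.add_0_r; replace (csum h N - csum h N) with (RtoC 0) by ring.
  rewrite Cmod_0; simpl; unfold Rdiv; lra.
- rewrite Nat.add_succ_r; simpl csum.
  replace (csum h (N + M) + h (N + M)%nat - csum h N)
    with ((csum h (N + M) - csum h N) + h (N + M)%nat) by ring.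
  eapply Rle_trans; [apply Cmod_triangle|].
  assert (H1 : (Cmod (h (N + M)%nat) <= A * r ^ (N + M))%R) by (apply H; lia).
  assert (H2 := IH ltac:(intros; apply H; lia)).
  rewrite pow_add in H1.
  replace (A * r ^ N * (1 - r ^ S M) / (1 - r))%R
    with (A * r ^ N * (1 - r ^ M) / (1 - r) + A * (r ^ N * r ^ M))%R
    by (simpl; field; lra).
  lra.
Qed.

Lemma geom_series_conv (g : nat -> C) (A r : R) :
  (0 <= r < 1)%R -> (forall n, (Cmod (g n) <= A * r ^ n)%R) ->
  Ccv (csum g) (CSeries g).
Proof.
intros Hr H.
assert (E : ex_series (V := C_CompleteNormedModule) g).
{ apply (ex_series_le (V := C_CompleteNormedModule) g (fun n => (A * r ^ n)%R)).
  - exact H.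
  - apply (ex_series_scal_l A (fun n => (r ^ n)%R)), ex_series_geom.
    rewrite Rabs_pos_eq; lra. }
destruct E as [l Hl]; rewrite (CSeries_unique _ _ Hl).
apply filterlim_Ccv in Hl; apply Ccv_eps; intros eps He.
destruct (proj1 (Ccv_eps _ _) Hl eps He) as [N HN]; exists (S N).
intros [|n] Hn; [lia|]; rewrite <- sum_n_csum; apply HN; lia.
Qed.

(** Dominated convergence when the number of summands grows with the parameter. The limit terms
    inherit the bound, so beyond a common N both tails are below eps/4; the first N terms converge
    one by one, and the partial sums of g account for the last quarter. *)
Lemma tannery (f : nat -> nat -> C) (g : nat -> C) (A r : R) :
  (0 <= r < 1)%R ->
  (forall K n, (n < K)%nat -> (Cmod (f K n) <= A * r ^ n)%R) ->
  (forall n, Ccv (fun K => f K n) (g n)) ->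
  Ccv (fun K => csum (f K) K) (CSeries g).
Proof.
intros Hr Hf Hg.
assert (Bg : forall n, (Cmod (g n) <= A * r ^ n)%R).
{ intros n; apply (Ccv_bound (fun K => f K n)); [apply Hg|].
  exists (S n); intros K HK; apply Hf; lia. }
assert (A0 : (0 <= A)%R).
{ specialize (Bg O); pose proof (Cmod_ge_0 (g O)); simpl in Bg; lra. }
assert (Sg := geom_series_conv g A r Hr Bg).
apply Ccv_eps; intros eps He.
assert (T : exists N, (A * r ^ N / (1 - r) < eps / 4)%R).
{ assert (L : is_lim_seq (fun n => (A / (1 - r) * r ^ n)%R) (A / (1 - r) * 0)%R).
  { apply (is_lim_seq_mult' (fun _ => (A / (1 - r))%R)).
    - apply is_lim_seq_const.
    - apply is_lim_seq_geom; rewrite Rabs_pos_eq; lra. }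
  apply is_lim_seq_spec in L.
  destruct (L (mkposreal (eps / 4) ltac:(lra))) as [N HN]; exists N.
  specialize (HN N (Nat.le_refl N)); simpl in HN.
  apply Rabs_def2 in HN; unfold Rdiv in *; lra. }
destruct T as [N HN].
assert (tail : forall h M, (forall n, (N <= n < N + M)%nat ->
    (Cmod (h n) <= A * r ^ n)%R) ->
  (Cmod (csum h (N + M) - csum h N) < eps / 4)%R).
{ intros h M Hh; eapply Rle_lt_trans; [apply (geom_tail h A r N M Hr Hh)|].
  eapply Rle_lt_trans; [|exact HN].
  unfold Rdiv; apply Rmult_le_compat_r; [left; apply Rinv_0_lt_compat; lra|].
  rewrite <- (Rmult_1_r (A * r ^ N)) at 2.
  apply Rmult_le_compat_l; [apply Rmult_le_pos; [lra | apply pow_le; lra]|].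
  pose proof (pow_le r M ltac:(lra)); lra. }
destruct (proj1 (Ccv_eps _ _) (Ccv_csum f g N (fun k _ => Hg k)) (eps / 4)%R
  ltac:(lra)) as [N1 H1].
destruct (proj1 (Ccv_eps _ _) Sg (eps / 4)%R ltac:(lra)) as [N2 H2].
exists (N + N1 + N2)%nat; intros K HK.
specialize (H1 K ltac:(lia)); specialize (H2 K ltac:(lia)).
assert (T1 := tail (f K) (K - N)%nat
  ltac:(intros n Hn; apply Hf; lia)).
assert (T2 := tail g (K - N)%nat ltac:(intros n _; apply Bg)).
replace (N + (K - N))%nat with K in * by lia.
replace (csum (f K) K - CSeries g)
  with ((csum (f K) K - csum (f K) N) + (csum (f K) N - csum g N)
        + - (csum g K - csum g N) + (csum g K - CSeries g)) by ring.
pose proof (Cmod_triangle ((csum (f K) K - csum (f K) N) + (csum (f K) N - csum g N)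
        + - (csum g K - csum g N)) (csum g K - CSeries g)).
pose proof (Cmod_triangle ((csum (f K) K - csum (f K) N) + (csum (f K) N - csum g N))
        (- (csum g K - csum g N))).
pose proof (Cmod_triangle (csum (f K) K - csum (f K) N) (csum (f K) N - csum g N)).
rewrite Cmod_opp in *; lra.
Qed.

(* The partial sum over the window [-K <= k < K]. *)
Definition zsum (a : Z -> C) (K : nat) : C :=
  csum (fun n => a (Z.of_nat n) + a (- Z.of_nat (S n))%Z) K.

(** Geometric decay in |k| on both sides. The Gaussian weights met below decay much faster, but this
    much already gives convergence, reindexing and Tannery's theorem. *)
Definition zdom (a : Z -> C) : Prop :=
  exists A r : R, (0 <= r < 1)%R /\
  forall k, (Cmod (a k) <= A * r ^ Z.abs_nat k)%R.

Lemma zsum_ext (a b : Z -> C) (K : nat) :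
  (forall k, (- Z.of_nat K <= k < Z.of_nat K)%Z -> a k = b k) ->
  zsum a K = zsum b K.
Proof. intros H; apply csum_ext; intros n Hn; rewrite !H by lia; reflexivity. Qed.

Lemma zsum_plus (a b : Z -> C) (K : nat) :
  zsum (fun k => a k + b k) K = zsum a K + zsum b K.
Proof.
unfold zsum; rewrite <- csum_plus; apply csum_ext; intros; ring.
Qed.

Lemma zsum_scal (c : C) (a : Z -> C) (K : nat) :
  zsum (fun k => c * a k) K = c * zsum a K.
Proof.
unfold zsum; rewrite <- csum_scal; apply csum_ext; intros; ring.
Qed.

Lemma tannery_Z (f : nat -> Z -> C) (g : Z -> C) (A r : R) :
  (0 <= r < 1)%R ->
  (forall K k, (- Z.of_nat K <= k < Z.of_nat K)%Z ->
     (Cmod (f K k) <= A * r ^ Z.abs_nat k)%R) ->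
  (forall k, Ccv (fun K => f K k) (g k)) ->
  Ccv (fun K => zsum (f K) K) (CSeriesZ g).
Proof.
intros Hr Hf Hg; unfold CSeriesZ, zsum.
apply (Ccv_ext (fun K => csum (fun n => f K (Z.of_nat n)) K
                       + csum (fun n => f K (- Z.of_nat (S n))%Z) K)).
{ intros K; symmetry; apply csum_plus. }
assert (A0 : (0 <= A)%R).
{ specialize (Hf 1%nat 0%Z ltac:(lia)); pose proof (Cmod_ge_0 (f 1%nat 0%Z)).
  simpl in Hf; lra. }
apply Ccv_plus; apply (tannery _ _ A r Hr); auto; intros K n Hn.
- eapply Rle_trans; [apply Hf; lia|]; now rewrite Zabs2Nat.id; right.
- eapply Rle_trans; [apply Hf; lia|].
  replace (Z.abs_nat (- Z.of_nat (S n))) with (S n) by lia.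
  apply Rmult_le_compat_l; [lra|]; simpl.
  rewrite <- (Rmult_1_l (r ^ n)) at 2.
  apply Rmult_le_compat_r; [apply pow_le|]; lra.
Qed.

Lemma zdom_conv (a : Z -> C) : zdom a -> Ccv (zsum a) (CSeriesZ a).
Proof.
intros [A [r [Hr H]]].
exact (tannery_Z (fun _ => a) a A r Hr (fun _ k _ => H k) (fun k => Ccv_const (a k))).
Qed.

(** * Infinite products and integer powers *)

Lemma qpoch_fin_cprod (z q : C) (n : nat) :
  qpoch_fin z q n = cprod (fun k => 1 - z * q ^ k) n.
Proof. induction n as [|n IH]; simpl; [|rewrite IH]; reflexivity. Qed.

Lemma qpoch_fin_add (z q : C) (m n : nat) :
  qpoch_fin z q (m + n) = qpoch_fin z q m * qpoch_fin (z * q ^ m) q n.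
Proof.
rewrite !qpoch_fin_cprod, cprod_add; f_equal; apply cprod_ext; intros k _.
rewrite Cpow_add_r; ring.
Qed.

Lemma qpoch_fin_neq_0 (z q : C) (n : nat) :
  (forall k, 1 - z * q ^ k <> 0) -> qpoch_fin z q n <> 0.
Proof. intros H; rewrite qpoch_fin_cprod; apply cprod_neq_0; auto. Qed.

(** Each factor is at most 1 + |z||q|^k <= exp(|z||q|^k), and the exponents add up to a partial
    geometric sum. *)
Lemma qpoch_fin_upper (z q : C) (n : nat) :
  (Cmod q < 1)%R ->
  (Cmod (qpoch_fin z q n) <= exp (Cmod z * (1 - Cmod q ^ n) / (1 - Cmod q)))%R.
Proof.
intros Hq; induction n as [|n IH].
- simpl; rewrite Cmod_1; replace (Cmod z * (1 - 1) / (1 - Cmod q))%R with 0%R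
    by (field; lra); rewrite exp_0; lra.
- simpl qpoch_fin; rewrite Cmod_mult.
  replace (Cmod z * (1 - Cmod q ^ S n) / (1 - Cmod q))%R
    with (Cmod z * (1 - Cmod q ^ n) / (1 - Cmod q) + Cmod z * Cmod q ^ n)%R
    by (simpl; field; lra).
  rewrite exp_plus; apply Rmult_le_compat; try apply Cmod_ge_0; [exact IH|].
  eapply Rle_trans; [apply Cmod_triangle|].
  rewrite Cmod_1, Cmod_opp, Cmod_mult, Cmod_pow; apply exp_ineq1_le.
Qed.

Lemma qpoch_fin_bounded (z q : C) :
  (Cmod q < 1)%R ->
  exists M, (0 < M)%R /\ forall n, (Cmod (qpoch_fin z q n) <= M)%R.
Proof.
intros Hq; exists (exp (Cmod z / (1 - Cmod q))); split; [apply exp_pos|].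
intros n; eapply Rle_trans; [now apply qpoch_fin_upper|].
assert (E : (Cmod z * (1 - Cmod q ^ n) / (1 - Cmod q) <= Cmod z / (1 - Cmod q))%R).
{ unfold Rdiv; apply Rmult_le_compat_r; [left; apply Rinv_0_lt_compat; lra|].
  pose proof (Cmod_ge_0 z); pose proof (pow_le (Cmod q) n (Cmod_ge_0 q)); nra. }
destruct E as [E|E]; [left; now apply exp_increasing | rewrite E; right; reflexivity].
Qed.

(** Consecutive partial products differ by -P_n z q^n, which decays geometrically because P_n is
    bounded; the product is thus 1 plus a dominated series. *)
Lemma qpoch_cv (z q : C) :
  (Cmod q < 1)%R -> Ccv (qpoch_fin z q) (qpoch z q).
Proof.
intros Hq; destruct (qpoch_fin_bounded z q Hq) as [M [M0 HM]].
assert (H := geom_series_conv (fun n => - (qpoch_fin z q n * (z * q ^ n)))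
  (M * Cmod z) (Cmod q) (conj (Cmod_ge_0 q) Hq)).
assert (S : Ccv (qpoch_fin z q)
  (1 + CSeries (fun n => - (qpoch_fin z q n * (z * q ^ n))))).
{ apply (Ccv_ext (fun n => 1 + csum (fun n => - (qpoch_fin z q n * (z * q ^ n))) n)).
  - intros n; induction n as [|n IH]; simpl; [ring|].
    rewrite Cplus_assoc, IH; ring.
  - apply Ccv_plus; [apply Ccv_const|]; apply H; intros n.
    rewrite Cmod_opp, !Cmod_mult, Cmod_pow, Rmult_assoc.
    apply Rmult_le_compat_r; [|apply HM].
    apply Rmult_le_pos; [|apply pow_le]; apply Cmod_ge_0. }
unfold qpoch; rewrite (Ccv_CLim _ _ S); exact S.
Qed.

Lemma qpoch_shift (z q : C) (n : nat) :
  (Cmod q < 1)%R -> qpoch z q = qpoch_fin z q n * qpoch (z * q ^ n) q.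
Proof.
intros Hq; apply (Ccv_unique (fun k => qpoch_fin z q (n + k))).
- apply (Ccv_subseq _ _ (fun k => n + k)%nat); [|now apply qpoch_cv].
  intros N; exists N; intros; lia.
- apply (Ccv_ext (fun k => qpoch_fin z q n * qpoch_fin (z * q ^ n) q k)).
  + intros k; symmetry; apply qpoch_fin_add.
  + apply Ccv_scal, qpoch_cv, Hq.
Qed.

(* Weierstrass: a product of factors 1 - x_k is at least 1 - sum x_k. *)
Lemma qpoch_fin_lower (z q : C) (n : nat) :
  (Cmod q < 1)%R -> (Cmod z / (1 - Cmod q) <= / 2)%R ->
  (1 - Cmod z * (1 - Cmod q ^ n) / (1 - Cmod q) <= Cmod (qpoch_fin z q n))%R.
Proof.
intros Hq Hz; induction n as [|n IH].
- simpl; rewrite Cmod_1; unfold Rdiv; lra.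
- simpl qpoch_fin; rewrite Cmod_mult.
  assert (T := Cmod_triangle (1 - z * q ^ n) (z * q ^ n)).
  replace (1 - z * q ^ n + z * q ^ n) with (RtoC 1) in T by ring.
  rewrite Cmod_1, Cmod_mult, Cmod_pow in T.
  replace (Cmod z * (1 - Cmod q ^ S n) / (1 - Cmod q))%R
    with (Cmod z * (1 - Cmod q ^ n) / (1 - Cmod q) + Cmod z * Cmod q ^ n)%R
    by (simpl; field; lra).
  pose proof (Cmod_ge_0 z); pose proof (Cmod_ge_0 q).
  pose proof (pow_le (Cmod q) n (Cmod_ge_0 q)).
  assert (Cmod q ^ n <= 1)%R by (rewrite <- (pow1 n); apply pow_incr; lra).
  set (s := (Cmod z * (1 - Cmod q ^ n) / (1 - Cmod q))%R) in *.
  set (x := (Cmod z * Cmod q ^ n)%R) in *.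
  assert (0 <= s)%R.
  { unfold s, Rdiv; apply Rmult_le_pos; [nra | left; apply Rinv_0_lt_compat; lra]. }
  assert (0 <= x)%R by (unfold x; nra).
  assert (E : (s + x <= / 2)%R).
  { eapply Rle_trans; [|exact Hz].
    replace (s + x)%R with (Cmod z * (1 - Cmod q ^ S n) / (1 - Cmod q))%R
      by (unfold s, x; simpl; field; lra).
    unfold Rdiv; apply Rmult_le_compat_r; [left; apply Rinv_0_lt_compat; lra|].
    pose proof (pow_le (Cmod q) (S n) (Cmod_ge_0 q)); nra. }
  nra.
Qed.

(** Finitely many nonzero factors are split off until |z q^N| < (1 - |q|)/2. Weierstrass' bound then
    keeps all remaining partial products at modulus at least 1/2, so their limit cannot be 0. *)
Lemma qpoch_neq_0 (z q : C) :
  (Cmod q < 1)%R -> (forall k, 1 - z * q ^ k <> 0) -> qpoch z q <> 0.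
Proof.
intros Hq H.
assert (L := Ccv_scal z _ _ (Ccv_pow0 q Hq)).
destruct (proj1 (Ccv_eps _ _) L ((1 - Cmod q) / 2)%R ltac:(lra)) as [N HN].
rewrite (qpoch_shift z q N Hq); apply Cmult_neq_0; [now apply qpoch_fin_neq_0|].
specialize (HN N (Nat.le_refl N)); replace (z * q ^ N - z * 0) with (z * q ^ N) in HN by ring.
set (w := z * q ^ N) in *.
assert (Hw : (Cmod w / (1 - Cmod q) <= / 2)%R).
{ apply (Rmult_le_reg_r (1 - Cmod q)); [lra|].
  unfold Rdiv; rewrite Rmult_assoc, Rinv_l by lra; lra. }
intros E; assert (C := qpoch_cv w q Hq); rewrite E in C.
destruct (proj1 (Ccv_eps _ _) C (/ 2)%R ltac:(lra)) as [K HK].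
specialize (HK K (Nat.le_refl K)).
replace (qpoch_fin w q K - 0) with (qpoch_fin w q K) in HK by ring.
assert (B := qpoch_fin_lower w q K Hq Hw).
assert (Cmod w * (1 - Cmod q ^ K) / (1 - Cmod q) <= Cmod w / (1 - Cmod q))%R; [|lra].
unfold Rdiv; apply Rmult_le_compat_r; [left; apply Rinv_0_lt_compat; lra|].
pose proof (Cmod_ge_0 w); pose proof (pow_le (Cmod q) K (Cmod_ge_0 q)); nra.
Qed.

Lemma qpoch_fin_away (z q : C) :
  (Cmod q < 1)%R -> (forall k, 1 - z * q ^ k <> 0) ->
  exists m, (0 < m)%R /\ forall n, (m <= Cmod (qpoch_fin z q n))%R.
Proof.
intros Hq H; apply (Ccv_away _ (qpoch z q)).
- now apply qpoch_cv.
- now apply qpoch_neq_0.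
- intros n; now apply qpoch_fin_neq_0.
Qed.

Lemma Ccv_cprod (f : nat -> nat -> C) (g : nat -> C) (n : nat) :
  (forall k, (k < n)%nat -> Ccv (fun K => f K k) (g k)) ->
  Ccv (fun K => cprod (f K) n) (cprod g n).
Proof.
induction n as [|n IH]; intros H; simpl; [apply Ccv_const|].
apply Ccv_mult; auto.
Qed.

Lemma Cmod_pow_lt_1 (q : C) (n : nat) :
  (Cmod q < 1)%R -> (0 < n)%nat -> (Cmod (q ^ n) < 1)%R.
Proof.
intros Hq Hn; rewrite Cmod_pow; apply pow_lt_1_compat; [|exact Hn].
split; [apply Cmod_ge_0 | exact Hq].
Qed.

(** The first nK factors are grouped by the class of their exponent modulo n. *)
Lemma qpoch_dissect (z q : C) (n : nat) :
  (Cmod q < 1)%R -> (0 < n)%nat ->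
  qpoch z q = cprod (fun i => qpoch (z * q ^ i) (q ^ n)) n.
Proof.
intros Hq Hn; apply (Ccv_unique (fun K => qpoch_fin z q (n * K))).
- apply (Ccv_subseq _ _ (fun K => n * K)%nat); [|now apply qpoch_cv].
  intros N; exists N; intros; nia.
- apply (Ccv_ext (fun K => cprod (fun i => qpoch_fin (z * q ^ i) (q ^ n) K) n)).
  + intros K; induction K as [|K IH].
    * rewrite Nat.mul_0_r; simpl; clear Hn.
      induction n as [|n IH]; simpl; [reflexivity | rewrite IH; ring].
    * simpl qpoch_fin; rewrite cprod_mult, IH, Nat.mul_succ_r, qpoch_fin_add.
      f_equal; rewrite qpoch_fin_cprod; apply cprod_ext; intros i _.
      rewrite <- Cpow_mult_r; ring.
  + apply (Ccv_cprod (fun K i => qpoch_fin (z * q ^ i) (q ^ n) K)).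
    intros i _; apply qpoch_cv; now apply Cmod_pow_lt_1.
Qed.

(** * Integer powers and Gaussian weights *)

Lemma Cpowz_1_l (n : Z) : Cpowz 1 n = 1.
Proof.
destruct n; simpl; rewrite ?Cpow_1_l; [reflexivity | reflexivity | field].
Qed.

Lemma Cpowz_of_nat (z : C) (n : nat) : Cpowz z (Z.of_nat n) = z ^ n.
Proof. destruct n; simpl; [reflexivity | now rewrite SuccNat2Pos.id_succ]. Qed.

Lemma Cpowz_opp_nat (z : C) (n : nat) : Cpowz z (- Z.of_nat n) = / z ^ n.
Proof.
destruct n; simpl; [field | now rewrite SuccNat2Pos.id_succ].
Qed.

Lemma Cpowz_neq_0 (z : C) (n : Z) : z <> 0 -> Cpowz z n <> 0.
Proof.
intros Hz; destruct n; simpl; [apply C1_nz | now apply Cpow_nz|].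
now apply Cinv_neq_0, Cpow_nz.
Qed.

Lemma Cpowz_succ (z : C) (n : Z) : z <> 0 -> Cpowz z (n + 1) = Cpowz z n * z.
Proof.
intros Hz; destruct (Z_le_gt_dec 0 n) as [H|H].
- rewrite <- (Z2Nat.id n H); replace (Z.of_nat (Z.to_nat n) + 1)%Z
    with (Z.of_nat (S (Z.to_nat n))) by lia.
  rewrite !Cpowz_of_nat, Cpow_S; ring.
- replace n with (- Z.of_nat (S (Z.to_nat (- n - 1))))%Z at 2 by lia.
  replace (n + 1)%Z with (- Z.of_nat (Z.to_nat (- n - 1)))%Z by lia.
  rewrite !Cpowz_opp_nat, Cpow_S; field; split; [now apply Cpow_nz | exact Hz].
Qed.

Lemma Cpowz_add (z : C) (m n : Z) :
  z <> 0 -> Cpowz z (m + n) = Cpowz z m * Cpowz z n.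
Proof.
intros Hz; revert n; apply Z.bi_induction.
- intros ? ? ->; reflexivity.
- rewrite Z.add_0_r; simpl; ring.
- intros n; unfold Z.succ; rewrite Z.add_assoc, !Cpowz_succ by exact Hz; split.
  + intros ->; ring.
  + intros E; apply (f_equal (fun x => x * / z)) in E.
    replace (Cpowz z (m + n) * z * / z) with (Cpowz z (m + n)) in E by (field; auto).
    rewrite E; field; exact Hz.
Qed.

Lemma Cpowz_opp (z : C) (n : Z) : z <> 0 -> Cpowz z (- n) = / Cpowz z n.
Proof.
intros Hz; assert (E := Cpowz_add z n (- n) Hz).
rewrite Z.add_opp_diag_r in E; simpl in E.
assert (N := Cpowz_neq_0 z n Hz).
replace (Cpowz z (- n)) with (Cpowz z n * Cpowz z (- n) * / Cpowz z n)
  by (field; exact N).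
rewrite <- E; ring.
Qed.

Lemma Cpowz_sub (z : C) (m n : Z) :
  z <> 0 -> Cpowz z (m - n) = Cpowz z m / Cpowz z n.
Proof. intros Hz; unfold Z.sub; rewrite Cpowz_add, Cpowz_opp by exact Hz; reflexivity. Qed.

Lemma Cpowz_mul (z : C) (m n : Z) :
  z <> 0 -> Cpowz z (m * n) = Cpowz (Cpowz z m) n.
Proof.
intros Hz; assert (N := Cpowz_neq_0 z m Hz); revert n; apply Z.bi_induction.
- intros ? ? ->; reflexivity.
- rewrite Z.mul_0_r; reflexivity.
- intros n; unfold Z.succ.
  rewrite Z.mul_add_distr_l, Z.mul_1_r, Cpowz_add, Cpowz_succ by assumption; split.
  + intros ->; ring.
  + intros E; apply (f_equal (fun x => x * / Cpowz z m)) in E.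
    replace (Cpowz z (m * n) * Cpowz z m * / Cpowz z m) with (Cpowz z (m * n)) in E
      by (field; auto).
    rewrite E; field; exact N.
Qed.

Lemma Cpowz_mult_l (y z : C) (n : Z) :
  y <> 0 -> z <> 0 -> Cpowz (y * z) n = Cpowz y n * Cpowz z n.
Proof.
intros Hy Hz; assert (N := Cmult_neq_0 _ _ Hy Hz).
assert (Hs : forall n, Cpowz y (- n) * Cpowz z (- n) = / (Cpowz y n * Cpowz z n)).
{ intros m; rewrite !Cpowz_opp by assumption.
  field; split; now apply Cpowz_neq_0. }
destruct (Z_le_gt_dec 0 n) as [H|H].
- rewrite <- (Z2Nat.id n H), !Cpowz_of_nat; apply Cpow_mult_l.
- replace n with (- Z.of_nat (Z.to_nat (- n)))%Z by lia.
  rewrite Hs, Cpowz_opp, !Cpowz_of_nat, Cpow_mult_l by assumption; reflexivity.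
Qed.

Lemma Cpowz_pow (z : C) (m : nat) (n : Z) :
  z <> 0 -> Cpowz (z ^ m) n = Cpowz z (Z.of_nat m * n).
Proof. intros Hz; rewrite Cpowz_mul, Cpowz_of_nat by exact Hz; reflexivity. Qed.

Lemma Cpowz_inj_1 (q : C) (n : Z) :
  (0 < Cmod q < 1)%R -> Cpowz q n = 1 -> n = 0%Z.
Proof.
intros Hq E; assert (q0 : q <> 0) by (apply Cmod_gt_0; lra).
assert (F : forall k, Cpowz q (Z.of_nat (S k)) <> 1).
{ intros k H; rewrite Cpowz_of_nat in H.
  assert (L := Cmod_pow_lt_1 q (S k) ltac:(lra) ltac:(lia)).
  rewrite H, Cmod_1 in L; lra. }
destruct (Z.lt_trichotomy n 0) as [H|[H|H]]; [|exact H|].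
- exfalso; apply (F (Z.to_nat (- n - 1))).
  replace (Z.of_nat (S (Z.to_nat (- n - 1)))) with (- n)%Z by lia.
  rewrite Cpowz_opp, E by exact q0; field.
- exfalso; apply (F (Z.to_nat (n - 1))).
  replace (Z.of_nat (S (Z.to_nat (n - 1)))) with n by lia; exact E.
Qed.

Lemma Cmod_Cpowz (q : C) (n : Z) :
  q <> 0 -> RtoC (Cmod (Cpowz q n)) = Cpowz (RtoC (Cmod q)) n.
Proof.
intros Hq; destruct n; simpl; [now rewrite Cmod_1| |].
- rewrite Cmod_pow; apply RtoC_pow.
- rewrite Cmod_inv, Cmod_pow by now apply Cpow_nz.
  rewrite RtoC_inv, RtoC_pow; [reflexivity|].
  apply pow_nonzero; apply Cmod_gt_0 in Hq; lra.
Qed.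

(** After multiplication by 2^n the left side is (2 W p^n)^n. It is at most 1 as soon as 2 W p^n <=
    1, and before that rank N it is at most B^N with B = max(1, 2W). *)
Lemma gauss_bound (p W : R) :
  (0 <= p < 1)%R -> (0 <= W)%R ->
  exists A, (0 < A)%R /\ forall n, (p ^ (n * n) * W ^ n <= A * (/ 2) ^ n)%R.
Proof.
intros Hp HW.
assert (L : is_lim_seq (fun n => (2 * W * p ^ n)%R) (2 * W * 0)%R).
{ apply (is_lim_seq_mult' (fun _ => (2 * W)%R)); [apply is_lim_seq_const|].
  apply is_lim_seq_geom; rewrite Rabs_pos_eq; lra. }
apply is_lim_seq_spec in L; destruct (L (mkposreal 1 Rlt_0_1)) as [N HN].
assert (HN' : forall n, (N <= n)%nat -> (0 <= 2 * W * p ^ n <= 1)%R).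
{ intros n Hn; specialize (HN n Hn); simpl in HN; apply Rabs_def2 in HN.
  pose proof (pow_le p n ltac:(lra)); split; [|lra]; nra. }
set (B := Rmax 1 (2 * W)).
assert (B1 : (1 <= B)%R) by apply Rmax_l.
assert (B2 : (2 * W <= B)%R) by apply Rmax_r.
exists (B ^ N)%R; split; [apply pow_lt; lra|].
intros n; apply (Rmult_le_reg_r (2 ^ n)); [apply pow_lt; lra|].
rewrite (Rmult_assoc (B ^ N)), <- Rpow_mult_distr, Rinv_l, pow1, Rmult_1_r by lra.
replace (p ^ (n * n) * W ^ n * 2 ^ n)%R with ((2 * W * p ^ n) ^ n)%R
  by (rewrite !Rpow_mult_distr, pow_mult; ring).
destruct (le_lt_dec N n) as [Hn|Hn].
- apply Rle_trans with 1%R.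
  + rewrite <- (pow1 n); apply pow_incr, HN', Hn.
  + apply pow_R1_Rle, B1.
- apply Rle_trans with (B ^ n)%R.
  + apply pow_incr; split.
    * apply Rmult_le_pos; [lra | apply pow_le; lra].
    * pose proof (pow_le p n ltac:(lra)).
      assert (p ^ n <= 1)%R by (rewrite <- (pow1 n); apply pow_incr; lra).
      nra.
  + apply Rle_pow; [exact B1 | lia].
Qed.

(** The half k >= 0 is bounded with W = |w|, the half k < 0 with W = 1/|w|. *)
Lemma gauss_zdom (p w : C) :
  (0 < Cmod p < 1)%R -> w <> 0 -> zdom (fun k => Cpowz p (k * k) * Cpowz w k).
Proof.
intros Hp Hw; assert (w0 := proj1 (Cmod_gt_0 w) Hw).
destruct (gauss_bound (Cmod p) (Cmod w) ltac:(lra) ltac:(lra)) as [A [A0 HA]].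
destruct (gauss_bound (Cmod p) (/ Cmod w) ltac:(lra)
  ltac:(left; now apply Rinv_0_lt_compat)) as [B [B0 HB]].
exists (A + B)%R, (/ 2)%R; split; [lra|].
intros k; assert (P := pow_lt (/ 2) (Z.abs_nat k) ltac:(lra)).
replace (k * k)%Z with (Z.of_nat (Z.abs_nat k * Z.abs_nat k)) by lia.
rewrite Cpowz_of_nat, Cmod_mult, Cmod_pow.
destruct (Z_le_gt_dec 0 k) as [H|H].
- replace k with (Z.of_nat (Z.abs_nat k)) at 3 by lia.
  rewrite Cpowz_of_nat, Cmod_pow.
  specialize (HA (Z.abs_nat k)); nra.
- replace k with (- Z.of_nat (Z.abs_nat k))%Z at 3 by lia.
  rewrite Cpowz_opp_nat, Cmod_inv, Cmod_pow, <- pow_inv by now apply Cpow_nz.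
  specialize (HB (Z.abs_nat k)); nra.
Qed.

Lemma zdom_le (a b : Z -> C) :
  (forall k, (Cmod (a k) <= Cmod (b k))%R) -> zdom b -> zdom a.
Proof.
intros H [A [r [Hr HA]]]; exists A, r; split; [exact Hr|].
intros k; eapply Rle_trans; [apply H | apply HA].
Qed.

Lemma zdom_comp (a : Z -> C) (f : Z -> Z) :
  (forall k, (Z.abs_nat k <= Z.abs_nat (f k))%nat) -> zdom a -> zdom (fun k => a (f k)).
Proof.
intros Hf [A [r [Hr HA]]]; exists A, r; split; [exact Hr|]; intros k.
eapply Rle_trans; [apply HA|].
assert (A0 : (0 <= A)%R).
{ specialize (HA 0%Z); pose proof (Cmod_ge_0 (a 0%Z)); simpl in HA; lra. }
apply Rmult_le_compat_l; [exact A0|].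
set (d := (Z.abs_nat (f k) - Z.abs_nat k)%nat).
replace (Z.abs_nat (f k)) with (Z.abs_nat k + d)%nat by (specialize (Hf k); lia).
rewrite pow_add; pose proof (pow_le r (Z.abs_nat k) ltac:(lra)).
assert (r ^ d <= 1)%R by (rewrite <- (pow1 d); apply pow_incr; lra).
nra.
Qed.

Lemma zdom_mult_bounded (a b : Z -> C) (M : R) :
  (forall k, (Cmod (b k) <= M)%R) -> zdom a -> zdom (fun k => a k * b k).
Proof.
intros H [A [r [Hr HA]]]; exists (A * M)%R, r; split; [exact Hr|].
intros k; rewrite Cmod_mult.
replace (A * M * r ^ Z.abs_nat k)%R with (A * r ^ Z.abs_nat k * M)%R by ring.
apply Rmult_le_compat; try apply Cmod_ge_0; auto.
Qed.

Lemma zdom_scal (c : C) (a : Z -> C) : zdom a -> zdom (fun k => c * a k).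
Proof.
intros H; destruct (zdom_mult_bounded a (fun _ => c) (Cmod c)
  (fun _ => Rle_refl _) H) as [A [r [Hr HA]]].
exists A, r; split; [exact Hr|]; intros k; rewrite Cmult_comm; apply HA.
Qed.

Lemma zdom_cv0 (a : Z -> C) :
  zdom a -> Ccv (fun K => a (Z.of_nat K)) 0 /\ Ccv (fun K => a (- Z.of_nat K)%Z) 0.
Proof.
intros [A [r [Hr H]]].
assert (L : is_lim_seq (fun n => (A * r ^ n)%R) 0%R).
{ replace (Finite 0) with (Finite (A * 0)) by (f_equal; ring).
  apply (is_lim_seq_mult' (fun _ => A)); [apply is_lim_seq_const|].
  apply is_lim_seq_geom; rewrite Rabs_pos_eq; lra. }
split; (apply Ccv_squeeze with (fun n => (A * r ^ n)%R); [|exact L]); intros n.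
- replace (a (Z.of_nat n) - 0) with (a (Z.of_nat n)) by ring.
  specialize (H (Z.of_nat n)); now replace (Z.abs_nat (Z.of_nat n)) with n in H by lia.
- replace (a (- Z.of_nat n)%Z - 0) with (a (- Z.of_nat n)%Z) by ring.
  specialize (H (- Z.of_nat n)%Z).
  now replace (Z.abs_nat (- Z.of_nat n)) with n in H by lia.
Qed.

(** The window -K <= k < K is not symmetric: negation trades its end -K for K. Both boundary terms
    vanish in the limit. *)
Lemma zsum_opp (a : Z -> C) (K : nat) :
  zsum (fun k => a (- k)%Z) K = zsum a K + a (Z.of_nat K) - a (- Z.of_nat K)%Z.
Proof.
induction K as [|K IH]; [unfold zsum; simpl; ring|].
unfold zsum in *; cbn [csum]; rewrite IH.
rewrite Z.opp_involutive; ring.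
Qed.

Lemma CSeriesZ_opp (a : Z -> C) :
  zdom a -> CSeriesZ (fun k => a (- k)%Z) = CSeriesZ a.
Proof.
intros H; assert (H' : zdom (fun k => a (- k)%Z)).
{ apply (zdom_comp a Z.opp); [intros; lia | exact H]. }
apply (Ccv_unique (zsum (fun k => a (- k)%Z))); [now apply zdom_conv|].
destruct (zdom_cv0 a H) as [P N].
apply (Ccv_ext (fun K => zsum a K + a (Z.of_nat K) - a (- Z.of_nat K)%Z)).
- intros K; symmetry; apply zsum_opp.
- replace (CSeriesZ a) with (CSeriesZ a + 0 - 0) by ring.
  apply Ccv_minus; [apply Ccv_plus; [now apply zdom_conv|]|]; assumption.
Qed.

Lemma CSeriesZ_ext (a b : Z -> C) :
  (forall k, a k = b k) -> zdom a -> CSeriesZ a = CSeriesZ b.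
Proof.
intros E H; apply (Ccv_unique (zsum a)); [now apply zdom_conv|].
apply (Ccv_ext (zsum b)).
- intros K; apply zsum_ext; intros; symmetry; apply E.
- apply zdom_conv; apply (zdom_le _ a); [|exact H]; intros k; rewrite E; lra.
Qed.

Lemma CSeriesZ_scal (c : C) (a : Z -> C) :
  zdom a -> CSeriesZ (fun k => c * a k) = c * CSeriesZ a.
Proof.
intros H; apply (Ccv_unique (zsum (fun k => c * a k))).
- now apply zdom_conv, zdom_scal.
- apply (Ccv_ext (fun K => c * zsum a K)).
  + intros K; symmetry; apply zsum_scal.
  + now apply Ccv_scal, zdom_conv.
Qed.

(** * Partial fractions *)

Fixpoint lsum {A : Type} (f : A -> C) (l : list A) : C :=
  match l with nil => 0 | x :: l' => f x + lsum f l' end.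

Fixpoint lprod {A : Type} (f : A -> C) (l : list A) : C :=
  match l with nil => 1 | x :: l' => f x * lprod f l' end.

Lemma lsum_ext {A : Type} (f g : A -> C) (l : list A) :
  (forall x, In x l -> f x = g x) -> lsum f l = lsum g l.
Proof.
induction l as [|x l IH]; intros H; simpl; [reflexivity|].
rewrite IH, H; [reflexivity | now left | intros; apply H; now right].
Qed.

Lemma lprod_ext {A : Type} (f g : A -> C) (l : list A) :
  (forall x, In x l -> f x = g x) -> lprod f l = lprod g l.
Proof.
induction l as [|x l IH]; intros H; simpl; [reflexivity|].
rewrite IH, H; [reflexivity | now left | intros; apply H; now right].
Qed.

Lemma lsum_plus {A : Type} (f g : A -> C) (l : list A) :
  lsum (fun x => f x + g x) l = lsum f l + lsum g l.
Proof. induction l as [|x l IH]; simpl; [|rewrite IH]; ring. Qed.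

Lemma lsum_scal {A : Type} (c : C) (f : A -> C) (l : list A) :
  lsum (fun x => c * f x) l = c * lsum f l.
Proof. induction l as [|x l IH]; simpl; [|rewrite IH]; ring. Qed.

Lemma lprod_mult {A : Type} (f g : A -> C) (l : list A) :
  lprod (fun x => f x * g x) l = lprod f l * lprod g l.
Proof. induction l as [|x l IH]; simpl; [|rewrite IH]; ring. Qed.

Lemma lprod_neq_0 {A : Type} (f : A -> C) (l : list A) :
  (forall x, In x l -> f x <> 0) -> lprod f l <> 0.
Proof.
induction l as [|x l IH]; intros H; simpl; [apply C1_nz|].
apply Cmult_neq_0; [apply H; now left | apply IH; intros; apply H; now right].
Qed.

Lemma lsum_map {A B : Type} (f : B -> C) (h : A -> B) (l : list A) :
  lsum f (map h l) = lsum (fun x => f (h x)) l.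
Proof. induction l as [|x l IH]; simpl; [|rewrite IH]; reflexivity. Qed.

Lemma lprod_map {A B : Type} (f : B -> C) (h : A -> B) (l : list A) :
  lprod f (map h l) = lprod (fun x => f (h x)) l.
Proof. induction l as [|x l IH]; simpl; [|rewrite IH]; reflexivity. Qed.

Lemma lsum_app {A : Type} (f : A -> C) (l l' : list A) :
  lsum f (l ++ l') = lsum f l + lsum f l'.
Proof. induction l as [|x l IH]; simpl; [|rewrite IH]; ring. Qed.

Lemma lprod_app {A : Type} (f : A -> C) (l l' : list A) :
  lprod f (l ++ l') = lprod f l * lprod f l'.
Proof. induction l as [|x l IH]; simpl; [|rewrite IH]; ring. Qed.

Lemma lsum_flat_map {A B : Type} (f : B -> C) (h : A -> list B) (l : list A) :
  lsum f (flat_map h l) = lsum (fun x => lsum f (h x)) l.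
Proof.
induction l as [|x l IH]; simpl; [reflexivity | rewrite lsum_app, IH; reflexivity].
Qed.

Lemma lprod_flat_map {A B : Type} (f : B -> C) (h : A -> list B) (l : list A) :
  lprod f (flat_map h l) = lprod (fun x => lprod f (h x)) l.
Proof.
induction l as [|x l IH]; simpl; [reflexivity | rewrite lprod_app, IH; reflexivity].
Qed.

Lemma lprod_perm {A : Type} (f : A -> C) (l l' : list A) :
  Permutation l l' -> lprod f l = lprod f l'.
Proof. induction 1; simpl; try congruence; ring. Qed.

Lemma lsum_perm {A : Type} (f : A -> C) (l l' : list A) :
  Permutation l l' -> lsum f l = lsum f l'.
Proof. induction 1; simpl; try congruence; ring. Qed.

Lemma lsum_seq (f : nat -> C) (n : nat) : lsum f (seq 0 n) = csum f n.
Proof.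
induction n as [|n IH]; [reflexivity|].
rewrite seq_S, lsum_app, IH; simpl; ring.
Qed.

Lemma lprod_seq (f : nat -> C) (n : nat) : lprod f (seq 0 n) = cprod f n.
Proof.
induction n as [|n IH]; [reflexivity|].
rewrite seq_S, lprod_app, IH; simpl; ring.
Qed.

(** * Divided differences and Lagrange's formula *)

Lemma Csub_neq_0 (x y : C) : x <> y -> x - y <> 0.
Proof.
intros E H; apply E; replace x with (x - y + y) by ring; rewrite H; ring.
Qed.

(** The value 1 on the diagonal lets a product run over the whole list of nodes, the node y
    included, with the same result as over the other nodes. *)
Definition cdiff (y y' : C) : C := if Ceq_dec y y' then 1 else y - y'.

Lemma cdiff_neq_0 (y y' : C) : cdiff y y' <> 0.
Proof.
unfold cdiff; destruct (Ceq_dec y y') as [E|E]; [apply C1_nz|].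
now apply Csub_neq_0.
Qed.

(* Meaningful only for distinct nodes: a repeated node is not a higher-order one. *)
Definition divdiff (f : C -> C) (l : list C) : C :=
  lsum (fun y => f y / lprod (cdiff y) l) l.

Lemma lprod_cdiff_neq_0 (y : C) (l : list C) : lprod (cdiff y) l <> 0.
Proof. apply lprod_neq_0; intros; apply cdiff_neq_0. Qed.

Lemma divdiff_perm (f : C -> C) (l l' : list C) :
  Permutation l l' -> divdiff f l = divdiff f l'.
Proof.
intros P; unfold divdiff; rewrite (lsum_perm _ _ _ P).
apply lsum_ext; intros y _; now rewrite (lprod_perm _ _ _ P).
Qed.

Lemma divdiff_lin (a b : C) (f g : C -> C) (l : list C) :
  divdiff (fun y => a * f y + b * g y) l = a * divdiff f l + b * divdiff g l.
Proof.
unfold divdiff; rewrite <- !lsum_scal, <- lsum_plus; apply lsum_ext.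
intros y _; unfold Cdiv; ring.
Qed.

(** The factor y - y0 kills the summand at y0 and cancels the difference to y0 in every other
    denominator. *)
Lemma divdiff_cons (f : C -> C) (y0 : C) (l : list C) :
  NoDup (y0 :: l) -> divdiff (fun y => (y - y0) * f y) (y0 :: l) = divdiff f l.
Proof.
intros N; inversion_clear N as [|? ? N1 N2]; unfold divdiff; simpl lsum.
replace (y0 - y0) with (RtoC 0) by ring; unfold Cdiv; rewrite !Cmult_0_l, Cplus_0_l.
apply lsum_ext; intros y Hy; simpl; unfold cdiff at 1.
destruct (Ceq_dec y y0) as [->|E]; [contradiction|].
assert (H := Csub_neq_0 _ _ E).
pose proof (lprod_cdiff_neq_0 y l); field; auto.
Qed.

(** Write y1 - y0 = (y - y0) - (y - y1). Each part drops one node and vanishes by induction on the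
    length, so (y1 - y0) times the divided difference is 0. *)
Lemma divdiff_const (y0 y1 : C) (l : list C) :
  NoDup (y0 :: y1 :: l) -> divdiff (fun _ => 1) (y0 :: y1 :: l) = 0.
Proof.
remember (length l) as n eqn:Hn; revert y0 y1 l Hn.
induction n as [|n IH]; intros y0 y1 l Hn N.
- destruct l; [|discriminate]; unfold divdiff, cdiff; simpl.
  destruct (Ceq_dec y0 y0), (Ceq_dec y1 y1), (Ceq_dec y0 y1), (Ceq_dec y1 y0);
    try contradiction; subst.
  + inversion_clear N as [|? ? N1 N2]; exfalso; apply N1; now left.
  + contradiction.
  + contradiction.
  + field; split; now apply Csub_neq_0.
- assert (N' : NoDup (y1 :: y0 :: l)) by (apply (Permutation_NoDup (perm_swap y1 y0 l) N)).
  assert (D0 := divdiff_cons (fun _ => 1) _ _ N).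
  assert (D1 := divdiff_cons (fun _ => 1) _ _ N').
  destruct l as [|y2 l]; [discriminate|].
  injection Hn as Hn.
  rewrite (IH y1 y2 l Hn) in D0 by (now inversion_clear N).
  rewrite (IH y0 y2 l Hn) in D1 by (now inversion_clear N').
  rewrite (divdiff_perm _ _ _ (perm_swap y0 y1 (y2 :: l))) in D1.
  assert (E := divdiff_lin 1 (- (1)) (fun y => (y - y0) * 1) (fun y => (y - y1) * 1)
    (y0 :: y1 :: y2 :: l)); cbv beta in E; rewrite D0, D1 in E.
  assert (E' := divdiff_lin (y1 - y0) 0 (fun _ => 1) (fun _ => 1)
    (y0 :: y1 :: y2 :: l)); cbv beta in E'.
  assert (Y : y1 - y0 <> 0).
  { apply Csub_neq_0; intros ->; inversion_clear N as [|? ? N1 N2].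
    apply N1; now left. }
  set (d := divdiff (fun _ => 1) (y0 :: y1 :: y2 :: l)) in *.
  assert (Z : (y1 - y0) * d = 0).
  { replace ((y1 - y0) * d) with ((y1 - y0) * d + 0 * d) by ring.
    rewrite <- E'; etransitivity; [|etransitivity; [exact E | ring]].
    unfold divdiff; apply lsum_ext; intros y _; unfold Cdiv; ring. }
  replace d with (((y1 - y0) * d) * / (y1 - y0)) by (field; exact Y).
  rewrite Z; ring.
Qed.

(* Lagrange: the divided difference of a polynomial of degree at most
   length l - 2 vanishes; the polynomial is given by linear factors. *)
Lemma divdiff_poly (fs : list (C * C)) (l : list C) :
  NoDup l -> (length fs + 2 <= length l)%nat ->
  divdiff (fun y => lprod (fun cd => fst cd + snd cd * y) fs) l = 0.
Proof.
revert l; induction fs as [|[c d] fs IH]; intros l N L; simpl in L.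
- destruct l as [|y0 [|y1 l]]; simpl in L; try lia.
  exact (divdiff_const y0 y1 l N).
- destruct l as [|y0 l]; simpl in L; [lia|].
  set (g := fun y => lprod (fun cd => fst cd + snd cd * y) fs).
  (* The linear factor is expanded at y0: the first summand loses a factor, the second a factor and
     a node, so the degree bound persists in both. *)
  transitivity (divdiff (fun y => (c + d * y0) * g y + d * ((y - y0) * g y)) (y0 :: l)).
  + unfold divdiff; apply lsum_ext; intros y _; simpl; fold (g y); f_equal; ring.
  + rewrite (divdiff_lin (c + d * y0) d g (fun y => (y - y0) * g y)).
    rewrite divdiff_cons by exact N.
    unfold g; rewrite !IH; [ring | now inversion_clear N | lia | exact N | simpl; lia].
Qed.

(** The multiplicative counterpart of [cdiff]: the vanishing factor at n = 0 is replaced by 1. *)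
Definition onesub (q : C) (n : Z) : C := if Z.eq_dec n 0 then 1 else 1 - Cpowz q n.

Lemma onesub_neq_0 (q : C) (n : Z) : (0 < Cmod q < 1)%R -> onesub q n <> 0.
Proof.
intros Hq; unfold onesub; destruct (Z.eq_dec n 0) as [E|E]; [apply C1_nz|].
intros H; apply E, (Cpowz_inj_1 q n Hq); symmetry.
rewrite <- (Cplus_0_r (Cpowz q n)), <- H; ring.
Qed.

Lemma Cpowz_inj (q : C) (m n : Z) :
  (0 < Cmod q < 1)%R -> Cpowz q m = Cpowz q n -> m = n.
Proof.
intros Hq E; assert (q0 : q <> 0) by (apply Cmod_gt_0; lra).
assert (m - n = 0)%Z; [|lia].
apply (Cpowz_inj_1 q _ Hq); rewrite Cpowz_sub, E by exact q0.
field; now apply Cpowz_neq_0.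
Qed.

(** Lagrange's formula for y^e prod (1 - q^a y) at the nodes q^(-b) together with the node 1, which
    is the exponent 0. The summand at 1 becomes the left side, the other summands the right side;
    the factor 1/(1 - q^b) comes from the difference to the node 1. *)
Lemma partial_fractions (q : C) (e : nat) (As Bs : list Z) :
  (0 < Cmod q < 1)%R -> NoDup (0%Z :: Bs) -> (e + length As < length Bs)%nat ->
  lprod (fun a => 1 - Cpowz q a) As / lprod (fun b => 1 - Cpowz q b) Bs =
  lsum (fun b => Cpowz q (- (Z.of_nat e * b))
                 * lprod (fun a => 1 - Cpowz q (a - b)) As
                 / lprod (fun b' => onesub q (b' - b)) Bs / (1 - Cpowz q b)) Bs.
Proof.
intros Hq N L; assert (q0 : q <> 0) by (apply Cmod_gt_0; lra).
set (node := fun b : Z => Cpowz q (- b)).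
assert (Nd : NoDup (map node (0%Z :: Bs))).
{ apply (FinFun.Injective_map_NoDup (f := node)); [|exact N].
  intros m n E; apply (Cpowz_inj q _ _ Hq) in E; lia. }
(* The pair (0, 1) encodes the factor y, the pair (1, -q^a) the factor 1 - q^a y. *)
set (fs := repeat (RtoC 0, RtoC 1) e ++ map (fun a => (RtoC 1, - Cpowz q a)) As).
assert (D := divdiff_poly fs _ Nd).
unfold fs in D at 1; rewrite length_app, repeat_length, !length_map in D.
specialize (D ltac:(simpl; lia)).
assert (F : forall b, lprod (fun cd => fst cd + snd cd * node b) fs
  = Cpowz q (- (Z.of_nat e * b)) * lprod (fun a => 1 - Cpowz q (a - b)) As).
{ intros b; unfold fs; rewrite lprod_app, lprod_map; f_equal.
  - transitivity (node b ^ e).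
    + clear; induction e as [|e IH]; simpl; [reflexivity | rewrite IH; ring].
    + unfold node; rewrite <- Cpowz_of_nat, <- Cpowz_mul by exact q0; f_equal; lia.
  - apply lprod_ext; intros a _; simpl; unfold node.
    replace (a - b)%Z with (a + - b)%Z by lia.
    rewrite Cpowz_add by exact q0; ring. }
set (c := lprod (fun b' => - node b') (0%Z :: Bs)).
assert (c0 : c <> 0).
{ apply lprod_neq_0; intros b _ H; apply (Cpowz_neq_0 q (- b) q0); fold (node b).
  replace (node b) with (- - node b) by ring; rewrite H; ring. }
(* Since q^(-b) - q^(-b') = -q^(-b') (1 - q^(b'-b)), the prefactors multiply to the constant c,
   except that the diagonal factor is 1; dividing c by -q^(-b) accounts for -q^b. *)
assert (G : forall b, In b (0%Z :: Bs) -> lprod (cdiff (node b)) (map node (0%Z :: Bs))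
  = c * - Cpowz q b * lprod (fun b' => onesub q (b' - b)) (0%Z :: Bs)).
{ intros b; unfold c; rewrite lprod_map; generalize (0%Z :: Bs) N; clear - q0 Hq.
  assert (Same : forall l, ~ In b l ->
    lprod (fun b' => cdiff (node b) (node b')) l
    = lprod (fun b' => - node b') l * lprod (fun b' => onesub q (b' - b)) l).
  { intros l Nb; rewrite <- lprod_mult; apply lprod_ext; intros b' Hb'.
    unfold cdiff, onesub; destruct (Ceq_dec (node b) (node b')) as [E|E].
    - apply (Cpowz_inj q _ _ Hq) in E.
      exfalso; apply Nb; now replace b with b' by lia.
    - destruct (Z.eq_dec (b' - b) 0) as [E'|E'].
      + exfalso; apply Nb; now replace b with b' by lia.
      + unfold node; replace (b' - b)%Z with (b' + - b)%Z by lia.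
        rewrite Cpowz_add, !Cpowz_opp by exact q0.
        field; split; now apply Cpowz_neq_0. }
  intros l N Hb; induction l as [|b' l IH]; [contradiction|].
  inversion_clear N as [|? ? N1 N2]; simpl.
  destruct (Z.eq_dec b' b) as [->|E].
  - rewrite Same by exact N1; unfold cdiff, onesub.
    destruct (Ceq_dec (node b) (node b)); [|contradiction].
    destruct (Z.eq_dec (b - b) 0); [|lia].
    assert (En : node b = / Cpowz q b) by now apply Cpowz_opp.
    rewrite En; field; now apply Cpowz_neq_0.
  - destruct Hb as [Hb|Hb]; [contradiction|].
    rewrite IH by assumption.
    unfold cdiff, onesub; destruct (Ceq_dec (node b) (node b')) as [E'|E'].
    { apply (Cpowz_inj q _ _ Hq) in E'; exfalso; lia. }
    destruct (Z.eq_dec (b' - b) 0); [lia|].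
    assert (En : forall n, node n = / Cpowz q n) by (intros; now apply Cpowz_opp).
    rewrite (En b), (En b'); replace (b' - b)%Z with (b' + - b)%Z by lia.
    rewrite Cpowz_add, !Cpowz_opp by exact q0.
    field; split; now apply Cpowz_neq_0. }
assert (P0 : forall b l, lprod (fun b' => onesub q (b' - b)) l <> 0).
{ intros; apply lprod_neq_0; intros; now apply onesub_neq_0. }
unfold divdiff in D; rewrite lsum_map in D.
rewrite (lsum_ext _ (fun b => / c * (- Cpowz q (- b)
   * (Cpowz q (- (Z.of_nat e * b)) * lprod (fun a => 1 - Cpowz q (a - b)) As
   / lprod (fun b' => onesub q (b' - b)) (0%Z :: Bs))))) in D.
2:{ intros b Hb; rewrite F, G by exact Hb; rewrite (Cpowz_opp q b) by exact q0.
    field; repeat split; [apply P0 | now apply Cpowz_neq_0 | exact c0]. }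
rewrite lsum_scal in D; cbn [lsum] in D.
assert (Nb : forall b, In b Bs -> b <> 0%Z).
{ intros b Hb ->; inversion_clear N as [|? ? N1 N2]; contradiction. }
rewrite (lsum_ext _ (fun b => Cpowz q (- (Z.of_nat e * b))
   * lprod (fun a => 1 - Cpowz q (a - b)) As
   / lprod (fun b' => onesub q (b' - b)) Bs / (1 - Cpowz q b))) in D.
2:{ intros b Hb; specialize (Nb b Hb); cbn [lprod].
    assert (O : onesub q (0 - b) = 1 - Cpowz q (- b)).
    { unfold onesub; destruct (Z.eq_dec (0 - b) 0); [lia|]; reflexivity. }
    assert (O0 := onesub_neq_0 q (0 - b) Hq); rewrite O in O0.
    rewrite (Cpowz_opp q b) in * by exact q0; rewrite O.
    assert (B0 := Cpowz_neq_0 q b q0).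
    assert (1 - Cpowz q b <> 0).
    { intros H; apply O0; replace (Cpowz q b) with (1 - (1 - Cpowz q b)) by ring.
      rewrite H; field; apply C1_nz. }
    field; repeat split; auto.
    intros H1; apply H; replace (1 - Cpowz q b) with (- (Cpowz q b - 1)) by ring.
    rewrite H1; ring. }
assert (D' : forall x s : C, / c * (x + s) = 0 -> s = - x).
{ intros x s H; replace s with (c * (/ c * (x + s)) - x) by (field; exact c0).
  rewrite H; ring. }
apply D' in D; rewrite D; replace (Z.of_nat e * 0)%Z with 0%Z by lia; simpl.
change (if Z.eq_dec 0 0 then _ else _) with (RtoC 1).
unfold onesub at 1; simpl.
rewrite (lprod_ext (fun a => 1 - Cpowz q (a - 0)) (fun a => 1 - Cpowz q a))
  by (intros; f_equal; f_equal; f_equal; lia).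
rewrite (lprod_ext (fun b' => onesub q (b' - 0)) (fun b => 1 - Cpowz q b)).
- field.
  assert (P := P0 0%Z Bs); intros H; apply P; rewrite <- H; apply lprod_ext.
  intros b Hb; specialize (Nb b Hb); unfold onesub; destruct (Z.eq_dec (b - 0) 0); [lia|].
  f_equal; f_equal; f_equal; lia.
- intros b Hb; specialize (Nb b Hb); unfold onesub; destruct (Z.eq_dec (b - 0) 0); [lia|].
  f_equal; f_equal; f_equal; lia.
Qed.

(** * Theta quotients as Appell-Lerch sums *)

(** For k -> +oo the quantity tends to 1. For k = -n it is rewritten as -(p^n/z)/(1 - p^n/z), which
    tends to 0. Convergent sequences are bounded. *)
Lemma inv_one_minus_bounded (z p : C) :
  (0 < Cmod p < 1)%R -> z <> 0 -> (forall k, 1 - z * Cpowz p k <> 0) ->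
  exists M, forall k, (Cmod (/ (1 - z * Cpowz p k)) <= M)%R.
Proof.
intros Hp Hz H; assert (p0 : p <> 0) by (apply Cmod_gt_0; lra).
assert (A : forall y : C, y <> 0 -> (forall n : nat, 1 - y * p ^ n <> 0) ->
  exists M, (0 < M)%R /\ forall n : nat, (Cmod (/ (1 - y * p ^ n)) <= M)%R).
{ intros y Hy Hn.
  assert (L : Ccv (fun n => / (1 - y * p ^ n)) (/ (1 - y * 0))).
  { apply Ccv_inv; [| |exact Hn].
    - apply Ccv_minus; [apply Ccv_const | apply Ccv_scal, Ccv_pow0; lra].
    - replace (1 - y * 0) with (RtoC 1) by ring; apply C1_nz. }
  destruct (Ccv_bounded _ _ L) as [M HM]; now exists M. }
assert (N : forall n : nat, 1 - / z * p ^ n <> 0).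
{ intros n E; apply (H (- Z.of_nat n)%Z); rewrite Cpowz_opp_nat.
  assert (P := Cpow_nz p n p0).
  replace (1 - z * / p ^ n) with (- (z * / p ^ n) * (1 - / z * p ^ n)) by (field; auto).
  rewrite E; ring. }
destruct (A z Hz) as [M [M0 HM]].
{ intros n; specialize (H (Z.of_nat n)); now rewrite Cpowz_of_nat in H. }
destruct (A (/ z) (Cinv_neq_0 z Hz) N) as [M' [M0' HM']].
exists (M + / Cmod z * M')%R; intros k.
assert (z0 := Rinv_0_lt_compat _ (proj1 (Cmod_gt_0 z) Hz)).
assert (T := Rmult_lt_0_compat _ _ z0 M0').
destruct (Z_le_gt_dec 0 k) as [Hk|Hk].
- replace k with (Z.of_nat (Z.to_nat k)) by lia.
  rewrite Cpowz_of_nat; specialize (HM (Z.to_nat k)); lra.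
- replace k with (- Z.of_nat (Z.to_nat (- k)))%Z by lia; rewrite Cpowz_opp_nat.
  set (n := Z.to_nat (- k)); assert (P := Cpow_nz p n p0).
  replace (/ (1 - z * / p ^ n)) with (- (/ z * p ^ n * / (1 - / z * p ^ n))).
  2:{ assert (Z1 : z - p ^ n <> 0).
      { intros E; apply (N n); replace (1 - / z * p ^ n) with ((z - p ^ n) * / z)
          by (field; auto); rewrite E; ring. }
      assert (Z2 : p ^ n - z <> 0).
      { intros E; apply Z1; replace (z - p ^ n) with (- (p ^ n - z)) by ring.
        rewrite E; ring. }
      field; auto. }
  rewrite Cmod_opp, !Cmod_mult, Cmod_inv, Cmod_pow by exact Hz.
  specialize (HM' n).
  assert (0 <= Cmod p ^ n <= 1)%R.
  { split; [apply pow_le; lra | rewrite <- (pow1 n); apply pow_incr; lra]. }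
  assert (0 <= Cmod (/ (1 - / z * p ^ n)))%R by apply Cmod_ge_0.
  apply Rle_trans with (/ Cmod z * M')%R; [|lra].
  rewrite Rmult_assoc; apply Rmult_le_compat_l; [lra|]; nra.
Qed.

Lemma Sigma_weight_zdom (w p : C) :
  (0 < Cmod p < 1)%R -> w <> 0 ->
  zdom (fun k => Cpowz p (2 * k * (k + 1)) * Cpowz w k).
Proof.
intros Hp Hw; assert (p0 : p <> 0) by (apply Cmod_gt_0; lra).
assert (p2 : p ^ 2 <> 0) by now apply Cpow_nz.
apply (zdom_le _ (fun k => Cpowz (p ^ 2) (k * k) * Cpowz (p ^ 2 * w) k)).
- intros k; rewrite Cpowz_mult_l, !Cpowz_pow by assumption.
  rewrite Cmult_assoc, <- Cpowz_add by exact p0; right; do 3 f_equal; lia.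
- apply gauss_zdom; [|now apply Cmult_neq_0].
  split; [now apply Cmod_gt_0 | apply Cmod_pow_lt_1; [lra | lia]].
Qed.

Lemma Sigma_zdom (z w p : C) :
  (0 < Cmod p < 1)%R -> z <> 0 -> w <> 0 -> (forall k, 1 - z * Cpowz p k <> 0) ->
  zdom (fun k => Cpowz p (2 * k * (k + 1)) * Cpowz w k / (1 - z * Cpowz p k)).
Proof.
intros Hp Hz Hw H; destruct (inv_one_minus_bounded z p Hp Hz H) as [M HM].
exact (zdom_mult_bounded _ _ M HM (Sigma_weight_zdom w p Hp Hw)).
Qed.

(** Factors with negative exponent are turned over, 1 - u p^(-i) = -u p^(-i) (1 - p^i/u). This
    produces the second half of a truncated theta and a monomial with sign. *)
Lemma bilateral_product (u p : C) (m1 m2 : nat) :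
  u <> 0 -> p <> 0 ->
  cprod (fun i => 1 - u * Cpowz p (Z.of_nat i - Z.of_nat m1)) (m1 + m2) =
  qpoch_fin u p m2 * qpoch_fin (p / u) p m1
  * cprod (fun i => - (u * Cpowz p (- Z.of_nat (S i)))) m1.
Proof.
intros Hu Hp; rewrite cprod_add, cprod_rev, !qpoch_fin_cprod.
rewrite <- Cmult_assoc, <- cprod_mult, Cmult_comm; f_equal.
- apply cprod_ext; intros k Hk; f_equal; f_equal; f_equal.
  rewrite <- Cpowz_of_nat; f_equal; lia.
- apply cprod_ext; intros k Hk.
  replace (Z.of_nat (m1 - S k) - Z.of_nat m1)%Z with (- Z.of_nat (S k))%Z by lia.
  rewrite Cpowz_opp_nat, Cpow_S; field; repeat split; auto; now apply Cpow_nz.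
Qed.

Lemma bilateral_product_1 (q p : C) (N : Z) (m1 m2 : nat) :
  q <> 0 -> N <> 0%Z -> p = Cpowz q N ->
  cprod (fun i => onesub q (N * (Z.of_nat i - Z.of_nat m1))) (m1 + S m2) =
  qpoch_fin p p m2 * qpoch_fin p p m1
  * cprod (fun i => - (Cpowz p (- Z.of_nat (S i)))) m1.
Proof.
intros Hq HN ->; assert (Hp := Cpowz_neq_0 q N Hq).
rewrite cprod_add, cprod_rev, !qpoch_fin_cprod.
rewrite <- Cmult_assoc, <- cprod_mult, Cmult_comm; f_equal.
- rewrite cprod_shift; unfold onesub at 1.
  destruct (Z.eq_dec _ 0) as [_|E]; [|exfalso; apply E; lia].
  rewrite Cmult_1_l; apply cprod_ext; intros k Hk; unfold onesub.
  destruct (Z.eq_dec _ 0) as [E|_].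
  { apply Z.mul_eq_0 in E; lia. }
  rewrite <- Cpow_S, <- Cpowz_of_nat, <- Cpowz_mul by exact Hq.
  do 3 f_equal; lia.
- apply cprod_ext; intros k Hk; unfold onesub.
  destruct (Z.eq_dec _ 0) as [E|_].
  { apply Z.mul_eq_0 in E; lia. }
  replace (Z.of_nat (m1 - S k) - Z.of_nat m1)%Z with (- Z.of_nat (S k))%Z by lia.
  rewrite Cpowz_mul, Cpowz_opp_nat, Cpow_S by exact Hq.
  field; split; [now apply Cpow_nz | exact Hp].
Qed.

Definition window (K : nat) : list Z :=
  map (fun i => (Z.of_nat i - Z.of_nat K)%Z) (seq 0 (K + K)).

Lemma lsum_window (f : Z -> C) (K : nat) : lsum f (window K) = zsum f K.
Proof.
unfold window, zsum; rewrite lsum_map, lsum_seq, csum_add, csum_plus.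
rewrite (csum_rev _ K), Cplus_comm; f_equal; apply csum_ext; intros k Hk; f_equal; lia.
Qed.

Lemma NoDup_window (K : nat) : NoDup (window K).
Proof.
apply FinFun.Injective_map_NoDup; [|apply seq_NoDup].
intros i j E; lia.
Qed.

Lemma In_window (K : nat) (k : Z) :
  In k (window K) <-> (- Z.of_nat K <= k < Z.of_nat K)%Z.
Proof.
unfold window; rewrite in_map_iff; split.
- intros [i [<- Hi]]; apply in_seq in Hi; lia.
- intros H; exists (Z.to_nat (k + Z.of_nat K)); split; [lia|].
  apply in_seq; lia.
Qed.

Definition progressions (N : Z) (K : nat) (l : list Z) : list Z :=
  flat_map (fun a => map (fun k => (a + N * k)%Z) (window K)) l.

Lemma length_progressions (N : Z) (K : nat) (l : list Z) :
  length (progressions N K l) = (length l * (K + K))%nat.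
Proof.
unfold progressions; induction l as [|a l IH]; [reflexivity|].
simpl; rewrite length_app, IH, length_map; unfold window.
rewrite length_map, length_seq; lia.
Qed.

Lemma NoDup_progressions (N : Z) (K : nat) (l : list Z) :
  (0 < N)%Z -> NoDup (map (fun a => a mod N)%Z l) -> NoDup (progressions N K l).
Proof.
intros HN; induction l as [|a l IH]; intros H; [constructor|].
simpl in H; inversion_clear H as [|? ? H1 H2]; simpl; apply NoDup_app.
- apply FinFun.Injective_map_NoDup; [|apply NoDup_window].
  intros i j E; nia.
- exact (IH H2).
- intros n Hn Hn'; apply in_map_iff in Hn; destruct Hn as [k [<- _]].
  unfold progressions in Hn'; apply in_flat_map in Hn'; destruct Hn' as [b [Hb Hn']].
  apply in_map_iff in Hn'; destruct Hn' as [k' [E _]].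
  apply H1, in_map_iff; exists b; split; [|exact Hb].
  replace b with (a + (k - k') * N)%Z by nia; apply Z_mod_plus_full.
Qed.

Lemma lprod_bounded {A I : Type} (f : A -> I -> C) (l : list A) :
  (forall x, In x l -> exists M, forall i, (Cmod (f x i) <= M)%R) ->
  exists M, forall i, (Cmod (lprod (fun x => f x i) l) <= M)%R.
Proof.
induction l as [|x l IH]; intros H.
- exists 1%R; intros i; simpl; rewrite Cmod_1; lra.
- destruct (H x (or_introl eq_refl)) as [M HM].
  destruct IH as [M' HM']; [intros; apply H; now right|].
  exists (M * M')%R; intros i; simpl; rewrite Cmod_mult.
  apply Rmult_le_compat; try apply Cmod_ge_0; auto.
Qed.

Lemma Ccv_lprod {A : Type} (f : A -> nat -> C) (g : A -> C) (l : list A) :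
  (forall x, In x l -> Ccv (f x) (g x)) ->
  Ccv (fun K => lprod (fun x => f x K) l) (lprod g l).
Proof.
induction l as [|x l IH]; intros H; simpl; [apply Ccv_const|].
apply Ccv_mult; [apply H; now left | apply IH; intros; apply H; now right].
Qed.

Lemma Ccv_lsum {A : Type} (f : A -> nat -> C) (g : A -> C) (l : list A) :
  (forall x, In x l -> Ccv (f x) (g x)) ->
  Ccv (fun K => lsum (fun x => f x K) l) (lsum g l).
Proof.
induction l as [|x l IH]; intros H; simpl; [apply Ccv_const|].
apply Ccv_plus; [apply H; now left | apply IH; intros; apply H; now right].
Qed.

Lemma lprod_inv {A : Type} (f : A -> C) (l : list A) :
  (forall x, In x l -> f x <> 0) -> lprod (fun x => / f x) l = / lprod f l.
Proof.
induction l as [|x l IH]; intros H; simpl; [field|].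
rewrite IH by (intros; apply H; now right); field; split.
- apply lprod_neq_0; intros; apply H; now right.
- apply H; now left.
Qed.

Definition zlist_sum (l : list Z) : Z := fold_right Z.add 0%Z l.

(* [(z, p/z; p)_oo] at [z = q^n], [p = q^N]. *)
Definition theta (q : C) (N n : Z) : C :=
  qpoch (Cpowz q n) (Cpowz q N) * qpoch (Cpowz q (N - n)) (Cpowz q N).

(* [theta], divided by its vanishing factor [1 - z] at [n = 0]. *)
Definition theta' (q : C) (N n : Z) : C :=
  if Z.eq_dec n 0 then qpoch (Cpowz q N) (Cpowz q N) ^ 2 else theta q N n.

(** Two truncation lengths are needed: seen from the pole b + N k, the window leaves K + k factors
    on one side and K - k on the other. *)
Definition theta_fin (q : C) (N n : Z) (m1 m2 : nat) : C :=
  qpoch_fin (Cpowz q n) (Cpowz q N) m2 * qpoch_fin (Cpowz q (N - n)) (Cpowz q N) m1.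

(** At n = 0 the factor 1 - q^0 of the first product is removed, whence the length m2 - 1 and the
    start at q^N. *)
Definition theta_fin' (q : C) (N n : Z) (m1 m2 : nat) : C :=
  if Z.eq_dec n 0
  then qpoch_fin (Cpowz q N) (Cpowz q N) (m2 - 1) * qpoch_fin (Cpowz q N) (Cpowz q N) m1
  else theta_fin q N n m1 m2.

(** The monomial with sign that is left over when the m factors of negative exponent are turned
    over. *)
Definition flip (q : C) (N n : Z) (m : nat) : C :=
  cprod (fun i => - Cpowz q (n - N * Z.of_nat (S i))) m.

Lemma bilateral_theta_fin (q : C) (N n : Z) (m1 m2 : nat) :
  q <> 0 ->
  cprod (fun i => 1 - Cpowz q (n + N * (Z.of_nat i - Z.of_nat m1))) (m1 + m2) =
  theta_fin q N n m1 m2 * flip q N n m1.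
Proof.
intros Hq; unfold theta_fin, flip.
assert (Hu := Cpowz_neq_0 q n Hq); assert (Hp := Cpowz_neq_0 q N Hq).
assert (B := bilateral_product _ _ m1 m2 Hu Hp).
rewrite <- Cpowz_sub in B by exact Hq.
rewrite (cprod_ext _ (fun i => 1 - Cpowz q (n + N * (Z.of_nat i - Z.of_nat m1)))) in B.
- rewrite B; f_equal; apply cprod_ext; intros i _; f_equal.
  rewrite <- Cpowz_mul, <- Cpowz_add by exact Hq; f_equal; lia.
- intros i _; f_equal; f_equal; rewrite <- Cpowz_mul, <- Cpowz_add by exact Hq.
  reflexivity.
Qed.

Lemma bilateral_theta_fin' (q : C) (N n : Z) (m1 m2 : nat) :
  q <> 0 -> (0 < m2)%nat -> N <> 0%Z -> n = 0%Z \/ (n mod N <> 0)%Z ->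
  cprod (fun i => onesub q (n + N * (Z.of_nat i - Z.of_nat m1))) (m1 + m2) =
  theta_fin' q N n m1 m2 * flip q N n m1.
Proof.
intros Hq Hm HN Hn; unfold theta_fin'; destruct (Z.eq_dec n 0) as [->|E].
- destruct m2 as [|m2]; [lia|].
  assert (B := bilateral_product_1 q _ N m1 m2 Hq HN eq_refl).
  replace (S m2 - 1)%nat with m2 by lia.
  etransitivity; [exact B|]; f_equal; unfold flip; apply cprod_ext; intros i _.
  rewrite <- Cpowz_mul by exact Hq; f_equal; f_equal; lia.
- destruct Hn as [Hn|Hn]; [contradiction|].
  rewrite <- bilateral_theta_fin by exact Hq; apply cprod_ext; intros i _.
  unfold onesub; destruct (Z.eq_dec _ 0) as [F|_]; [|reflexivity].
  exfalso; apply Hn; replace n with ((Z.of_nat m1 - Z.of_nat i) * N)%Z by lia.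
  apply Z_mod_mult.
Qed.

Lemma flip_shift (q : C) (N n : Z) (m : nat) :
  q <> 0 -> flip q N n m = Cpowz q (n * Z.of_nat m) * flip q N 0 m.
Proof.
intros Hq; unfold flip; induction m as [|m IH]; cbn [cprod].
- rewrite Z.mul_0_r; simpl; ring.
- rewrite IH, Nat2Z.inj_succ.
  replace (n * Z.succ (Z.of_nat m))%Z with (n * Z.of_nat m + n)%Z by lia.
  replace (n - N * Z.succ (Z.of_nat m))%Z
    with (n + (0 - N * Z.succ (Z.of_nat m)))%Z by lia.
  rewrite !Cpowz_add by exact Hq; ring.
Qed.

(** Source of the weight 2k(k + 1) in [Sigma]: the fourth power removes the signs and quadruples the
    triangular exponent Nm(m + 1)/2. *)
Lemma flip_pow4 (q : C) (N : Z) (m : nat) :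
  q <> 0 -> flip q N 0 m ^ 4 = Cpowz q (- (2 * N * Z.of_nat m * (Z.of_nat m + 1))).
Proof.
intros Hq; unfold flip; induction m as [|m IH]; cbn [cprod].
- rewrite Z.mul_0_r; simpl; ring.
- rewrite Cpow_mult_l, IH.
  replace ((- Cpowz q (0 - N * Z.of_nat (S m))) ^ 4)
    with (Cpowz q (4 * (0 - N * Z.of_nat (S m)))).
  + rewrite <- Cpowz_add by exact Hq; f_equal; lia.
  + replace (4 * (0 - N * Z.of_nat (S m)))%Z with ((0 - N * Z.of_nat (S m)) * 4)%Z by lia.
    rewrite Cpowz_mul by exact Hq; simpl; ring.
Qed.

Lemma flip_neq_0 (q : C) (N n : Z) (m : nat) : q <> 0 -> flip q N n m <> 0.
Proof.
intros Hq; apply cprod_neq_0; intros k _ H.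
apply (Cpowz_neq_0 q (n - N * Z.of_nat (S k)) Hq).
replace (Cpowz q (n - N * Z.of_nat (S k)))
  with (- - Cpowz q (n - N * Z.of_nat (S k))) by ring.
rewrite H; ring.
Qed.

Lemma lprod_flip (q : C) (N b : Z) (m : nat) (l : list Z) :
  q <> 0 ->
  lprod (fun a => flip q N (a - b) m) l =
  Cpowz q (Z.of_nat m * (zlist_sum l - Z.of_nat (length l) * b))
  * flip q N 0 m ^ length l.
Proof.
intros Hq; induction l as [|a l IH].
- simpl; rewrite Z.mul_0_r; simpl; ring.
- cbn [lprod length zlist_sum fold_right]; fold (zlist_sum l).
  rewrite IH, flip_shift, Cpow_S, Nat2Z.inj_succ by exact Hq.
  replace (Z.of_nat m * (a + zlist_sum l - Z.succ (Z.of_nat (length l)) * b))%Z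
    with ((a - b) * Z.of_nat m
          + Z.of_nat m * (zlist_sum l - Z.of_nat (length l) * b))%Z by lia.
  rewrite (Cpowz_add q ((a - b) * Z.of_nat m)) by exact Hq; ring.
Qed.

Lemma lprod_window_shift (f : Z -> C) (N n : Z) (K : nat) (k : Z) :
  (- Z.of_nat K <= k < Z.of_nat K)%Z ->
  lprod (fun k' => f (n + N * (k' - k))%Z) (window K) =
  cprod (fun i => f (n + N * (Z.of_nat i - Z.of_nat (Z.to_nat (Z.of_nat K + k))))%Z)
    (Z.to_nat (Z.of_nat K + k) + Z.to_nat (Z.of_nat K - k)).
Proof.
intros Hk; unfold window; rewrite lprod_map, lprod_seq.
replace (Z.to_nat (Z.of_nat K + k) + Z.to_nat (Z.of_nat K - k))%nat
  with (K + K)%nat by lia.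
apply cprod_ext; intros i _; f_equal; f_equal; f_equal; lia.
Qed.

(** With m = K + k, the four surplus flips give 2N(m(m + 1) - K(K + 1)) = 4NKk + 2Nk(k + 1), and the
    shift by b adds 4bm. The power with exponent -4K(b + Nk) removes exactly the parts containing
    K. *)
Lemma flip_ratio (q : C) (N b k : Z) (K : nat) (As Bs : list Z) :
  q <> 0 -> length Bs = (length As + 4)%nat ->
  (- Z.of_nat K <= k < Z.of_nat K)%Z ->
  Cpowz q (- (Z.of_nat (4 * K) * (b + N * k)))
  * lprod (fun a => flip q N (a - b) (Z.to_nat (Z.of_nat K + k))) As
  / lprod (fun b' => flip q N (b' - b) (Z.to_nat (Z.of_nat K + k))) Bs
  / (lprod (fun a => flip q N (a - 0) K) As / lprod (fun b' => flip q N (b' - 0) K) Bs)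
  = Cpowz (Cpowz q N) (2 * k * (k + 1))
    * Cpowz (Cpowz q (zlist_sum As + 4 * b - zlist_sum Bs)) k.
Proof.
intros Hq L Hk; rewrite !lprod_flip, L, !Cpow_add_r, !flip_pow4 by exact Hq.
set (m := Z.to_nat (Z.of_nat K + k)).
assert (F1 := Cpow_nz _ (length As) (flip_neq_0 q N 0 m Hq)).
assert (F2 := Cpow_nz _ (length As) (flip_neq_0 q N 0 K Hq)).
rewrite <- !Cpowz_mul by exact Hq.
set (x1 := (- (Z.of_nat (4 * K) * (b + N * k)))%Z).
set (x2 := (Z.of_nat m * (zlist_sum As - Z.of_nat (length As) * b))%Z).
set (x3 := (Z.of_nat m * (zlist_sum Bs - Z.of_nat (length As + 4) * b))%Z).
set (x4 := (- (2 * N * Z.of_nat m * (Z.of_nat m + 1)))%Z).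
set (x5 := (Z.of_nat K * (zlist_sum As - Z.of_nat (length As) * 0))%Z).
set (x6 := (Z.of_nat K * (zlist_sum Bs - Z.of_nat (length As + 4) * 0))%Z).
set (x7 := (- (2 * N * Z.of_nat K * (Z.of_nat K + 1)))%Z).
assert (Hx : forall x, Cpowz q x <> 0) by (intros; now apply Cpowz_neq_0).
transitivity (Cpowz q (x1 + x2 - x3 - x4 - x5 + x6 + x7)).
- unfold Z.sub; rewrite !Cpowz_add, !Cpowz_opp by exact Hq; field; auto 10.
- rewrite <- Cpowz_add by exact Hq; f_equal.
  unfold x1, x2, x3, x4, x5, x6, x7, m; rewrite Z2Nat.id by lia; lia.
Qed.

(** When a factor vanishes both sides are 0, because [/ 0] evaluates to 0. Quotients can then be
    rearranged by [ring] alone. *)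
Lemma Cinv_mul (x y : C) : / (x * y) = / x * / y.
Proof.
assert (I0 : / 0 = 0) by (apply injective_projections; simpl; unfold Rdiv; ring).
destruct (Ceq_dec x 0) as [->|Hx]; [rewrite Cmult_0_l, I0; ring|].
destruct (Ceq_dec y 0) as [->|Hy]; [rewrite Cmult_0_r, I0; ring|].
field; auto.
Qed.

Lemma residue_difference (N : Z) (l : list Z) (b b' : Z) :
  (0 < N)%Z -> NoDup (map (fun a => a mod N)%Z l) -> In b l -> In b' l ->
  (b' - b = 0)%Z \/ ((b' - b) mod N <> 0)%Z.
Proof.
intros HN ND Hb Hb'; destruct (Z.eq_dec b' b) as [->|E]; [left; lia|right].
intros E'; apply E.
assert (F : (b' mod N = b mod N)%Z).
{ replace b' with (b + (b' - b) / N * N)%Z.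
  - apply Z_mod_plus_full.
  - pose proof (Z.div_mod (b' - b) N ltac:(lia)); nia. }
clear - ND Hb Hb' F.
induction l as [|c l IH]; [contradiction|].
simpl in ND; inversion_clear ND as [|? ? N1 N2].
destruct Hb as [->|Hb], Hb' as [->|Hb']; auto.
- exfalso; apply N1, in_map_iff; now exists b'.
- exfalso; apply N1, in_map_iff; now exists b.
Qed.

(** Partial fractions with e = 4K, whose zeros and poles are the exponents a + N k and b + N k with
    k in the window. Both sides are divided by the flips of the centred window; [flip_ratio]
    evaluates what remains at each pole. *)
Lemma theta_fin_identity (q : C) (N : Z) (As Bs : list Z) (K : nat) :
  (0 < Cmod q < 1)%R -> (0 < N)%Z -> length Bs = (length As + 4)%nat ->
  NoDup (map (fun b => b mod N)%Z Bs) ->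
  (forall b, In b Bs -> (b mod N <> 0)%Z) -> (0 < K)%nat ->
  lprod (fun a => theta_fin q N a K K) As / lprod (fun b => theta_fin q N b K K) Bs =
  lsum (fun b => zsum (fun k =>
    Cpowz (Cpowz q N) (2 * k * (k + 1))
    * Cpowz (Cpowz q (zlist_sum As + 4 * b - zlist_sum Bs)) k
    / (1 - Cpowz q b * Cpowz (Cpowz q N) k)
    * (lprod (fun a => theta_fin q N (a - b) (Z.to_nat (Z.of_nat K + k))
                         (Z.to_nat (Z.of_nat K - k))) As
       * / lprod (fun b' => theta_fin' q N (b' - b) (Z.to_nat (Z.of_nat K + k))
                         (Z.to_nat (Z.of_nat K - k))) Bs)) K) Bs.
Proof.
intros Hq HN L ND B0 HK; assert (q0 : q <> 0) by (apply Cmod_gt_0; lra).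
assert (ND' : NoDup (0%Z :: progressions N K Bs)).
{ constructor; [|now apply NoDup_progressions].
  intros H; unfold progressions in H; apply in_flat_map in H.
  destruct H as [b [Hb H]]; apply in_map_iff in H; destruct H as [k [E _]].
  apply (B0 b Hb); replace b with ((- k) * N)%Z by lia; apply Z_mod_mult. }
assert (PF := partial_fractions q (4 * K) (progressions N K As) (progressions N K Bs)
  Hq ND').
(* The degree condition reads 4K + 2K|As| < 2K(|As| + 4), true for K > 0. *)
rewrite !length_progressions in PF; specialize (PF ltac:(nia)).
unfold progressions in PF.
rewrite !lprod_flat_map, lsum_flat_map in PF.
assert (R : forall n, lprod (fun n' => 1 - Cpowz q n') (map (fun k => n + N * k)%Z (window K))
  = theta_fin q N n K K * flip q N n K).
{ intros n; rewrite <- bilateral_theta_fin by exact q0; rewrite lprod_map.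
  rewrite (lprod_ext _ (fun k' => 1 - Cpowz q (n + N * (k' - 0)))).
  - rewrite (lprod_window_shift (fun n => 1 - Cpowz q n) N n K 0) by lia.
    replace (Z.to_nat (Z.of_nat K + 0)) with K by lia.
    replace (Z.to_nat (Z.of_nat K - 0)) with K by lia; reflexivity.
  - intros k _; do 3 f_equal; lia. }
rewrite !(lprod_ext _ _ _ (fun n _ => R n)), !lprod_mult in PF.
assert (T0 : forall b, In b Bs -> theta_fin q N b K K <> 0).
{ intros b Hb; assert (H : theta_fin q N b K K * flip q N b K <> 0).
  { rewrite <- R, lprod_map; apply lprod_neq_0; intros k _ H.
    apply (B0 b Hb).
    assert (E : (b + N * k = 0)%Z).
    { apply (Cpowz_inj_1 q _ Hq).
      replace (Cpowz q (b + N * k)) with (1 - (1 - Cpowz q (b + N * k))) by ring.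
      rewrite H; ring. }
    replace b with ((- k) * N)%Z by lia; apply Z_mod_mult. }
  intros E; apply H; rewrite E; ring. }
assert (T1 : lprod (fun b => theta_fin q N b K K) Bs <> 0) by now apply lprod_neq_0.
set (FA := lprod (fun a => flip q N (a - 0) K) As).
set (FB := lprod (fun b => flip q N (b - 0) K) Bs).
assert (FA0 : FA <> 0) by (apply lprod_neq_0; intros; now apply flip_neq_0).
assert (FB0 : FB <> 0) by (apply lprod_neq_0; intros; now apply flip_neq_0).
rewrite (lprod_ext (fun a => flip q N a K) (fun a => flip q N (a - 0) K) As) in PF
  by (intros; f_equal; lia).
rewrite (lprod_ext (fun a => flip q N a K) (fun a => flip q N (a - 0) K) Bs) in PF
  by (intros; f_equal; lia).
fold FA FB in PF.
transitivity (/ (FA / FB) * (lprod (fun a => theta_fin q N a K K) As * FA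
  / (lprod (fun b => theta_fin q N b K K) Bs * FB))).
{ field; auto. }
rewrite PF, <- lsum_scal; apply lsum_ext; intros b Hb.
rewrite lsum_map, <- lsum_window, <- lsum_scal; apply lsum_ext; intros k Hk.
apply In_window in Hk.
set (m1 := Z.to_nat (Z.of_nat K + k)); set (m2 := Z.to_nat (Z.of_nat K - k)).
rewrite !lprod_flat_map.
rewrite (lprod_ext _ (fun a => theta_fin q N (a - b) m1 m2 * flip q N (a - b) m1) As).
2:{ intros a _; rewrite <- bilateral_theta_fin by exact q0; rewrite lprod_map.
    unfold m1, m2; rewrite <- (lprod_window_shift (fun n => 1 - Cpowz q n)) by exact Hk.
    apply lprod_ext; intros k' _; do 2 f_equal; lia. }
rewrite (lprod_ext _ (fun a => theta_fin' q N (a - b) m1 m2 * flip q N (a - b) m1) Bs).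
2:{ intros b' Hb'; rewrite <- bilateral_theta_fin'; [|exact q0|unfold m2; lia|lia|].
    - rewrite lprod_map.
      unfold m1, m2; rewrite <- (lprod_window_shift (onesub q)) by exact Hk.
      apply lprod_ext; intros k' _; f_equal; lia.
    - now apply (residue_difference N Bs). }
rewrite !lprod_mult.
rewrite <- (flip_ratio q N b k K As Bs q0 L Hk); fold m1 FA FB.
replace (Cpowz q b * Cpowz (Cpowz q N) k) with (Cpowz q (b + N * k))
  by (rewrite Cpowz_add, Cpowz_mul by exact q0; reflexivity).
set (GA := lprod (fun a => flip q N (a - b) m1) As).
set (GB := lprod (fun a => flip q N (a - b) m1) Bs).
assert (GB0 : GB <> 0) by (apply lprod_neq_0; intros; now apply flip_neq_0).
unfold Cdiv; rewrite !Cinv_mul.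
ring.
Qed.

(** * Passage from truncated to infinite thetas *)

Lemma Cmod_Cpowz_lt_1 (q : C) (N : Z) :
  (0 < Cmod q < 1)%R -> (0 < N)%Z -> (0 < Cmod (Cpowz q N) < 1)%R.
Proof.
intros Hq HN; assert (q0 : q <> 0) by (apply Cmod_gt_0; lra).
replace N with (Z.of_nat (Z.to_nat N)) by lia; rewrite Cpowz_of_nat; split.
- now apply Cmod_gt_0, Cpow_nz.
- apply Cmod_pow_lt_1; [lra | lia].
Qed.

Lemma one_minus_Cpowz_neq_0 (q : C) (n : Z) :
  (0 < Cmod q < 1)%R -> n <> 0%Z -> 1 - Cpowz q n <> 0.
Proof.
intros Hq Hn H; assert (O := onesub_neq_0 q n Hq); unfold onesub in O.
destruct (Z.eq_dec n 0); contradiction.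
Qed.

Lemma progression_neq_0 (q : C) (N n k : Z) :
  (0 < Cmod q < 1)%R -> (n mod N <> 0)%Z -> 1 - Cpowz q n * Cpowz (Cpowz q N) k <> 0.
Proof.
intros Hq Hn; assert (q0 : q <> 0) by (apply Cmod_gt_0; lra).
rewrite <- Cpowz_mul, <- Cpowz_add by exact q0.
apply one_minus_Cpowz_neq_0; [exact Hq|]; intros E; apply Hn.
replace n with ((- k) * N)%Z by lia; apply Z_mod_mult.
Qed.

Lemma qpoch_factor_neq_0 (q : C) (N n : Z) (k : nat) :
  (0 < Cmod q < 1)%R -> (n mod N <> 0)%Z -> 1 - Cpowz q n * Cpowz q N ^ k <> 0.
Proof.
intros Hq Hn; rewrite <- Cpowz_of_nat; now apply progression_neq_0.
Qed.

Lemma qpoch_self_factor_neq_0 (p : C) (k : nat) :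
  (0 < Cmod p < 1)%R -> 1 - p * p ^ k <> 0.
Proof.
intros Hp; rewrite <- Cpow_S, <- Cpowz_of_nat.
apply one_minus_Cpowz_neq_0; [exact Hp | lia].
Qed.

Lemma mod_opp_neq_0 (N n : Z) : (n mod N <> 0)%Z -> ((N - n) mod N <> 0)%Z.
Proof.
intros Hn E; apply Hn.
destruct (Z.eq_dec N 0) as [->|HN].
- rewrite Zmod_0_r in *; lia.
- apply Z.mod_divide in E; [|exact HN]; apply Z.mod_divide; [exact HN|].
  destruct E as [c E]; exists (1 - c)%Z; lia.
Qed.

Lemma theta_fin_cv (q : C) (N n k : Z) :
  (0 < Cmod q < 1)%R -> (0 < N)%Z ->
  Ccv (fun K => theta_fin q N n (Z.to_nat (Z.of_nat K + k)) (Z.to_nat (Z.of_nat K - k)))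
    (theta q N n).
Proof.
intros Hq HN; assert (Hp := Cmod_Cpowz_lt_1 q N Hq HN).
unfold theta_fin, theta; apply Ccv_mult.
- apply (Ccv_subseq _ _ (fun K => Z.to_nat (Z.of_nat K - k))).
  + intros M; exists (M + Z.to_nat (Z.abs k))%nat; intros; lia.
  + apply qpoch_cv; lra.
- apply (Ccv_subseq _ _ (fun K => Z.to_nat (Z.of_nat K + k))).
  + intros M; exists (M + Z.to_nat (Z.abs k))%nat; intros; lia.
  + apply qpoch_cv; lra.
Qed.

Lemma theta_fin_cv' (q : C) (N n k : Z) :
  (0 < Cmod q < 1)%R -> (0 < N)%Z ->
  Ccv (fun K => theta_fin' q N n (Z.to_nat (Z.of_nat K + k)) (Z.to_nat (Z.of_nat K - k)))
    (theta' q N n).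
Proof.
intros Hq HN; assert (Hp := Cmod_Cpowz_lt_1 q N Hq HN).
unfold theta_fin', theta'; destruct (Z.eq_dec n 0) as [E|E]; [|now apply theta_fin_cv].
replace (qpoch (Cpowz q N) (Cpowz q N) ^ 2)
  with (qpoch (Cpowz q N) (Cpowz q N) * qpoch (Cpowz q N) (Cpowz q N)) by ring.
apply Ccv_mult.
- apply (Ccv_subseq _ _ (fun K => (Z.to_nat (Z.of_nat K - k) - 1)%nat)).
  + intros M; exists (S M + Z.to_nat (Z.abs k))%nat; intros; lia.
  + apply qpoch_cv; lra.
- apply (Ccv_subseq _ _ (fun K => Z.to_nat (Z.of_nat K + k))).
  + intros M; exists (M + Z.to_nat (Z.abs k))%nat; intros; lia.
  + apply qpoch_cv; lra.
Qed.

Lemma theta_fin_bounded (q : C) (N n : Z) :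
  (0 < Cmod q < 1)%R -> (0 < N)%Z ->
  exists M, forall m : nat * nat, (Cmod (theta_fin q N n (fst m) (snd m)) <= M)%R.
Proof.
intros Hq HN; assert (Hp := Cmod_Cpowz_lt_1 q N Hq HN).
destruct (qpoch_fin_bounded (Cpowz q n) _ (proj2 Hp)) as [M1 [_ H1]].
destruct (qpoch_fin_bounded (Cpowz q (N - n)) _ (proj2 Hp)) as [M2 [_ H2]].
exists (M1 * M2)%R; intros m; unfold theta_fin; rewrite Cmod_mult.
apply Rmult_le_compat; auto; apply Cmod_ge_0.
Qed.

Lemma inv_theta_fin_bounded (q : C) (N n : Z) :
  (0 < Cmod q < 1)%R -> (0 < N)%Z -> n = 0%Z \/ (n mod N <> 0)%Z ->
  exists M, forall m : nat * nat, (Cmod (/ theta_fin' q N n (fst m) (snd m)) <= M)%R.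
Proof.
intros Hq HN Hn; assert (Hp := Cmod_Cpowz_lt_1 q N Hq HN).
assert (A : forall z z', (forall k, 1 - z * Cpowz q N ^ k <> 0) ->
  (forall k, 1 - z' * Cpowz q N ^ k <> 0) ->
  exists M, forall i j, (Cmod (/ (qpoch_fin z (Cpowz q N) i * qpoch_fin z' (Cpowz q N) j))
    <= M)%R).
{ intros z z' Hz Hz'.
  destruct (qpoch_fin_away z _ (proj2 Hp) Hz) as [m1 [P1 H1]].
  destruct (qpoch_fin_away z' _ (proj2 Hp) Hz') as [m2 [P2 H2]].
  exists (/ m1 * / m2)%R; intros i j.
  rewrite Cinv_mul, Cmod_mult, !Cmod_inv by now apply qpoch_fin_neq_0.
  apply Rmult_le_compat; try (left; apply Rinv_0_lt_compat, Cmod_gt_0;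
    now apply qpoch_fin_neq_0); apply Rinv_le_contravar; auto. }
unfold theta_fin', theta_fin; destruct (Z.eq_dec n 0) as [E|E].
- destruct (A (Cpowz q N) (Cpowz q N)) as [M HM];
    try (intros k; now apply qpoch_self_factor_neq_0).
  exists M; intros m; apply HM.
- destruct Hn as [Hn|Hn]; [contradiction|].
  destruct (A (Cpowz q n) (Cpowz q (N - n))) as [M HM].
  + intros k; now apply qpoch_factor_neq_0.
  + intros k; apply qpoch_factor_neq_0; [exact Hq | now apply mod_opp_neq_0].
  + exists M; intros m; apply HM.
Qed.

Lemma theta_neq_0 (q : C) (N n : Z) :
  (0 < Cmod q < 1)%R -> (0 < N)%Z -> (n mod N <> 0)%Z -> theta q N n <> 0.
Proof.
intros Hq HN Hn; assert (Hp := Cmod_Cpowz_lt_1 q N Hq HN).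
unfold theta; apply Cmult_neq_0; apply qpoch_neq_0; try lra; intros k;
  apply qpoch_factor_neq_0; auto using mod_opp_neq_0.
Qed.

Lemma theta_neq_0' (q : C) (N n : Z) :
  (0 < Cmod q < 1)%R -> (0 < N)%Z -> n = 0%Z \/ (n mod N <> 0)%Z -> theta' q N n <> 0.
Proof.
intros Hq HN Hn; assert (Hp := Cmod_Cpowz_lt_1 q N Hq HN).
unfold theta'; destruct (Z.eq_dec n 0) as [E|E].
- apply Cpow_nz, qpoch_neq_0; [lra|]; intros k; now apply qpoch_self_factor_neq_0.
- destruct Hn as [Hn|Hn]; [contradiction | now apply theta_neq_0].
Qed.

Lemma theta_fin_neq_0' (q : C) (N n : Z) (m1 m2 : nat) :
  (0 < Cmod q < 1)%R -> (0 < N)%Z -> n = 0%Z \/ (n mod N <> 0)%Z ->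
  theta_fin' q N n m1 m2 <> 0.
Proof.
intros Hq HN Hn; assert (Hp := Cmod_Cpowz_lt_1 q N Hq HN).
unfold theta_fin', theta_fin; destruct (Z.eq_dec n 0) as [E|E].
- apply Cmult_neq_0; apply qpoch_fin_neq_0; intros k; now apply qpoch_self_factor_neq_0.
- destruct Hn as [Hn|Hn]; [contradiction|].
  apply Cmult_neq_0; apply qpoch_fin_neq_0; intros k;
    apply qpoch_factor_neq_0; auto using mod_opp_neq_0.
Qed.

(** In the truncated identity the summand at pole b + N k is the k-th term of a [Sigma] times a
    ratio of truncated thetas. These ratios are bounded uniformly in K and k, since the denominators
    stay away from 0, and tend to a constant for fixed k; the terms of [Sigma] dominate. *)
Theorem theta_quotient_partial_fractions (q : C) (N : Z) (As Bs : list Z) :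
  (0 < Cmod q < 1)%R -> (0 < N)%Z -> length Bs = (length As + 4)%nat ->
  NoDup (map (fun b => b mod N)%Z Bs) ->
  (forall b, In b Bs -> (b mod N <> 0)%Z) ->
  lprod (theta q N) As / lprod (theta q N) Bs =
  lsum (fun b => lprod (fun a => theta q N (a - b)) As
    / lprod (fun b' => theta' q N (b' - b)) Bs
    * Sigma (Cpowz q b) (Cpowz q (zlist_sum As + 4 * b - zlist_sum Bs)) (Cpowz q N)) Bs.
Proof.
intros Hq HN L ND B0; assert (q0 : q <> 0) by (apply Cmod_gt_0; lra).
assert (Hp := Cmod_Cpowz_lt_1 q N Hq HN).
assert (T : forall n, (n mod N <> 0)%Z -> forall K, theta_fin q N n K K <> 0).
{ intros n Hn K; assert (H := theta_fin_neq_0' q N n K K Hq HN (or_intror Hn)).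
  unfold theta_fin' in H; destruct (Z.eq_dec n 0) as [->|]; [|exact H].
  exfalso; apply Hn, Zmod_0_l. }
apply (Ccv_unique (fun K => lprod (fun a => theta_fin q N a K K) As
  / lprod (fun b => theta_fin q N b K K) Bs)).
- assert (F : forall l, Ccv (fun K => lprod (fun a => theta_fin q N a K K) l)
    (lprod (theta q N) l)).
  { intros l; apply Ccv_lprod; intros a _.
    apply (Ccv_ext (fun K => theta_fin q N a (Z.to_nat (Z.of_nat K + 0))
      (Z.to_nat (Z.of_nat K - 0)))).
    - intros K; f_equal; lia.
    - now apply theta_fin_cv. }
  apply Ccv_div; auto.
  + apply lprod_neq_0; intros b Hb; now apply theta_neq_0; auto.
  + intros K; apply lprod_neq_0; intros b Hb; apply T; auto.
- eapply Ccv_eventually with (N := 1%nat).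
  { intros K HK; symmetry; now apply theta_fin_identity. }
  apply Ccv_lsum; intros b Hb; unfold Sigma.
  set (w := Cpowz q (zlist_sum As + 4 * b - zlist_sum Bs)).
  set (base := fun k => Cpowz (Cpowz q N) (2 * k * (k + 1)) * Cpowz w k
                        / (1 - Cpowz q b * Cpowz (Cpowz q N) k)).
  assert (Zb : zdom base).
  { apply Sigma_zdom; [exact Hp | now apply Cpowz_neq_0 | now apply Cpowz_neq_0|].
    intros k; apply progression_neq_0; auto. }
  rewrite Cmult_comm.
  set (R := lprod (fun a => theta q N (a - b)) As
            / lprod (fun b' => theta' q N (b' - b)) Bs).
  rewrite Cmult_comm, <- (CSeriesZ_scal R base) by exact Zb.
  destruct (lprod_bounded (fun a (m : nat * nat) => theta_fin q N (a - b) (fst m) (snd m))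
    As) as [M1 HM1].
  { intros; now apply theta_fin_bounded. }
  destruct (lprod_bounded (fun b' (m : nat * nat) =>
    / theta_fin' q N (b' - b) (fst m) (snd m)) Bs) as [M2 HM2].
  { intros b' Hb'; apply inv_theta_fin_bounded; auto.
    now apply (residue_difference N Bs). }
  destruct Zb as [A [r [Hr HA]]].
  apply tannery_Z with (A := (A * (M1 * M2))%R) (r := r).
  + exact Hr.
  + intros K k _; rewrite Cmod_mult; fold (base k).
    replace (A * (M1 * M2) * r ^ Z.abs_nat k)%R
      with (A * r ^ Z.abs_nat k * (M1 * M2))%R by ring.
    apply Rmult_le_compat; try apply Cmod_ge_0; [apply HA|].
    rewrite Cmod_mult; apply Rmult_le_compat; try apply Cmod_ge_0.
    * exact (HM1 (Z.to_nat (Z.of_nat K + k), Z.to_nat (Z.of_nat K - k))).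
    * rewrite <- lprod_inv.
      -- exact (HM2 (Z.to_nat (Z.of_nat K + k), Z.to_nat (Z.of_nat K - k))).
      -- intros b' Hb'; apply theta_fin_neq_0'; auto.
         now apply (residue_difference N Bs).
  + intros k; fold (base k); rewrite Cmult_comm; apply Ccv_scal.
    apply Ccv_div.
    * apply Ccv_lprod; intros; now apply theta_fin_cv.
    * apply Ccv_lprod; intros; now apply theta_fin_cv'.
    * apply lprod_neq_0; intros b' Hb'; apply theta_neq_0'; auto.
      now apply (residue_difference N Bs).
    * intros K; apply lprod_neq_0; intros b' Hb'; apply theta_fin_neq_0'; auto.
      now apply (residue_difference N Bs).
Qed.

(** * The Lambert series *)

Fixpoint gbinom (q : C) (n k : nat) : C :=
  match k, n with
  | O, _ => 1
  | S _, O => 0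
  | S k', S n' => gbinom q n' k' + q ^ k * gbinom q n' k
  end.

Lemma gbinom_0 (q : C) (n : nat) : gbinom q n 0 = 1.
Proof. now destruct n. Qed.

Lemma gbinom_gt (q : C) (n k : nat) : (n < k)%nat -> gbinom q n k = 0.
Proof.
revert k; induction n as [|n IH]; intros [|k] H; try lia; simpl; [reflexivity|].
rewrite !IH by lia; ring.
Qed.

Lemma gbinom_poch (q : C) (n k : nat) :
  gbinom q (n + k) k * (qpoch_fin q q k * qpoch_fin q q n) = qpoch_fin q q (n + k).
Proof.
revert k; induction n as [|n IHn]; intros k.
- simpl; induction k as [|k IHk]; [simpl; ring|].
  cbn [gbinom]; rewrite (gbinom_gt q k (S k)) by lia; simpl qpoch_fin in *.
  rewrite Cmult_0_r, Cplus_0_r; rewrite <- IHk at 2; ring.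
- induction k as [|k IHk].
  + rewrite Nat.add_0_r, gbinom_0; simpl; ring.
  + assert (H := IHn (S k)).
    replace (S n + S k)%nat with (S (S n + k)) by lia.
    replace (n + S k)%nat with (S n + k)%nat in H by lia.
    cbn [gbinom]; cbn [qpoch_fin] in *.
    assert (E1 : gbinom q (S n + k) k * (qpoch_fin q q k * (1 - q * q ^ k)
      * (qpoch_fin q q n * (1 - q * q ^ n)))
      = (1 - q * q ^ k) * qpoch_fin q q (S n + k)) by (rewrite <- IHk; ring).
    assert (E2 : gbinom q (S n + k) (S k) * (qpoch_fin q q k * (1 - q * q ^ k)
      * (qpoch_fin q q n * (1 - q * q ^ n)))
      = (1 - q * q ^ n) * qpoch_fin q q (S n + k)) by (rewrite <- H; ring).
    match type of E1 with ?x = _ => match type of E2 with ?y = _ =>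
      transitivity (x + q ^ S k * y); [ring | rewrite E1, E2] end end.
    rewrite <- !Cpow_S.
    replace (q ^ S (S n + k)) with (q ^ S k * q ^ S n)
      by (rewrite <- Cpow_add_r; f_equal; lia); ring.
Qed.

(** The mirror image of the recursion that defines [gbinom]. Expanding by that recursion reduces
    both terms to smaller n. *)
Lemma gbinom_pascal (q : C) (n k : nat) :
  (k <= n)%nat -> gbinom q (S n) (S k) = gbinom q n (S k) + q ^ (n - k) * gbinom q n k.
Proof.
revert k; induction n as [|n IH]; intros k H.
- replace k with O by lia; simpl; ring.
- destruct k as [|k].
  + assert (F : forall n, 1 + q * gbinom q n 1 = gbinom q n 1 + q ^ n).
    { clear; intros n; induction n as [|n IH]; [simpl; ring|].
      assert (E : gbinom q (S n) 1 = 1 + q * gbinom q n 1)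
        by (cbn [gbinom]; rewrite gbinom_0, Cpow_1_r; reflexivity).
      assert (P : q ^ n = 1 + q * gbinom q n 1 - gbinom q n 1) by (rewrite IH; ring).
      rewrite E, Cpow_S, P; ring. }
    rewrite gbinom_0, Nat.sub_0_r, Cmult_1_r, <- F.
    change (gbinom q (S (S n)) 1) with (gbinom q (S n) 0 + q ^ 1 * gbinom q (S n) 1).
    rewrite gbinom_0, Cpow_1_r; reflexivity.
  + change (gbinom q (S (S n)) (S (S k)))
      with (gbinom q (S n) (S k) + q ^ S (S k) * gbinom q (S n) (S (S k))).
    destruct (Nat.eq_dec k n) as [->|E].
    { rewrite (gbinom_gt q (S n) (S (S n))), Nat.sub_diag by lia.
      change (q ^ 0) with (RtoC 1); ring. }
    rewrite (IH k) at 1 by lia.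
    destruct (le_lt_dec (S k) n) as [L|L].
    * rewrite (IH (S k)) at 1 by lia.
      change (gbinom q (S n) (S (S k)))
        with (gbinom q n (S k) + q ^ S (S k) * gbinom q n (S (S k))).
      change (gbinom q (S n) (S k)) with (gbinom q n k + q ^ S k * gbinom q n (S k)).
      replace (S n - S k)%nat with (n - k)%nat by lia.
      replace (n - k)%nat with (S (n - S k)) by lia.
      rewrite !Cpow_S; ring.
    * lia.
Qed.

(** This is k(k - 1)/2, so [triang (S l)] is l(l + 1)/2. *)
Fixpoint triang (k : nat) : nat :=
  match k with O => O | S k' => (triang k' + k')%nat end.

(** Only s = 0 occurs in the coefficients; s = 1 is the companion that closes the recurrences, one
    from each Pascal rule. The upper limit is generous: terms with 2k > n vanish. *)
Definition altsum (q : C) (s n : nat) : C :=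
  csum (fun k => (- (1)) ^ k * q ^ (triang k + s * k) * gbinom q (n - k) k) (S n).

Lemma altsum_shift (q : C) (s n : nat) :
  altsum q s (S n) =
  1 + csum (fun k => (- (1)) ^ S k * q ^ (triang (S k) + s * S k)
                     * gbinom q (S n - S k) (S k)) (S n).
Proof.
unfold altsum; rewrite csum_shift, gbinom_0, Nat.mul_0_r; f_equal.
change (triang 0 + 0)%nat with O; simpl; ring.
Qed.

Lemma altsum_shift2 (q : C) (s n : nat) :
  altsum q s (S (S n)) =
  1 + csum (fun k => (- (1)) ^ S k * q ^ (triang (S k) + s * S k)
                     * gbinom q (S (S n) - S k) (S k)) (S n).
Proof.
rewrite altsum_shift; f_equal; cbn [csum].
rewrite (gbinom_gt q (S (S n) - S (S n))) by lia; ring.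
Qed.

Lemma altsum_rec0 (q : C) (n : nat) :
  altsum q 0 (S (S n)) = altsum q 1 (S n) - altsum q 1 n.
Proof.
rewrite altsum_shift2, altsum_shift; unfold altsum.
rewrite (csum_ext _ (fun k => (- (1)) ^ S k * q ^ (triang (S k) + 1 * S k)
    * gbinom q (S n - S k) (S k)
  + - (1) * ((- (1)) ^ k * q ^ (triang k + 1 * k) * gbinom q (n - k) k))).
- rewrite csum_plus, csum_scal; ring.
- intros k Hk; replace (S (S n) - S k)%nat with (S (n - k)) by lia.
  change (gbinom q (S (n - k)) (S k))
    with (gbinom q (n - k) k + q ^ S k * gbinom q (n - k) (S k)).
  replace (S n - S k)%nat with (n - k)%nat by lia.
  simpl triang; rewrite !Nat.mul_succ_r, !Nat.mul_1_l, !Nat.add_0_r.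
  replace (triang k + k + (k + 1))%nat with (triang k + k + S k)%nat by lia.
  rewrite !Cpow_add_r, !Cpow_S; ring.
Qed.

Lemma altsum_rec1 (q : C) (n : nat) :
  altsum q 1 (S (S n)) = altsum q 1 (S n) - q ^ S n * altsum q 0 n.
Proof.
rewrite altsum_shift2, altsum_shift; unfold altsum.
rewrite (csum_ext _ (fun k => (- (1)) ^ S k * q ^ (triang (S k) + 1 * S k)
    * gbinom q (S n - S k) (S k)
  + - q ^ S n * ((- (1)) ^ k * q ^ (triang k + 0 * k) * gbinom q (n - k) k))).
- rewrite csum_plus, csum_scal; ring.
- intros k Hk; replace (S (S n) - S k)%nat with (S (n - k)) by lia.
  replace (S n - S k)%nat with (n - k)%nat by lia.
  rewrite Nat.mul_0_l, Nat.add_0_r.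
  destruct (le_lt_dec k (n - k)) as [L|L].
  + rewrite gbinom_pascal by exact L.
    replace (q ^ S n) with (q ^ (k + S k) * q ^ (n - k - k))
      by (rewrite <- Cpow_add_r; f_equal; lia).
    simpl triang; rewrite Nat.mul_1_l, <- Nat.add_assoc, (Cpow_add_r q (triang k)), (Cpow_S (- (1))).
    ring.
  + rewrite !(gbinom_gt q _ k), !(gbinom_gt q _ (S k)) by lia; ring.
Qed.

(** Eliminating the companion s = 1 leaves a recurrence of step 3 with a single term. With the
    values 1, 1, 0 at n = 0, 1, 2 it explains both the monomials and the character modulo 3. *)
Lemma altsum_rec (q : C) (n : nat) :
  altsum q 0 (n + 3) = - q ^ (n + 1) * altsum q 0 n.
Proof.
replace (n + 3)%nat with (S (S (S n))) by lia.
rewrite altsum_rec0, altsum_rec1; replace (n + 1)%nat with (S n) by lia; ring.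
Qed.

Lemma altsum_6 (q : C) (n : nat) :
  altsum q 0 (n + 6) = q ^ (2 * n + 5) * altsum q 0 n.
Proof.
replace (n + 6)%nat with (n + 3 + 3)%nat by lia; rewrite !altsum_rec.
replace (2 * n + 5)%nat with (n + 3 + 1 + (n + 1))%nat by lia.
rewrite (Cpow_add_r q (n + 3 + 1)); ring.
Qed.

Lemma altsum_values (q : C) (r : nat) :
  altsum q 0 (6 * r + 1) = q ^ (6 * r * r + r) /\
  altsum q 0 (6 * r + 3) = - q ^ (6 * r * r + 5 * r + 1) /\
  altsum q 0 (6 * r + 5) = 0.
Proof.
induction r as [|r [I1 [I2 I3]]].
- assert (A0 : altsum q 0 0 = 1) by (unfold altsum; simpl; ring).
  assert (A1 : altsum q 0 1 = 1) by (unfold altsum; simpl; ring).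
  assert (A2 : altsum q 0 2 = 0) by (unfold altsum; simpl; ring).
  repeat split.
  + simpl; exact A1.
  + change (altsum q 0 (0 + 3) = - q ^ (0 + 1)); rewrite altsum_rec, A0; ring.
  + change (altsum q 0 (2 + 3) = 0); rewrite altsum_rec, A2; ring.
- replace (6 * S r + 1)%nat with (6 * r + 1 + 6)%nat by lia.
  replace (6 * S r + 3)%nat with (6 * r + 3 + 6)%nat by lia.
  replace (6 * S r + 5)%nat with (6 * r + 5 + 6)%nat by lia.
  rewrite !altsum_6, I1, I2, I3; repeat split.
  + rewrite <- Cpow_add_r; f_equal; lia.
  + replace (6 * S r * S r + 5 * S r + 1)%nat
      with (2 * (6 * r + 3) + 5 + (6 * r * r + 5 * r + 1))%nat by lia.
    rewrite (Cpow_add_r q (2 * (6 * r + 3) + 5)); ring.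
  + ring.
Qed.

(* The coefficient belonging to [n = j + 1]; it equals [(n | 3) q^((2 n^2 + 1) / 3)]
   with the Legendre symbol [(n | 3)]. *)
Definition lambert_coeff (q : C) (j : nat) : C := q ^ S j * altsum q 0 (2 * j + 1).

(** With k = j - i the quotient of Pochhammers is the Gaussian binomial [2j + 1 - k; k]. The k in
    [triang (S k)] = [triang k] + k is absorbed by q^(i+1) = q^(j+1-k), which leaves s = 0. *)
Lemma lambert_coeff_sum (q : C) (j : nat) :
  (0 < Cmod q < 1)%R ->
  csum (fun i => q ^ S i * ((- (1)) ^ (j - i) * q ^ triang (S (j - i))
     * qpoch_fin q q (2 * i + 1 + (j - i))
     / (qpoch_fin q q (j - i) * qpoch_fin q q (2 * i + 1)))) (S j)
  = lambert_coeff q j.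
Proof.
intros Hq; unfold lambert_coeff, altsum.
replace (S (2 * j + 1)) with (S j + S j)%nat by lia.
rewrite csum_add, (csum_zero (fun k => _ * gbinom q (2 * j + 1 - (S j + k)) (S j + k))).
2:{ intros k _; rewrite gbinom_gt by lia; ring. }
rewrite Cplus_0_r, <- csum_scal, csum_rev; apply csum_ext; intros k Hk.
replace (S j - S k)%nat with (j - k)%nat by lia.
replace (j - (j - k))%nat with k by lia.
assert (B := gbinom_poch q (2 * j + 1 - k - k) k).
replace (2 * j + 1 - k - k + k)%nat with (2 * j + 1 - k)%nat in B by lia.
replace (2 * (j - k) + 1 + k)%nat with (2 * j + 1 - k)%nat by lia.
replace (2 * (j - k) + 1)%nat with (2 * j + 1 - k - k)%nat by lia.
rewrite <- B.
assert (Q0 : forall n, qpoch_fin q q n <> 0).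
{ intros n; apply qpoch_fin_neq_0; intros i; now apply qpoch_self_factor_neq_0. }
rewrite Nat.mul_0_l, Nat.add_0_r; simpl triang; rewrite Cpow_add_r.
replace (q ^ S j) with (q ^ S (j - k) * q ^ k)
  by (rewrite <- Cpow_add_r; f_equal; lia).
field; auto.
Qed.

Lemma lambert_coeff_values (q : C) (r : nat) :
  lambert_coeff q (3 * r) = q ^ (6 * r * r + 4 * r + 1) /\
  lambert_coeff q (3 * r + 1) = - q ^ (6 * r * r + 8 * r + 3) /\
  lambert_coeff q (3 * r + 2) = 0.
Proof.
unfold lambert_coeff; destruct (altsum_values q r) as [H1 [H2 H3]].
replace (2 * (3 * r) + 1)%nat with (6 * r + 1)%nat by lia.
replace (2 * (3 * r + 1) + 1)%nat with (6 * r + 3)%nat by lia.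
replace (2 * (3 * r + 2) + 1)%nat with (6 * r + 5)%nat by lia.
rewrite H1, H2, H3; repeat split.
- rewrite <- Cpow_add_r; f_equal; lia.
- replace (6 * r * r + 8 * r + 3)%nat
    with (S (3 * r + 1) + (6 * r * r + 5 * r + 1))%nat by lia.
  rewrite (Cpow_add_r q (S (3 * r + 1))); ring.
- ring.
Qed.

Lemma lambert_coeff_bound (q : C) (j : nat) :
  (0 < Cmod q < 1)%R -> (Cmod (lambert_coeff q j) <= 1 * Cmod q ^ j)%R.
Proof.
intros Hq.
assert (M : forall a, (j <= a)%nat -> (Cmod q ^ a <= 1 * Cmod q ^ j)%R).
{ intros a Ha; rewrite Rmult_1_l; replace a with (j + (a - j))%nat by lia.
  rewrite pow_add; pose proof (pow_le (Cmod q) j ltac:(lra)).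
  assert (Cmod q ^ (a - j) <= 1)%R by (rewrite <- (pow1 (a - j)); apply pow_incr; lra).
  nra. }
assert (D := Nat.div_mod_eq j 3); assert (U := Nat.mod_upper_bound j 3 ltac:(lia)).
destruct (lambert_coeff_values q (j / 3)) as [H1 [H2 H3]].
set (r := (j / 3)%nat) in *; destruct (j mod 3)%nat as [|[|[|m]]]; try lia.
- replace (3 * r)%nat with j in H1 by lia; rewrite H1, Cmod_pow; apply M; lia.
- replace (3 * r + 1)%nat with j in H2 by lia; rewrite H2, Cmod_opp, Cmod_pow.
  apply M; lia.
- replace (3 * r + 2)%nat with j in H3 by lia; rewrite H3, Cmod_0.
  rewrite Rmult_1_l; apply pow_le; lra.
Qed.

(** * Partial fractions in z + 1/z *)

Lemma lsum_seq_from (f : nat -> C) (a n : nat) :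
  lsum f (seq a n) = csum (fun t => f (a + t)%nat) n.
Proof.
revert a; induction n as [|n IH]; intros a; [reflexivity|].
rewrite csum_shift, Nat.add_0_r; simpl; rewrite IH; f_equal.
apply csum_ext; intros; f_equal; lia.
Qed.

Lemma lprod_seq_from (f : nat -> C) (a n : nat) :
  lprod f (seq a n) = cprod (fun t => f (a + t)%nat) n.
Proof.
revert a; induction n as [|n IH]; intros a; [reflexivity|].
rewrite cprod_shift, Nat.add_0_r; simpl; rewrite IH; f_equal.
apply cprod_ext; intros; f_equal; lia.
Qed.

Definition quad (z q : C) (n : nat) : C := (1 - z * q ^ n) * (1 - / z * q ^ n).

Definition quad_prod (z q : C) (K : nat) : C :=
  qpoch_fin (z * q ^ 1) q K * qpoch_fin (/ z * q ^ 1) q K.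

Lemma quad_prod_cprod (z q : C) (K : nat) :
  quad_prod z q K = cprod (fun j => quad z q (S j)) K.
Proof.
unfold quad_prod, quad; rewrite !qpoch_fin_cprod, <- cprod_mult.
apply cprod_ext; intros k _; rewrite Cpow_1_r, Cpow_S; ring.
Qed.

Lemma sign_triang (q : C) (l : nat) :
  q <> 0 ->
  cprod (fun i => - Cpowz q (- Z.of_nat (S i))) l * q ^ triang (S l) = (- (1)) ^ l.
Proof.
intros Hq; induction l as [|l IH]; [simpl; ring|].
cbn [cprod]; rewrite Cpow_S, <- IH, Cpowz_opp_nat.
change (triang (S (S l))) with (triang (S l) + S l)%nat; rewrite Cpow_add_r.
field; now apply Cpow_nz.
Qed.

(** With s = z + 1/z and u_n = q^n + q^(-n) one has [quad z q n] = q^n (u_n - s), so the poles in s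
    are simple. The divided difference of 1 at s and the u_n vanishes. Each u_n - u_n' factors into
    1 - q^(n'-n) and 1 - q^(n'+n), which turns the residues into Pochhammer quotients. *)
Lemma inv_quad_prod (z q : C) (i K : nat) :
  (0 < Cmod q < 1)%R -> z <> 0 -> (forall n, quad z q (S n) <> 0) -> (i < K)%nat ->
  quad_prod z q i / quad_prod z q K =
  csum (fun l => (1 - q ^ (2 * S (i + l))) / quad z q (S (i + l))
    * ((- (1)) ^ l * q ^ triang (S l) * qpoch_fin q q (2 * i + 1 + l)
       / (qpoch_fin q q l * qpoch_fin q q (K - S (i + l))
          * qpoch_fin q q (K + S (i + l))))) (K - i).
Proof.
intros Hq Hz HD Hi; assert (q0 : q <> 0) by (apply Cmod_gt_0; lra).
assert (Qn : forall n, q ^ n <> 0) by (intros; now apply Cpow_nz).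
assert (P0 : forall n, qpoch_fin q q n <> 0).
{ intros n; apply qpoch_fin_neq_0; intros j; now apply qpoch_self_factor_neq_0. }
assert (O0 : forall n, 1 - q ^ S n <> 0).
{ intros n; rewrite <- Cpowz_of_nat; apply one_minus_Cpowz_neq_0; [exact Hq | lia]. }
set (u := fun n => q ^ n + / q ^ n); set (s := z + / z).
assert (Us : forall n, u n - s = / q ^ n * quad z q n).
{ intros n; unfold u, s, quad; field; auto. }
assert (Uu : forall n n', u n - u n' =
  - / q ^ n' * ((1 - Cpowz q (Z.of_nat n' - Z.of_nat n)) * (1 - q ^ (n' + n)))).
{ intros n n'; unfold u; rewrite Cpowz_sub, !Cpowz_of_nat, Cpow_add_r by exact q0.
  field; auto. }
set (L := (K - i)%nat); set (ns := seq (S i) L).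
assert (Hns : forall n, In n ns -> exists l, n = S (i + l) /\ (l < L)%nat).
{ intros n Hn; apply in_seq in Hn; exists (n - S i)%nat; lia. }
assert (Uinj : forall n n', In n ns -> In n' ns -> n <> n' -> u n - u n' <> 0).
{ intros n n' Hn Hn' E; rewrite Uu; apply Cmult_neq_0.
  - intros H; apply (Cinv_neq_0 _ (Qn n')).
    replace (/ q ^ n') with (- - / q ^ n') by ring; rewrite H; ring.
  - apply Hns in Hn; destruct Hn as [l [-> _]]; apply Cmult_neq_0.
    + apply one_minus_Cpowz_neq_0; [exact Hq | lia].
    + rewrite Nat.add_succ_r; apply O0. }
assert (ND : NoDup (s :: map u ns)).
{ constructor.
  - intros H; apply in_map_iff in H; destruct H as [n [E Hn]].
    apply Hns in Hn; destruct Hn as [l [-> _]].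
    apply (Cmult_neq_0 _ _ (Cinv_neq_0 _ (Qn (S (i + l)))) (HD (i + l)%nat)).
    rewrite <- Us, E; ring.
  - assert (Ns : NoDup ns) by apply seq_NoDup.
    revert Uinj Ns; clear; induction ns as [|n l IH]; intros Uinj Ns; [constructor|].
    inversion_clear Ns as [|? ? N1 N2]; simpl; constructor.
    + intros H; apply in_map_iff in H; destruct H as [n' [E Hn']].
      apply (Uinj n' n); [now right | now left | now intros -> | rewrite E; ring].
    + apply IH; [|exact N2]; intros; apply Uinj; auto; now right. }
assert (D := divdiff_poly [] _ ND); simpl length in D; rewrite length_map in D.
unfold ns in D at 1; rewrite length_seq in D; specialize (D ltac:(unfold L; lia)).
unfold divdiff in D; cbn [lsum lprod] in D; rewrite lsum_map in D.
set (c := lprod (fun n => - / q ^ n) ns).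
assert (c0 : c <> 0).
{ apply lprod_neq_0; intros n _ H; apply (Cinv_neq_0 _ (Qn n)).
  replace (/ q ^ n) with (- - / q ^ n) by ring; rewrite H; ring. }
assert (E1 : cdiff s s * lprod (cdiff s) (map u ns) = c * lprod (quad z q) ns).
{ unfold cdiff at 1; destruct (Ceq_dec s s); [|contradiction].
  rewrite Cmult_1_l, lprod_map; unfold c; rewrite <- lprod_mult; apply lprod_ext.
  intros n Hn; apply Hns in Hn; destruct Hn as [l [-> _]].
  assert (U := Us (S (i + l))); unfold cdiff; destruct (Ceq_dec s (u (S (i + l)))) as [E|E].
  - exfalso; apply (Cmult_neq_0 _ _ (Cinv_neq_0 _ (Qn (S (i + l)))) (HD (i + l)%nat)).
    rewrite <- U, E; ring.
  - replace (s - u (S (i + l))) with (- (u (S (i + l)) - s)) by ring; rewrite U; ring. }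
(* The differences n' - n form a bilateral product around 0; the sums n' + n are consecutive from 2i
   + 2 + l. The latter include n' = n, hence the extra 1 - q^(2n) on the left. *)
assert (E2 : forall l, (l < L)%nat ->
  lprod (cdiff (u (S (i + l)))) (map u ns) * (1 - q ^ (2 * S (i + l))) =
  c * - q ^ S (i + l) *
  (qpoch_fin q q (L - S l) * qpoch_fin q q l
   * cprod (fun i => - Cpowz q (- Z.of_nat (S i))) l
   * qpoch_fin (q * q ^ (2 * i + 1 + l)) q L)).
{ intros l Hl; set (n := S (i + l)).
  assert (B := bilateral_product_1 q (Cpowz q 1) 1 l (L - S l) q0 ltac:(lia) eq_refl).
  replace (l + S (L - S l))%nat with L in B by lia.
  change (Cpowz q 1) with (q ^ 1) in B; rewrite Cpow_1_r in B; rewrite <- B; clear B.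
  rewrite qpoch_fin_cprod, <- cprod_mult.
  transitivity (c * - q ^ n * lprod (fun n' => onesub q (Z.of_nat n' - Z.of_nat n)
    * (1 - q ^ (n' + n))) ns).
  2:{ f_equal; unfold ns; rewrite lprod_seq_from; apply cprod_ext; intros t _; f_equal.
      - f_equal; unfold n; lia.
      - rewrite <- Cpow_S, <- Cpow_add_r; do 2 f_equal; unfold n; lia. }
  assert (Same : forall ms, (forall n', In n' ms -> In n' ns) -> ~ In n ms ->
    lprod (cdiff (u n)) (map u ms) = lprod (fun n => - / q ^ n) ms
    * lprod (fun n' => onesub q (Z.of_nat n' - Z.of_nat n) * (1 - q ^ (n' + n))) ms).
  { intros ms Hms Nm; rewrite lprod_map, <- lprod_mult; apply lprod_ext.
    intros n' Hn'; assert (n <> n') by now intros ->.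
    assert (I : In n ns) by (unfold ns, n; apply in_seq; lia).
    unfold cdiff; destruct (Ceq_dec (u n) (u n')) as [E|E].
    - exfalso; apply (Uinj n n' I (Hms n' Hn')); [assumption | rewrite E; ring].
    - rewrite Uu; unfold onesub; destruct (Z.eq_dec _ 0); [lia|]; reflexivity. }
  unfold c; assert (I : In n ns) by (unfold ns, n; apply in_seq; lia).
  assert (Ns : NoDup ns) by apply seq_NoDup.
  apply in_split in I; destruct I as [l1 [l2 I]].
  rewrite I, map_app, !lprod_app; cbn [map lprod].
  rewrite I in Ns; apply NoDup_remove_2 in Ns.
  rewrite !Same.
  - assert (Hc : cdiff (u n) (u n) = 1).
    { unfold cdiff; destruct (Ceq_dec (u n) (u n)); [reflexivity | contradiction]. }
    assert (Ho : onesub q (Z.of_nat n - Z.of_nat n) = 1).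
    { unfold onesub; destruct (Z.eq_dec _ 0); [reflexivity | lia]. }
    rewrite Hc, Ho; replace (2 * n)%nat with (n + n)%nat by lia; field; auto.
  - intros n' Hn'; rewrite I; apply in_or_app; right; now right.
  - intros H; apply Ns, in_or_app; now right.
  - intros n' Hn'; rewrite I; apply in_or_app; now left.
  - intros H; apply Ns, in_or_app; now left. }
rewrite E1 in D.
assert (PDK : quad_prod z q K = quad_prod z q i * lprod (quad z q) ns).
{ rewrite !quad_prod_cprod; replace K with (i + L)%nat by (unfold L; lia).
  rewrite cprod_add; f_equal; unfold ns; rewrite lprod_seq_from; reflexivity. }
assert (QP : forall n, quad_prod z q n <> 0).
{ intros n; rewrite quad_prod_cprod; apply cprod_neq_0; auto. }
assert (QL : lprod (quad z q) ns <> 0).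
{ intros H; apply (QP K); rewrite PDK, H; ring. }
transitivity (/ lprod (quad z q) ns).
{ rewrite PDK; field; auto. }
assert (Sl : lsum (fun n => 1 / (cdiff (u n) s * lprod (cdiff (u n)) (map u ns))) ns
  = - (1 / (c * lprod (quad z q) ns))).
{ match type of D with @eq _ (Cplus ?x ?y) _ =>
    assert (E : forall a b : C, a + b = 0 -> b = - a) end.
  { intros a b H; replace b with (a + b - a) by ring; rewrite H; ring. }
  exact (E _ _ D). }
replace (/ lprod (quad z q) ns) with (- c * - (1 / (c * lprod (quad z q) ns)))
  by (field; auto).
rewrite <- Sl, <- lsum_scal.
assert (Sh : forall f : nat -> C, lsum f ns = csum (fun l => f (S (i + l))) L).
{ intros f; unfold ns; rewrite lsum_seq_from; reflexivity. }
rewrite Sh; apply csum_ext; intros l Hl.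
assert (F := E2 l Hl); assert (G := sign_triang q l q0).
set (n := S (i + l)) in *.
assert (Cn : cdiff (u n) s = / q ^ n * quad z q n).
{ unfold cdiff; destruct (Ceq_dec (u n) s) as [E|E]; [|apply Us].
  exfalso; apply (Cmult_neq_0 _ _ (Cinv_neq_0 _ (Qn n)) (HD (i + l)%nat)).
  fold n; rewrite <- Us, E; ring. }
rewrite Cn.
assert (Q1 : qpoch_fin q q (K + n)
  = qpoch_fin q q (2 * i + 1 + l) * qpoch_fin (q * q ^ (2 * i + 1 + l)) q L).
{ rewrite <- qpoch_fin_add; f_equal; unfold n, L; lia. }
replace (K - n)%nat with (L - S l)%nat by (unfold n, L; lia).
assert (K1 := P0 (K + n)%nat); rewrite Q1 in K1 |- *.
assert (K2 : qpoch_fin (q * q ^ (2 * i + 1 + l)) q L <> 0).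
{ intros H; apply K1; rewrite H; ring. }
assert (O2 : 1 - q ^ (2 * n) <> 0).
{ unfold n; replace (2 * S (i + l))%nat with (S (2 * (i + l) + 1)) by lia; apply O0. }
assert (S0 : cprod (fun i => - Cpowz q (- Z.of_nat (S i))) l <> 0).
{ apply cprod_neq_0; intros k _ H; apply (Cpowz_neq_0 q (- Z.of_nat (S k)) q0).
  replace (Cpowz q (- Z.of_nat (S k))) with (- - Cpowz q (- Z.of_nat (S k))) by ring.
  rewrite H; ring. }
replace ((- (1)) ^ l * q ^ triang (S l))
  with (/ cprod (fun i => - Cpowz q (- Z.of_nat (S i))) l).
2:{ assert (Sq : (- (1)) ^ l * (- (1)) ^ l = 1).
    { rewrite <- Cpow_mult_l; replace (- (1) * - (1)) with (RtoC 1) by ring.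
      apply Cpow_1_l. }
    rewrite <- G in Sq at 1.
    set (x := cprod (fun i => - Cpowz q (- Z.of_nat (S i))) l) in *.
    transitivity (/ x * (x * q ^ triang (S l) * (- (1)) ^ l)).
    - rewrite Sq; ring.
    - field; exact S0. }
assert (L0 := lprod_cdiff_neq_0 (u n) (map u ns)).
replace (lprod (cdiff (u n)) (map u ns)) with
  (c * - q ^ n *
    (qpoch_fin q q (L - S l) * qpoch_fin q q l
     * cprod (fun i => - Cpowz q (- Z.of_nat (S i))) l
     * qpoch_fin (q * q ^ (2 * i + 1 + l)) q L) / (1 - q ^ (2 * n)))
  by (rewrite <- F; field; exact O2).
assert (Dn := HD (i + l)%nat); fold n in Dn.
assert (R1 := P0 (L - S l)%nat); assert (R2 := P0 l); assert (R3 := P0 (2 * i + 1 + l)%nat).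
assert (R4 := Qn n).
field; repeat split; auto.
Qed.

Lemma csum_triangle (h : nat -> nat -> C) (K : nat) :
  csum (fun i => csum (fun l => h i (i + l)%nat) (K - i)) K =
  csum (fun j => csum (fun i => h i j) (S j)) K.
Proof.
induction K as [|K IH]; [reflexivity|].
transitivity (csum (fun i => csum (fun l => h i (i + l)%nat) (K - i)) (S K)
              + csum (fun i => h i K) (S K)).
- rewrite <- csum_plus; apply csum_ext; intros i Hi.
  replace (S K - i)%nat with (S (K - i)) by lia; cbn [csum]; do 2 f_equal; lia.
- cbn [csum] in *; rewrite IH, Nat.sub_diag; simpl; ring.
Qed.

Lemma finite_lambert (z q : C) (K : nat) :
  (0 < Cmod q < 1)%R -> z <> 0 -> (forall n, quad z q (S n) <> 0) ->
  csum (fun i => q ^ S i / qpoch_fin q q (2 * i + 1)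
                 * (quad_prod z q i / quad_prod z q K)) K =
  csum (fun j => (1 - q ^ (2 * S j)) / quad z q (S j) * lambert_coeff q j
    * / (qpoch_fin q q (K - S j) * qpoch_fin q q (K + S j))) K.
Proof.
intros Hq Hz HD.
assert (P0 : forall n, qpoch_fin q q n <> 0).
{ intros n; apply qpoch_fin_neq_0; intros j; now apply qpoch_self_factor_neq_0. }
set (h := fun i j => (1 - q ^ (2 * S j)) / quad z q (S j)
    * / (qpoch_fin q q (K - S j) * qpoch_fin q q (K + S j))
    * (q ^ S i * ((- (1)) ^ (j - i) * q ^ triang (S (j - i))
     * qpoch_fin q q (2 * i + 1 + (j - i))
     / (qpoch_fin q q (j - i) * qpoch_fin q q (2 * i + 1))))).
transitivity (csum (fun i => csum (fun l => h i (i + l)%nat) (K - i)) K).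
- apply csum_ext; intros i Hi; rewrite inv_quad_prod by assumption.
  rewrite <- csum_scal; apply csum_ext; intros l Hl.
  unfold h; replace (i + l - i)%nat with l by lia.
  assert (D := HD (i + l)%nat).
  field; auto 10.
- rewrite csum_triangle; apply csum_ext; intros j Hj; unfold h.
  rewrite csum_scal, lambert_coeff_sum by exact Hq; ring.
Qed.

(** Tannery's theorem on both sides of [finite_lambert] times (q;q)_oo. On the left, (q;q)_oo /
    (q;q)_(2i+1) = (q^(2i+2);q)_oo restores the term n = i + 1; on the right, the weights tend to
    1/(q;q)_oo^2, and one factor cancels. *)
Lemma lambert_series (z q : C) :
  (0 < Cmod q < 1)%R -> z <> 0 -> (forall n, quad z q (S n) <> 0) ->
  Ccv (csum (fun j => (1 - q ^ (2 * S j)) / quad z q (S j) * lambert_coeff q j))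
    (qpoch q q * PPt z q).
Proof.
intros Hq Hz HD; assert (q0 : q <> 0) by (apply Cmod_gt_0; lra).
assert (F0 : forall k, 1 - q * q ^ k <> 0) by (intros; now apply qpoch_self_factor_neq_0).
assert (P0 : forall n, qpoch_fin q q n <> 0) by (intros; now apply qpoch_fin_neq_0).
assert (PI : qpoch q q <> 0) by (apply qpoch_neq_0; [lra | exact F0]).
assert (Z1 : forall k, 1 - z * q ^ S k <> 0).
{ intros k H; apply (HD k); unfold quad; rewrite H; ring. }
assert (Z2 : forall k, 1 - / z * q ^ S k <> 0).
{ intros k H; apply (HD k); unfold quad; rewrite H; ring. }
assert (Z1' : forall k, 1 - z * q ^ 1 * q ^ k <> 0).
{ intros k; rewrite <- Cmult_assoc, <- Cpow_add_r; apply Z1. }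
assert (Z2' : forall k, 1 - / z * q ^ 1 * q ^ k <> 0).
{ intros k; rewrite <- Cmult_assoc, <- Cpow_add_r; apply Z2. }
assert (Q0 : forall n, quad_prod z q n <> 0).
{ intros n; apply Cmult_neq_0; now apply qpoch_fin_neq_0. }
set (QI := qpoch (z * q ^ 1) q * qpoch (/ z * q ^ 1) q).
assert (QI0 : QI <> 0) by (apply Cmult_neq_0; apply qpoch_neq_0; auto; lra).
assert (Qc : Ccv (quad_prod z q) QI).
{ apply (Ccv_mult (qpoch_fin (z * q ^ 1) q)); apply qpoch_cv; lra. }
destruct (Ccv_bounded _ _ Qc) as [MQ [MQ0 HMQ]].
destruct (Ccv_bounded _ _ (Ccv_inv _ _ Qc QI0 Q0)) as [MI [MI0 HMI]].
assert (Pc : Ccv (qpoch_fin q q) (qpoch q q)) by (apply qpoch_cv; lra).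
destruct (Ccv_bounded _ _ (Ccv_inv _ _ Pc PI P0)) as [MP [MP0 HMP]].
assert (TL : Ccv (fun K => csum (fun i => qpoch q q * (q ^ S i
  / qpoch_fin q q (2 * i + 1) * (quad_prod z q i / quad_prod z q K))) K) (PPt z q)).
{ unfold PPt; apply tannery with (A := (Cmod (qpoch q q) * (MP * (MQ * MI)))%R)
    (r := Cmod q).
  - split; [apply Cmod_ge_0 | lra].
  - intros K n _; unfold Cdiv; rewrite !Cmod_mult, Cpow_S, Cmod_mult, Cmod_pow.
    replace (Cmod (qpoch q q) * (MP * (MQ * MI)) * Cmod q ^ n)%R
      with (Cmod (qpoch q q) * ((1 * Cmod q ^ n) * MP * (MQ * MI)))%R by ring.
    apply Rmult_le_compat_l; [apply Cmod_ge_0|].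
    assert (T := pow_le (Cmod q) n (Cmod_ge_0 q)).
    repeat first [apply Rmult_le_compat | apply Rmult_le_pos | apply Cmod_ge_0
                 | apply HMP | apply HMQ | apply HMI | lra].
  - intros i; replace (PPt_term z q (S i)) with (qpoch q q * (q ^ S i
      / qpoch_fin q q (2 * i + 1) * (quad_prod z q i * / QI))).
    + do 3 apply Ccv_scal; now apply Ccv_inv.
    + unfold PPt_term, QI, quad_prod.
      rewrite (qpoch_shift q q (2 * i + 1)) by lra.
      rewrite (qpoch_shift (z * q ^ 1) q i), (qpoch_shift (/ z * q ^ 1) q i) by lra.
      replace (q * q ^ (2 * i + 1)) with (q ^ (2 * S i))
        by (rewrite <- Cpow_S; f_equal; lia).
      replace (z * q ^ 1 * q ^ i) with (z * q ^ S i)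
        by (rewrite Cpow_S, Cpow_1_r; ring).
      replace (/ z * q ^ 1 * q ^ i) with (/ z * q ^ S i)
        by (rewrite Cpow_S, Cpow_1_r; ring).
      assert (qpoch (z * q ^ S i) q <> 0).
      { apply qpoch_neq_0; [lra|]; intros k; rewrite <- Cmult_assoc, <- Cpow_add_r.
        apply (Z1 (i + k)%nat). }
      assert (qpoch (/ z * q ^ S i) q <> 0).
      { apply qpoch_neq_0; [lra|]; intros k; rewrite <- Cmult_assoc, <- Cpow_add_r.
        apply (Z2 (i + k)%nat). }
      assert (qpoch_fin (z * q ^ 1) q i <> 0) by now apply qpoch_fin_neq_0.
      assert (qpoch_fin (/ z * q ^ 1) q i <> 0) by now apply qpoch_fin_neq_0.
      field; auto 10. }
set (h := fun j => (1 - q ^ (2 * S j)) / quad z q (S j) * lambert_coeff q j) in *.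
assert (Hb : exists A, forall j, (Cmod (h j) <= A * Cmod q ^ j)%R).
{ assert (L : Ccv (fun j => (1 - q ^ (2 * S j)) * / quad z q (S j))
    ((1 - 0) * / ((1 - z * 0) * (1 - / z * 0)))).
  { apply Ccv_mult.
    - apply Ccv_minus; [apply Ccv_const|].
      apply (Ccv_subseq _ _ (fun j => (2 * S j)%nat) ltac:(intros N; exists N; intros; lia)).
      apply Ccv_pow0; lra.
    - apply Ccv_inv; [| |exact HD].
      + assert (S0 : Ccv (fun j => q ^ S j) 0).
        { apply (Ccv_subseq _ _ S ltac:(intros N; exists N; intros; lia)).
          apply Ccv_pow0; lra. }
        apply Ccv_mult; (apply Ccv_minus; [apply Ccv_const | now apply Ccv_scal]).
      + replace ((1 - z * 0) * (1 - / z * 0)) with (RtoC 1) by ring; apply C1_nz. }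
  destruct (Ccv_bounded _ _ L) as [A [_ HA]]; exists (A * 1)%R; intros j.
  unfold h, Cdiv; rewrite Cmod_mult.
  replace (A * 1 * Cmod q ^ j)%R with (A * (1 * Cmod q ^ j))%R by ring.
  apply Rmult_le_compat; try apply Cmod_ge_0; [apply HA|].
  now apply lambert_coeff_bound. }
destruct Hb as [A HA].
assert (A0 : (0 <= A)%R).
{ specialize (HA O); pose proof (Cmod_ge_0 (h O)); simpl in HA; lra. }
assert (TR : Ccv (fun K => csum (fun j => qpoch q q * (h j
  * / (qpoch_fin q q (K - S j) * qpoch_fin q q (K + S j)))) K)
  (CSeries (fun j => / qpoch q q * h j))).
{ apply tannery with (A := (Cmod (qpoch q q) * (A * (MP * MP)))%R) (r := Cmod q).
  - split; [apply Cmod_ge_0 | lra].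
  - intros K n _; rewrite Cinv_mul, !Cmod_mult.
    replace (Cmod (qpoch q q) * (A * (MP * MP)) * Cmod q ^ n)%R
      with (Cmod (qpoch q q) * (A * Cmod q ^ n * (MP * MP)))%R by ring.
    apply Rmult_le_compat_l; [apply Cmod_ge_0|].
    repeat first [apply HA | apply HMP | apply Rmult_le_compat | apply Rmult_le_pos
                 | apply Cmod_ge_0].
  - intros j; replace (/ qpoch q q * h j)
      with (qpoch q q * (h j * / (qpoch q q * qpoch q q))) by (field; auto).
    do 2 apply Ccv_scal; apply Ccv_inv.
    + apply Ccv_mult; (eapply Ccv_subseq; [|exact Pc]).
      * intros N; exists (N + S j)%nat; intros; lia.
      * intros N; exists N; intros; lia.
    + now apply Cmult_neq_0.
    + intros K; now apply Cmult_neq_0. }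
assert (E : PPt z q = CSeries (fun j => / qpoch q q * h j)).
{ apply (Ccv_unique _ _ _ TL); eapply Ccv_ext; [|exact TR]; intros K; cbv beta.
  rewrite !csum_scal, finite_lambert by assumption; reflexivity. }
rewrite E; apply (Ccv_ext (fun K => qpoch q q * csum (fun j => / qpoch q q * h j) K)).
- intros K; rewrite csum_scal; field; exact PI.
- apply Ccv_scal, geom_series_conv with (A := (Cmod (/ qpoch q q) * A)%R) (r := Cmod q).
  + split; [apply Cmod_ge_0 | lra].
  + intros n; rewrite Cmod_mult, Rmult_assoc.
    apply Rmult_le_compat_l; [apply Cmod_ge_0 | apply HA].
Qed.

(** This equals 1/(1 - z q^n) + 1/(1 - q^n/z) - 1 and is odd in n, which absorbs the sign of the
    Legendre symbol when n is replaced by -n. *)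
Definition lambert_factor (z q : C) (n : Z) : C :=
  (1 - Cpowz q (2 * n)) / ((1 - z * Cpowz q n) * (1 - / z * Cpowz q n)).

(** Putting n = 3r + 1 with r in Z covers the class 1 modulo 3 by r >= 0 and the class 2, through
    -n, by r < 0; the exponent (2n^2 + 1)/3 becomes 6r^2 + 4r + 1. *)
Theorem PPt_lambert (z q : C) :
  (0 < Cmod q < 1)%R -> z <> 0 -> (forall n, quad z q (S n) <> 0) ->
  Ccv (zsum (fun r => Cpowz q (6 * r * r + 4 * r + 1) * lambert_factor z q (3 * r + 1)))
    (qpoch q q * PPt z q).
Proof.
intros Hq Hz HD; assert (q0 : q <> 0) by (apply Cmod_gt_0; lra).
assert (L := lambert_series z q Hq Hz HD).
(* Three values of j make one step of the window: j = 3K gives r = K, j = 3K + 1 gives r = -(K + 1),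
   and j = 3K + 2 contributes 0. *)
apply (Ccv_subseq _ _ (fun K => (3 * K)%nat) ltac:(intros N; exists N; intros; lia)) in L.
eapply Ccv_ext; [|exact L]; intros K; cbv beta; clear L.
set (h := fun j => (1 - q ^ (2 * S j)) / quad z q (S j) * lambert_coeff q j).
assert (Fac : forall j, (1 - q ^ (2 * S j)) / quad z q (S j)
  = lambert_factor z q (Z.of_nat (S j))).
{ intros j; unfold lambert_factor, quad.
  replace (2 * Z.of_nat (S j))%Z with (Z.of_nat (2 * S j)) by lia.
  rewrite !Cpowz_of_nat; reflexivity. }
induction K as [|K IH]; [reflexivity|].
replace (3 * S K)%nat with (S (S (S (3 * K)))) by lia.
unfold zsum in *; cbn [csum]; rewrite IH; unfold h; rewrite !Fac.
destruct (lambert_coeff_values q K) as [H1 [H2 H3]].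
replace (S (3 * K)) with (3 * K + 1)%nat by lia.
replace (S (3 * K + 1)) with (3 * K + 2)%nat by lia.
rewrite H1, H2, H3.
replace (Z.of_nat (3 * K + 1)) with (3 * Z.of_nat K + 1)%Z by lia.
replace (q ^ (6 * K * K + 4 * K + 1))
  with (Cpowz q (6 * Z.of_nat K * Z.of_nat K + 4 * Z.of_nat K + 1))
  by (rewrite <- Cpowz_of_nat; f_equal; lia).
replace (q ^ (6 * K * K + 8 * K + 3))
  with (Cpowz q (6 * (- Z.of_nat (S K)) * (- Z.of_nat (S K)) + 4 * (- Z.of_nat (S K)) + 1))
  by (rewrite <- Cpowz_of_nat; f_equal; lia).
replace (lambert_factor z q (Z.of_nat (3 * K + 2)))
  with (- lambert_factor z q (3 * (- Z.of_nat (S K)) + 1)); [ring|].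
replace (3 * (- Z.of_nat (S K)) + 1)%Z with (- Z.of_nat (3 * K + 2))%Z by lia.
assert (D := HD (3 * K + 1)%nat); unfold quad in D.
replace (S (3 * K + 1)) with (3 * K + 2)%nat in D by lia.
unfold lambert_factor; set (n := (3 * K + 2)%nat) in *.
replace (2 * Z.of_nat n)%Z with (Z.of_nat (2 * n)) by lia.
replace (2 * - Z.of_nat n)%Z with (- Z.of_nat (2 * n))%Z by lia.
rewrite !Cpowz_opp_nat, !Cpowz_of_nat.
replace (2 * n)%nat with (n + n)%nat by lia; rewrite Cpow_add_r.
assert (Q := Cpow_nz q n q0); set (x := q ^ n) in *.
assert (D1 : 1 - z * x <> 0) by (intros H; apply D; rewrite H; ring).
assert (D2 : 1 - / z * x <> 0) by (intros H; apply D; rewrite H; ring).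
assert (D3 : x - z <> 0).
{ intros H; apply D2; replace (1 - / z * x) with (- / z * (x - z)) by (field; auto).
  rewrite H; ring. }
assert (D4 : z - x <> 0).
{ intros H; apply D3; replace (x - z) with (- (z - x)) by ring; rewrite H; ring. }
assert (D5 : z * x - 1 <> 0).
{ intros H; apply D1; replace (1 - z * x) with (- (z * x - 1)) by ring; rewrite H; ring. }
field; repeat split; auto.
Qed.

(** * The quintuple product and the dissection of the Euler product *)

(** A terminating summand with total 1. The bilateral series appears for n = 2m and z q^(-m) in
    place of z, after recentring k at m. *)
Definition quint_term (z q : C) (n k : nat) : C :=
  (1 + z * q ^ k) * gbinom q n k * qpoch_fin z q (S n)
  / qpoch_fin (z ^ 2 * q ^ k) q (S n) * z ^ k * q ^ (k * k).

(* The WZ companion of [quint_term], at [k + 1]. *)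
Definition quint_cert (z q : C) (n k : nat) : C :=
  - q ^ (n - k) * gbinom q n k * qpoch_fin z q (S n)
  / qpoch_fin (z ^ 2 * q ^ S k) q (S n) * z ^ S k * q ^ (S k * S k).

Lemma qpoch_fin_first (z q : C) (n : nat) :
  qpoch_fin z q (S n) = (1 - z) * qpoch_fin (z * q) q n.
Proof.
assert (E := qpoch_fin_add z q 1 n); rewrite Cpow_1_r in E.
etransitivity; [exact E | simpl; ring].
Qed.

(** The WZ equation in summed form, the companion being 0 at k = 0. Once the Pochhammers share their
    common part, each step is a rational identity in z, q, q^j and q^(n-j). *)
Lemma quint_telescope (z q : C) (n j : nat) :
  (0 < Cmod q < 1)%R -> (forall k, 1 - z ^ 2 * q ^ k <> 0) -> (j <= n)%nat ->
  csum (fun k => quint_term z q (S n) k - quint_term z q n k) (S j) = quint_cert z q n j.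
Proof.
intros Hq Hz Hj; assert (q0 : q <> 0) by (apply Cmod_gt_0; lra).
assert (Z0 : forall i m, qpoch_fin (z ^ 2 * q ^ i) q m <> 0).
{ intros i m; apply qpoch_fin_neq_0; intros k; rewrite <- Cmult_assoc, <- Cpow_add_r.
  apply Hz. }
assert (O0 : forall n, 1 - q ^ S n <> 0).
{ intros i; rewrite <- Cpowz_of_nat; apply one_minus_Cpowz_neq_0; [exact Hq | lia]. }
induction j as [|j IH].
- cbn [csum]; rewrite Cplus_0_l; unfold quint_term, quint_cert.
  rewrite !gbinom_0, Nat.sub_0_r, !Nat.mul_1_l, !Cpow_1_r; simpl (0 * 0)%nat.
  rewrite (qpoch_fin_first (z ^ 2 * q ^ 0) q (S n)), (qpoch_fin_first (z ^ 2 * q ^ 0) q n).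
  replace (z ^ 2 * q ^ 0 * q) with (z ^ 2 * q ^ 1) by (simpl; ring).
  assert (Y := Z0 1%nat n); assert (X := Hz 0%nat); assert (W := Hz (S n)).
  rewrite Cpow_1_r in *; cbn [qpoch_fin].
  rewrite Cpow_S in *; change (q ^ 0) with (RtoC 1) in *.
  change (z ^ 0) with (RtoC 1).
  replace (1 - z ^ 2 * q * q ^ n) with (1 - z ^ 2 * (q * q ^ n)) by ring.
  field; repeat split; auto.
  intros H; apply X; rewrite <- H; ring.
- match goal with |- csum ?f _ = _ =>
    change (csum f (S (S j))) with (csum f (S j) + f (S j)) end.
  rewrite IH by lia; unfold quint_term, quint_cert.
  change (gbinom q (S n) (S j)) with (gbinom q n j + q ^ S j * gbinom q n (S j)).
  (* The difference of the two Pascal rules. *)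
  assert (B : gbinom q n (S j) = (1 - q ^ (n - j)) * gbinom q n j / (1 - q ^ S j)).
  { assert (P := gbinom_pascal q n j ltac:(lia)).
    change (gbinom q (S n) (S j)) with (gbinom q n j + q ^ S j * gbinom q n (S j)) in P.
    assert (E : (1 - q ^ S j) * gbinom q n (S j) = (1 - q ^ (n - j)) * gbinom q n j).
    { transitivity (gbinom q n (S j) + q ^ (n - j) * gbinom q n j
        - q ^ S j * gbinom q n (S j) - q ^ (n - j) * gbinom q n j); [ring|].
      rewrite <- P; ring. }
    rewrite <- E; field; apply O0. }
  rewrite B.
  rewrite (qpoch_fin_first (z ^ 2 * q ^ S j) q (S n)),
    (qpoch_fin_first (z ^ 2 * q ^ S j) q n).
  replace (z ^ 2 * q ^ S j * q) with (z ^ 2 * q ^ S (S j)) by (rewrite (Cpow_S q (S j)); ring).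
  assert (Y := Z0 (S (S j)) n); assert (X := Hz (S j)); assert (W := Hz (S (S j) + n)%nat).
  assert (O := O0 j).
  cbn [qpoch_fin].
  replace (n - j)%nat with (S (n - S j)) by lia.
  replace (S j * S j)%nat with (j * j + (j + (j + 1)))%nat by lia.
  replace (S (S j) * S (S j))%nat with (j * j + (j + (j + (j + (j + 4)))))%nat by lia.
  replace (q ^ n) with (q ^ S (n - S j) * q ^ j)
    by (rewrite <- Cpow_add_r; f_equal; lia).
  rewrite Cpow_add_r in W.
  replace (q ^ n) with (q ^ S (n - S j) * q ^ j) in W
    by (rewrite <- Cpow_add_r; f_equal; lia).
  replace (q ^ S n) with (q * (q ^ S (n - S j) * q ^ j))
    by (rewrite <- Cpow_add_r, <- Cpow_S; f_equal; lia).
  rewrite !Cpow_add_r, !Cpow_S in *; rewrite ?Cpow_1_r in *.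
  set (a := q ^ j) in *; set (N := q ^ (n - S j)) in *.
  set (Yv := qpoch_fin (z ^ 2 * (q * (q * a))) q n) in *.
  change (q ^ 0) with (RtoC 1) in *.
  set (s := q ^ (j * j)); set (zz := z ^ j).
  set (pz := qpoch_fin z q n).
  field; repeat split; auto; intros H;
    first [apply W; rewrite <- H; ring | apply X; rewrite <- H; ring].
Qed.

(** Passing from n to n + 1, the telescoped differences cancel the new term k = n + 1; at n = 0 the
    sum is (1 + z)(1 - z)/(1 - z^2). *)
Lemma finite_quintuple (z q : C) (n : nat) :
  (0 < Cmod q < 1)%R -> (forall k, 1 - z ^ 2 * q ^ k <> 0) ->
  csum (quint_term z q n) (S n) = 1.
Proof.
intros Hq Hz.
assert (Z0 : forall i m, qpoch_fin (z ^ 2 * q ^ i) q m <> 0).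
{ intros i m; apply qpoch_fin_neq_0; intros k; rewrite <- Cmult_assoc, <- Cpow_add_r.
  apply Hz. }
induction n as [|n IH].
- unfold quint_term; simpl; assert (X := Hz 0%nat); simpl in X.
  assert (1 - z * (z * 1) * 1 * 1 <> 0) by (intros H; apply X; rewrite <- H; ring).
  field; intros H'; apply X; rewrite <- H'; ring.
- match goal with |- csum ?f _ = _ =>
    change (csum f (S (S n))) with (csum f (S n) + f (S n)) end.
  assert (T := quint_telescope z q n n Hq Hz (le_n n)).
  assert (E : csum (quint_term z q (S n)) (S n) = 1 + quint_cert z q n n).
  { rewrite <- T, <- IH, <- csum_plus; apply csum_ext; intros; ring. }
  rewrite E; unfold quint_term, quint_cert.
  assert (G : forall m, gbinom q m m = 1).
  { intros m; induction m as [|m IHm]; [reflexivity|].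
    cbn [gbinom]; rewrite IHm, gbinom_gt by lia; ring. }
  rewrite !G, Nat.sub_diag; cbn [qpoch_fin].
  assert (Y := Z0 (S n) n); assert (W := Hz (S n + n)%nat); assert (W' := Hz (S n + S n)%nat).
  rewrite Cpow_add_r, Cmult_assoc in W, W'.
  rewrite !Cpow_S in *; change (q ^ 0) with (RtoC 1) in *.
  field; repeat split; auto; intros H;
    first [apply W; rewrite <- H; ring | apply W'; rewrite <- H; ring].
Qed.

Definition pent (k : Z) : Z := (k * (3 * k - 1) / 2)%Z.

Lemma pent_double (k : Z) : (2 * pent k = 3 * (k * k) - k)%Z.
Proof.
unfold pent; destruct (Z.Even_or_Odd k) as [[j ->]|[j ->]].
- replace (2 * j * (3 * (2 * j) - 1))%Z with (j * (6 * j - 1) * 2)%Z by ring.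
  rewrite Z.div_mul; lia.
- replace ((2 * j + 1) * (3 * (2 * j + 1) - 1))%Z with ((2 * j + 1) * (3 * j + 1) * 2)%Z
    by ring.
  rewrite Z.div_mul; lia.
Qed.

Lemma triang_double (l : nat) : (2 * Z.of_nat (triang (S l)) = Z.of_nat l * (Z.of_nat l + 1))%Z.
Proof.
induction l as [|l IH]; [reflexivity|].
change (triang (S (S l))) with (triang (S l) + S l)%nat; lia.
Qed.

Lemma Cneg1_neq_0 : - (1) <> 0 :> C.
Proof. intros H; apply C1_nz; replace (RtoC 1) with (- - (1)) by ring; rewrite H; ring. Qed.

Lemma Cpowz_neg1_even (j : Z) : Cpowz (- (1)) (2 * j) = 1.
Proof.
rewrite Cpowz_mul by apply Cneg1_neq_0.
replace (Cpowz (- (1)) 2) with (RtoC 1) by (simpl; ring).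
apply Cpowz_1_l.
Qed.

Definition quint_base (z q : C) (k : Z) : C :=
  Cpowz (- (1)) k * Cpowz q (pent k) * Cpowz z (3 * k) * (1 + z * Cpowz q k).

(** All of the recentred finite summand that depends on m. For fixed k it tends to the reciprocal of
    the product side. *)
Definition quint_coef (z q : C) (m : nat) (k : Z) : C :=
  qpoch_fin q q (2 * m)
  / (qpoch_fin q q (Z.to_nat (Z.of_nat m + k)) * qpoch_fin q q (Z.to_nat (Z.of_nat m - k)))
  * (qpoch_fin z q (S m) * qpoch_fin (q / z) q m
     / (qpoch_fin (z ^ 2) q (S (Z.to_nat (Z.of_nat m + k)))
        * qpoch_fin (q / z ^ 2) q (Z.to_nat (Z.of_nat m - k)))).

Lemma flip_cprod (u q : C) (l : nat) :
  u <> 0 -> q <> 0 ->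
  cprod (fun i => - (u * Cpowz q (- Z.of_nat (S i)))) l =
  Cpowz u (Z.of_nat l) * Cpowz (- (1)) (Z.of_nat l) * Cpowz q (- Z.of_nat (triang (S l))).
Proof.
intros Hu Hq; rewrite !Cpowz_of_nat, Cpowz_opp_nat, <- (sign_triang q l Hq).
assert (H := Cpow_nz q (triang (S l)) Hq).
transitivity (u ^ l * cprod (fun i => - Cpowz q (- Z.of_nat (S i))) l).
- clear H; induction l as [|l IH]; [simpl; ring|].
  cbn [cprod]; rewrite IH, Cpow_S; ring.
- field; exact H.
Qed.

Lemma quint_term_shift (z q : C) (m i : nat) :
  (0 < Cmod q < 1)%R -> z <> 0 -> (forall k, 1 - z ^ 2 * Cpowz q k <> 0) ->
  (i <= 2 * m)%nat ->
  quint_term (z / q ^ m) q (2 * m) i =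
  quint_base z q (Z.of_nat i - Z.of_nat m) * quint_coef z q m (Z.of_nat i - Z.of_nat m).
Proof.
intros Hq Hz Hk Hi; assert (q0 : q <> 0) by (apply Cmod_gt_0; lra).
assert (P0 : forall n, qpoch_fin q q n <> 0).
{ intros n; apply qpoch_fin_neq_0; intros j; now apply qpoch_self_factor_neq_0. }
assert (Qn : forall n, q ^ n <> 0) by (intros; now apply Cpow_nz).
assert (Qz : forall n, Cpowz q n <> 0) by (intros; now apply Cpowz_neq_0).
assert (z2 := Cpow_nz z 2 Hz).
set (b := (2 * m - i)%nat).
unfold quint_term, quint_base, quint_coef.
replace (Z.to_nat (Z.of_nat m + (Z.of_nat i - Z.of_nat m))) with i by lia.
replace (Z.to_nat (Z.of_nat m - (Z.of_nat i - Z.of_nat m))) with b by lia.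
assert (G := gbinom_poch q b i); replace (b + i)%nat with (2 * m)%nat in G by lia.
rewrite <- G.
assert (E0 : z / q ^ m * q ^ i = z * Cpowz q (Z.of_nat i - Z.of_nat m)).
{ rewrite Cpowz_sub, !Cpowz_of_nat by exact q0; field; auto. }
assert (E1 := bilateral_product z q m (S m) Hz q0).
assert (F1 : qpoch_fin (z / q ^ m) q (S (2 * m))
  = cprod (fun i => 1 - z * Cpowz q (Z.of_nat i - Z.of_nat m)) (m + S m)).
{ rewrite qpoch_fin_cprod; replace (m + S m)%nat with (S (2 * m)) by lia.
  apply cprod_ext; intros t _; rewrite Cpowz_sub, !Cpowz_of_nat by exact q0; field; auto. }
assert (E2 := bilateral_product (z ^ 2) q b (S i) z2 q0).
assert (F2 : qpoch_fin ((z / q ^ m) ^ 2 * q ^ i) q (S (2 * m))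
  = cprod (fun i => 1 - z ^ 2 * Cpowz q (Z.of_nat i - Z.of_nat b)) (b + S i)).
{ rewrite qpoch_fin_cprod; replace (b + S i)%nat with (S (2 * m)) by lia.
  apply cprod_ext; intros t _.
  replace (Z.of_nat t - Z.of_nat b)%Z
    with (Z.of_nat t + Z.of_nat i - Z.of_nat m - Z.of_nat m)%Z by lia.
  rewrite !Cpowz_sub, Cpowz_add, !Cpowz_of_nat by exact q0; field; auto. }
assert (N2 : qpoch_fin (z ^ 2) q (S i) * qpoch_fin (q / z ^ 2) q b <> 0).
{ apply Cmult_neq_0; apply qpoch_fin_neq_0; intros k H.
  - apply (Hk (Z.of_nat k)); rewrite Cpowz_of_nat; exact H.
  - apply (Hk (- Z.of_nat (S k))%Z); rewrite Cpowz_opp_nat, (Cpow_S q k).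
    replace (1 - z ^ 2 * / (q * q ^ k))
      with (- (z ^ 2 / (q * q ^ k)) * (1 - q / z ^ 2 * q ^ k)) by (field; auto).
    rewrite H; ring. }
rewrite F1, F2, E0, E1, E2, !flip_cprod by assumption.
set (A := qpoch_fin z q (S m)); set (B := qpoch_fin (q / z) q m).
set (X := qpoch_fin (z ^ 2) q (S i) * qpoch_fin (q / z ^ 2) q b) in *.
assert (S0 : forall n, Cpowz (- (1)) n <> 0).
{ intros n; apply Cpowz_neq_0, Cneg1_neq_0. }
assert (Zn : forall n, Cpowz z n <> 0) by (intros; now apply Cpowz_neq_0).
assert (Zp : forall n, Cpowz (z ^ 2) n = Cpowz z (2 * n)) by (intros; now apply Cpowz_pow).
rewrite Zp.
replace ((z / q ^ m) ^ i) with (Cpowz z (Z.of_nat i)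
  * Cpowz q (- (Z.of_nat m * Z.of_nat i))).
2:{ rewrite Cpowz_opp by exact q0; rewrite <- Nat2Z.inj_mul, !Cpowz_of_nat.
    unfold Cdiv; rewrite Cpow_mult_l, Cpow_inv, Cpow_mult_r by auto; reflexivity. }
replace (q ^ (i * i)) with (Cpowz q (Z.of_nat i * Z.of_nat i))
  by (rewrite <- Nat2Z.inj_mul, Cpowz_of_nat; reflexivity).
replace (Cpowz (- (1)) (Z.of_nat i - Z.of_nat m))
  with (Cpowz (- (1)) (Z.of_nat m) / Cpowz (- (1)) (Z.of_nat b)).
2:{ rewrite <- Cpowz_sub by apply Cneg1_neq_0.
    replace (Z.of_nat i - Z.of_nat m)%Z with (Z.of_nat m - Z.of_nat b
      + 2 * 0)%Z by lia.
    rewrite Cpowz_add, Cpowz_neg1_even by apply Cneg1_neq_0; ring. }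
replace (Cpowz z (3 * (Z.of_nat i - Z.of_nat m)))
  with (Cpowz z (Z.of_nat m) * Cpowz z (Z.of_nat i) / Cpowz z (2 * Z.of_nat b)).
2:{ rewrite <- Cpowz_add, <- Cpowz_sub by exact Hz; f_equal; lia. }
(* With k = i - m and b = m - k, the exponent -m(m+1)/2 + b(b+1)/2 - mi + i^2 is k(3k - 1)/2. *)
replace (Cpowz q (pent (Z.of_nat i - Z.of_nat m)))
  with (Cpowz q (- Z.of_nat (triang (S m))) / Cpowz q (- Z.of_nat (triang (S b)))
    * Cpowz q (- (Z.of_nat m * Z.of_nat i)) * Cpowz q (Z.of_nat i * Z.of_nat i)).
2:{ rewrite <- Cpowz_sub, <- !Cpowz_add by exact q0; f_equal.
    assert (T1 := triang_double m); assert (T2 := triang_double b).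
    assert (T3 := pent_double (Z.of_nat i - Z.of_nat m)).
    assert (Hb : Z.of_nat b = (2 * Z.of_nat m - Z.of_nat i)%Z) by (unfold b; lia).
    rewrite Hb in T2; lia. }
assert (Pi := P0 i); assert (Pb := P0 b).
field; repeat split; auto.
Qed.

Lemma zdom_plus (a b : Z -> C) : zdom a -> zdom b -> zdom (fun k => a k + b k).
Proof.
intros [A [r [Hr HA]]] [B [s [Hs HB]]].
assert (A0 : (0 <= A)%R).
{ specialize (HA 0%Z); pose proof (Cmod_ge_0 (a 0%Z)); simpl in HA; lra. }
assert (B0 : (0 <= B)%R).
{ specialize (HB 0%Z); pose proof (Cmod_ge_0 (b 0%Z)); simpl in HB; lra. }
exists (A + B)%R, (Rmax r s); split.
- split; [apply Rle_trans with r; [lra | apply Rmax_l] | apply Rmax_lub_lt; lra].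
- intros k; eapply Rle_trans; [apply Cmod_triangle|].
  rewrite Rmult_plus_distr_r; apply Rplus_le_compat.
  + eapply Rle_trans; [apply HA|]; apply Rmult_le_compat_l; [exact A0|].
    apply pow_incr; split; [lra | apply Rmax_l].
  + eapply Rle_trans; [apply HB|]; apply Rmult_le_compat_l; [exact B0|].
    apply pow_incr; split; [lra | apply Rmax_r].
Qed.

Lemma Cmod_neg1_powz (k : Z) : Cmod (Cpowz (- (1)) k) = 1%R.
Proof.
assert (H := Cmod_Cpowz (- (1)) k Cneg1_neq_0).
rewrite Cmod_m1, Cpowz_1_l in H; now apply RtoC_inj.
Qed.

(* With r^2 = |q|, the modulus of q^(pent k) is r^(3 k^2 - k). *)
Lemma pent_zdom (z q : C) :
  (0 < Cmod q < 1)%R -> z <> 0 ->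
  zdom (fun k => Cpowz (- (1)) k * Cpowz q (pent k) * Cpowz z k).
Proof.
intros Hq Hz; assert (q0 : q <> 0) by (apply Cmod_gt_0; lra).
set (r := sqrt (Cmod q)).
assert (r0 : (0 < r)%R) by (apply sqrt_lt_R0; lra).
assert (rr : (r * r = Cmod q)%R) by (apply sqrt_sqrt; lra).
assert (r1 : (r < 1)%R) by nra.
assert (R0 : RtoC r <> 0) by (intros H; apply RtoC_inj in H; lra).
assert (Mr : Cmod (RtoC r) = r) by (rewrite Cmod_R; apply Rabs_pos_eq; lra).
assert (R3 : RtoC r ^ 3 <> 0) by now apply Cpow_nz.
apply (zdom_le _ (fun k => Cpowz (RtoC r ^ 3) (k * k) * Cpowz (z / RtoC r) k)).
2:{ apply gauss_zdom.
    - split; [now apply Cmod_gt_0 | apply Cmod_pow_lt_1; [rewrite Mr; lra | lia]].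
    - apply Cmult_neq_0; [exact Hz | now apply Cinv_neq_0]. }
intros k; right; rewrite !Cmod_mult, Cmod_neg1_powz, Rmult_1_l.
assert (Hp : Cmod (Cpowz q (pent k)) = Cmod (Cpowz (RtoC r) (3 * (k * k) - k))).
{ rewrite <- pent_double, Cpowz_mul by exact R0.
  replace (Cpowz (RtoC r) 2) with (RtoC (Cmod q))
    by (simpl; rewrite Cmult_1_r, <- RtoC_mult, rr; reflexivity).
  rewrite <- Cmod_Cpowz by exact q0.
  rewrite Cmod_R, Rabs_pos_eq; [reflexivity | apply Cmod_ge_0]. }
rewrite Hp, <- !Cmod_mult; f_equal.
rewrite Cpowz_sub, Cpowz_pow by assumption.
unfold Cdiv; rewrite Cpowz_mult_l by (auto using Cinv_neq_0).
replace (Cpowz (/ RtoC r) k) with (/ Cpowz (RtoC r) k); [simpl Z.of_nat; ring|].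
assert (K0 := Cpowz_neq_0 (RtoC r) k R0).
assert (E := Cpowz_mult_l (RtoC r) (/ RtoC r) k R0 (Cinv_neq_0 _ R0)).
rewrite Cinv_r in E by exact R0.
rewrite Cpowz_1_l in E.
transitivity (/ Cpowz (RtoC r) k * (Cpowz (RtoC r) k * Cpowz (/ RtoC r) k)).
- rewrite <- E; ring.
- field; exact K0.
Qed.

Lemma quint_base_zdom (z q : C) :
  (0 < Cmod q < 1)%R -> z <> 0 -> zdom (quint_base z q).
Proof.
intros Hq Hz; assert (q0 : q <> 0) by (apply Cmod_gt_0; lra).
assert (z3 := Cpow_nz z 3 Hz).
apply (zdom_le _ (fun k => Cpowz (- (1)) k * Cpowz q (pent k) * Cpowz (z ^ 3) k
  + z * (Cpowz (- (1)) k * Cpowz q (pent k) * Cpowz (z ^ 3 * q) k))).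
- intros k; right; f_equal; unfold quint_base.
  rewrite Cpowz_mult_l, Cpowz_pow by assumption; simpl Z.of_nat; ring.
- apply zdom_plus; [|apply zdom_scal]; apply pent_zdom; auto using Cmult_neq_0.
Qed.

Theorem quintuple_product (z q : C) :
  (0 < Cmod q < 1)%R -> z <> 0 -> (forall k, 1 - z ^ 2 * Cpowz q k <> 0) ->
  CSeriesZ (quint_base z q) =
  qpoch q q * (qpoch (z ^ 2) q * qpoch (q / z ^ 2) q) / (qpoch z q * qpoch (q / z) q).
Proof.
intros Hq Hz Hk; assert (q0 : q <> 0) by (apply Cmod_gt_0; lra).
assert (z2 := Cpow_nz z 2 Hz).
assert (F0 : forall k, 1 - q * q ^ k <> 0) by (intros; now apply qpoch_self_factor_neq_0).
assert (Y1 : forall k, 1 - z ^ 2 * q ^ k <> 0).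
{ intros k; rewrite <- (Cpowz_of_nat q k); apply Hk. }
assert (Y2 : forall k, 1 - q / z ^ 2 * q ^ k <> 0).
{ intros k H; apply (Hk (- Z.of_nat (S k))%Z); rewrite Cpowz_opp_nat, (Cpow_S q k).
  assert (Qk := Cpow_nz q k q0).
  replace (1 - z ^ 2 * / (q * q ^ k))
    with (- (z ^ 2 / (q * q ^ k)) * (1 - q / z ^ 2 * q ^ k)) by (field; auto).
  rewrite H; ring. }
assert (X1 : forall k, 1 - z * q ^ k <> 0).
{ intros k H; apply (Y1 (2 * k)%nat); rewrite Nat.mul_comm, Cpow_mult_r.
  replace (1 - z ^ 2 * (q ^ k) ^ 2) with ((1 - z * q ^ k) * (1 + z * q ^ k)) by ring.
  rewrite H; ring. }
assert (X2 : forall k, 1 - q / z * q ^ k <> 0).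
{ intros k H; apply (Y2 (2 * k + 1)%nat); rewrite Cpow_add_r, Nat.mul_comm, Cpow_mult_r.
  replace (1 - q / z ^ 2 * ((q ^ k) ^ 2 * q ^ 1))
    with ((1 - q / z * q ^ k) * (1 + q / z * q ^ k)) by (field; auto).
  rewrite H; ring. }
assert (cv : forall u, Ccv (qpoch_fin u q) (qpoch u q)) by (intros; apply qpoch_cv; lra).
assert (bd : forall u, exists M, (0 < M)%R /\ forall n, (Cmod (qpoch_fin u q n) <= M)%R)
  by (intros; apply qpoch_fin_bounded; lra).
assert (ib : forall u, (forall k, 1 - u * q ^ k <> 0) ->
  exists M, (0 < M)%R /\ forall n, (Cmod (/ qpoch_fin u q n) <= M)%R).
{ intros u Hu; apply (Ccv_bounded _ (/ qpoch u q)), Ccv_inv; auto.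
  - apply qpoch_neq_0; [lra | exact Hu].
  - intros n; now apply qpoch_fin_neq_0. }
set (lim := qpoch q q / (qpoch q q * qpoch q q)
  * (qpoch z q * qpoch (q / z) q / (qpoch (z ^ 2) q * qpoch (q / z ^ 2) q))).
assert (Qq : qpoch q q <> 0) by (apply qpoch_neq_0; [lra | exact F0]).
assert (Qz : qpoch z q <> 0) by (apply qpoch_neq_0; [lra | exact X1]).
assert (Qz' : qpoch (q / z) q <> 0) by (apply qpoch_neq_0; [lra | exact X2]).
assert (Qy : qpoch (z ^ 2) q <> 0) by (apply qpoch_neq_0; [lra | exact Y1]).
assert (Qy' : qpoch (q / z ^ 2) q <> 0) by (apply qpoch_neq_0; [lra | exact Y2]).
assert (fin0 : forall u n, (forall k, 1 - u * q ^ k <> 0) -> qpoch_fin u q n <> 0)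
  by (intros; now apply qpoch_fin_neq_0).
assert (Cc : forall k, Ccv (fun m => quint_coef z q m k) lim).
{ intros k; unfold quint_coef, lim.
  assert (S1 : forall u, Ccv (fun m => qpoch_fin u q (Z.to_nat (Z.of_nat m + k))) (qpoch u q)).
  { intros u; apply (Ccv_subseq _ _ (fun m => Z.to_nat (Z.of_nat m + k))); [|apply cv].
    intros N; exists (N + Z.to_nat (Z.abs k))%nat; intros; lia. }
  assert (S2 : forall u, Ccv (fun m => qpoch_fin u q (S (Z.to_nat (Z.of_nat m + k)))) (qpoch u q)).
  { intros u; apply (Ccv_subseq _ _ (fun m => S (Z.to_nat (Z.of_nat m + k)))); [|apply cv].
    intros N; exists (N + Z.to_nat (Z.abs k))%nat; intros; lia. }
  assert (S3 : forall u, Ccv (fun m => qpoch_fin u q (Z.to_nat (Z.of_nat m - k))) (qpoch u q)).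
  { intros u; apply (Ccv_subseq _ _ (fun m => Z.to_nat (Z.of_nat m - k))); [|apply cv].
    intros N; exists (N + Z.to_nat (Z.abs k))%nat; intros; lia. }
  apply Ccv_mult; apply Ccv_div; try (apply Ccv_mult; auto);
    try (now apply Cmult_neq_0); try (intros n; apply Cmult_neq_0; now apply fin0).
  - apply (Ccv_subseq _ _ (fun m => 2 * m)%nat); [|apply cv].
    intros N; exists N; intros; lia.
  - apply (Ccv_subseq _ _ S); [|apply cv].
    intros N; exists N; intros; lia. }
destruct (bd q) as [M1 [P1 H1]]; destruct (ib q F0) as [M2 [P2 H2]].
destruct (bd z) as [M3 [P3 H3]]; destruct (bd (q / z)) as [M4 [P4 H4]].
destruct (ib _ Y1) as [M5 [P5 H5]]; destruct (ib _ Y2) as [M6 [P6 H6]].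
set (M := (M1 * (M2 * M2) * (M3 * M4 * (M5 * M6)))%R).
assert (HM : forall m k, (Cmod (quint_coef z q m k) <= M)%R).
{ intros m k; unfold quint_coef, M, Cdiv; rewrite !Cinv_mul, !Cmod_mult.
  repeat first [apply H1 | apply H2 | apply H3 | apply H4 | apply H5 | apply H6
    | apply Rmult_le_compat | apply Rmult_le_pos | apply Cmod_ge_0]. }
assert (Dm := quint_base_zdom z q Hq Hz).
assert (T : Ccv (fun m => zsum (fun k => quint_base z q k * quint_coef z q m k) m)
  (CSeriesZ (fun k => lim * quint_base z q k))).
{ destruct Dm as [A [r [Hr HA]]].
  apply tannery_Z with (A := (A * M)%R) (r := r); [exact Hr| |].
  - intros K k _; rewrite Cmod_mult.
    replace (A * M * r ^ Z.abs_nat k)%R with (A * r ^ Z.abs_nat k * M)%R by ring.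
    apply Rmult_le_compat; auto using Cmod_ge_0.
  - intros k; rewrite Cmult_comm; apply Ccv_scal, Cc. }
(* The finite sum runs over -m <= k <= m, one term more than [zsum]; this end term disappears in the
   limit. *)
assert (L : Ccv (fun m => quint_base z q (Z.of_nat m) * quint_coef z q m (Z.of_nat m)) 0).
{ destruct (zdom_cv0 _ Dm) as [D0 _].
  apply Ccv_squeeze with (fun m => (Cmod (quint_base z q (Z.of_nat m) - 0)%C * M)%R).
  - intros m.
    replace (quint_base z q (Z.of_nat m) * quint_coef z q m (Z.of_nat m) - 0)
      with ((quint_base z q (Z.of_nat m) - 0) * quint_coef z q m (Z.of_nat m)) by ring.
    rewrite Cmod_mult; apply Rmult_le_compat_l; [apply Cmod_ge_0 | apply HM].
  - replace (Finite 0) with (Finite (0 * M)) by (f_equal; ring).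
    apply (is_lim_seq_mult' _ (fun _ => M)); [exact D0 | apply is_lim_seq_const]. }
assert (E : RtoC 1 = CSeriesZ (fun k => lim * quint_base z q k) + 0).
{ apply (Ccv_unique (fun _ => RtoC 1)); [apply Ccv_const|].
  eapply Ccv_ext; [|exact (Ccv_plus _ _ _ _ T L)]; intros m; cbv beta.
  rewrite <- lsum_window; unfold window; rewrite lsum_map, lsum_seq.
  assert (Z' : forall k, 1 - (z / q ^ m) ^ 2 * q ^ k <> 0).
  { intros k; assert (Qm := Cpow_nz q m q0).
    replace ((z / q ^ m) ^ 2 * q ^ k)
      with (z ^ 2 * Cpowz q (Z.of_nat k - Z.of_nat m - Z.of_nat m)); [apply Hk|].
    rewrite !Cpowz_sub, !Cpowz_of_nat by exact q0; field; exact Qm. }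
  rewrite <- (finite_quintuple (z / q ^ m) q (2 * m) Hq Z').
  cbn [csum]; replace (m + m)%nat with (2 * m)%nat by lia; f_equal.
  - apply csum_ext; intros i Hi; symmetry; apply quint_term_shift; auto; lia.
  - rewrite quint_term_shift by (auto; lia).
    replace (Z.of_nat (2 * m) - Z.of_nat m)%Z with (Z.of_nat m) by lia; reflexivity. }
rewrite CSeriesZ_scal, Cplus_0_r in E by exact Dm.
(* The limit identity 1 = lim * series itself excludes 0. *)
assert (lim0 : lim <> 0).
{ intros H; rewrite H in E; apply C1_nz; rewrite E; ring. }
transitivity (/ lim * (lim * CSeriesZ (quint_base z q))); [field; exact lim0|].
rewrite <- E; unfold lim; field; auto 10.
Qed.

(** * The pentagonal number theorem and the dissection modulo 5 *)

Definition pent_term (q : C) (k : Z) : C := Cpowz (- (1)) k * Cpowz q (pent k).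

Lemma pent_term_zdom (q : C) (j : Z) :
  (0 < Cmod q < 1)%R -> zdom (fun k => pent_term q k * Cpowz q (j * k)).
Proof.
intros Hq; assert (q0 : q <> 0) by (apply Cmod_gt_0; lra).
apply (zdom_le _ (fun k => Cpowz (- (1)) k * Cpowz q (pent k) * Cpowz (Cpowz q j) k)).
- intros k; right; rewrite Cpowz_mul by exact q0; reflexivity.
- apply pent_zdom; [exact Hq | now apply Cpowz_neq_0].
Qed.

Lemma CSeriesZ_plus (a b : Z -> C) :
  zdom a -> zdom b -> CSeriesZ (fun k => a k + b k) = CSeriesZ a + CSeriesZ b.
Proof.
intros Ha Hb; apply (Ccv_unique (zsum (fun k => a k + b k))).
- now apply zdom_conv, zdom_plus.
- eapply Ccv_ext; [intros K; symmetry; apply zsum_plus|].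
  now apply Ccv_plus; apply zdom_conv.
Qed.

(** The window -K <= k < K is invariant under k -> -1 - k, so the partial sums agree exactly. *)
Lemma CSeriesZ_flip (a : Z -> C) :
  zdom a -> zdom (fun k => a (- 1 - k)%Z) ->
  CSeriesZ (fun k => a (- 1 - k)%Z) = CSeriesZ a.
Proof.
intros H H'; apply (Ccv_unique (zsum a)); [|now apply zdom_conv].
eapply Ccv_ext; [|apply zdom_conv; exact H']; intros K; unfold zsum.
apply csum_ext; intros n _.
replace (- 1 - Z.of_nat n)%Z with (- Z.of_nat (S n))%Z by lia.
replace (- 1 - - Z.of_nat (S n))%Z with (Z.of_nat n) by lia; ring.
Qed.

Lemma zdom_progression (a : Z -> C) (rho : nat) :
  (rho < 5)%nat -> zdom a -> zdom (fun k => a (5 * k + Z.of_nat rho)%Z).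
Proof.
intros Hrho; apply (zdom_comp a (fun k => (5 * k + Z.of_nat rho)%Z)); intros; lia.
Qed.

Lemma CSeriesZ_split5 (a : Z -> C) :
  zdom a ->
  CSeriesZ a = csum (fun rho => CSeriesZ (fun k => a (5 * k + Z.of_nat rho)%Z)) 5.
Proof.
intros H; apply (Ccv_unique (fun K => zsum a (5 * K))).
- apply (Ccv_subseq (zsum a)); [|now apply zdom_conv].
  intros N; exists N; intros; lia.
- apply (Ccv_ext (fun K => csum (fun rho => zsum (fun k => a (5 * k + Z.of_nat rho)%Z) K) 5)).
  + intros K; induction K as [|K IH]; [unfold zsum; simpl; ring|].
    replace (5 * S K)%nat with (S (S (S (S (S (5 * K)))))) by lia.
    unfold zsum in *; cbn [csum] in *; rewrite <- IH; clear IH.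
    replace (Z.of_nat (S (5 * K))) with (5 * Z.of_nat K + 1)%Z by lia.
    replace (Z.of_nat (S (S (5 * K)))) with (5 * Z.of_nat K + 2)%Z by lia.
    replace (Z.of_nat (S (S (S (5 * K))))) with (5 * Z.of_nat K + 3)%Z by lia.
    replace (Z.of_nat (S (S (S (S (5 * K)))))) with (5 * Z.of_nat K + 4)%Z by lia.
    replace (Z.of_nat (S (S (S (S (S (5 * K))))))) with (5 * Z.of_nat K + 5)%Z by lia.
    replace (Z.of_nat (5 * K)) with (5 * Z.of_nat K + 0)%Z by lia.
    change (Z.of_nat 0) with 0%Z; change (Z.of_nat 1) with 1%Z.
    change (Z.of_nat 2) with 2%Z; change (Z.of_nat 3) with 3%Z.
    change (Z.of_nat 4) with 4%Z.
    replace (5 * - Z.of_nat (S K) + 0)%Z with (- (5 * Z.of_nat K + 5))%Z by lia.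
    replace (5 * - Z.of_nat (S K) + 1)%Z with (- (5 * Z.of_nat K + 4))%Z by lia.
    replace (5 * - Z.of_nat (S K) + 2)%Z with (- (5 * Z.of_nat K + 3))%Z by lia.
    replace (5 * - Z.of_nat (S K) + 3)%Z with (- (5 * Z.of_nat K + 2))%Z by lia.
    replace (5 * - Z.of_nat (S K) + 4)%Z with (- (5 * Z.of_nat K + 1))%Z by lia.
    ring.
  + apply (Ccv_csum (fun K rho => zsum (fun k => a (5 * k + Z.of_nat rho)%Z) K)).
    intros rho Hrho; apply zdom_conv; now apply zdom_progression.
Qed.

(** The quintuple product at a primitive cube root of unity: w^(3k) = 1 turns the series into
    pentagonal ones, and 1/w = w^2 cancels all factors of the quotient but (1 - w^2)/(1 - w) = 1 +
    w. *)
Lemma pentagonal_aux (q w : C) :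
  (0 < Cmod q < 1)%R -> w ^ 2 + w + 1 = 0 ->
  CSeriesZ (fun k => pent_term q k * Cpowz q (0 * k))
  + w * CSeriesZ (fun k => pent_term q k * Cpowz q (1 * k)) = (1 + w) * qpoch q q.
Proof.
intros Hq Hw; assert (q0 : q <> 0) by (apply Cmod_gt_0; lra).
assert (w3 : w ^ 3 = 1).
{ transitivity ((w ^ 2 + w + 1) * (w - 1) + 1); [ring | rewrite Hw; ring]. }
assert (w0 : w <> 0).
{ intros H; apply C1_nz; rewrite <- w3, H; ring. }
assert (w1 : 1 - w <> 0).
{ intros H; assert (E : w = 1) by (replace w with (1 - (1 - w)) by ring; rewrite H; ring).
  rewrite E in Hw; apply (f_equal fst) in Hw; simpl in Hw; lra. }
assert (Hk : forall k, 1 - w ^ 2 * Cpowz q k <> 0).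
{ intros k H.
  assert (E : w ^ 2 * Cpowz q k = 1).
  { replace (w ^ 2 * Cpowz q k) with (1 - (1 - w ^ 2 * Cpowz q k)) by ring.
    rewrite H; ring. }
  assert (E3 : Cpowz q (k * 3) = 1).
  { rewrite Cpowz_mul by exact q0.
    transitivity ((w ^ 3) ^ 2 * Cpowz q k ^ 3); [rewrite w3; simpl; ring|].
    transitivity ((w ^ 2 * Cpowz q k) ^ 3); [ring | rewrite E; ring]. }
  apply (Cpowz_inj_1 q _ Hq) in E3; assert (k = 0)%Z by lia; subst k.
  simpl in E; apply w1.
  transitivity (1 - (w ^ 3) * w); [rewrite w3; ring|].
  transitivity (1 - (w * (w * 1) * 1) * (w * (w * 1) * 1)); [ring | rewrite E; ring]. }
assert (Z0 := pent_term_zdom q 0 Hq); assert (Z1 := pent_term_zdom q 1 Hq).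
rewrite <- CSeriesZ_scal, <- CSeriesZ_plus by auto using zdom_scal.
transitivity (CSeriesZ (quint_base w q)).
- apply CSeriesZ_ext; [|apply zdom_plus; auto using zdom_scal].
  intros k; unfold quint_base, pent_term.
  rewrite (Cpowz_mul w) by exact w0.
  replace (Cpowz w 3) with (RtoC 1) by (rewrite <- w3; reflexivity).
  rewrite Cpowz_1_l, Z.mul_0_l, Z.mul_1_l; simpl Cpowz at 3; ring.
- rewrite quintuple_product by assumption.
  rewrite (qpoch_shift w q 1), (qpoch_shift (w ^ 2) q 1) by lra.
  assert (wi : / w = w ^ 2).
  { transitivity (w ^ 3 / w); [rewrite w3; field; exact w0 | field; exact w0]. }
  replace (q / w ^ 2) with (w * q ^ 1) by (rewrite <- wi; simpl; field; exact w0).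
  replace (q / w) with (w ^ 2 * q ^ 1) by (unfold Cdiv; rewrite wi; simpl; ring).
  assert (N1 : qpoch (w * q ^ 1) q <> 0).
  { apply qpoch_neq_0; [lra|]; intros k H; apply (Hk (- Z.of_nat (S k))%Z).
    rewrite Cpowz_opp_nat, (Cpow_S q k), <- wi; assert (Qk := Cpow_nz q k q0).
    replace (1 - / w * / (q * q ^ k)) with (- / (w * (q * q ^ k))
      * (1 - w * q ^ 1 * q ^ k)) by (rewrite Cpow_1_r; field; auto).
    rewrite H; ring. }
  assert (N2 : qpoch (w ^ 2 * q ^ 1) q <> 0).
  { apply qpoch_neq_0; [lra|]; intros k.
    rewrite <- Cmult_assoc, <- Cpow_add_r, <- (Cpowz_of_nat q); apply Hk. }
  cbn [qpoch_fin]; change (q ^ 0) with (RtoC 1).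
  field; repeat split; auto; intros H; apply w1; rewrite <- H; ring.
Qed.

(** The two primitive cube roots of unity give two linear equations for the two series. *)
Theorem pentagonal_number (q : C) :
  (0 < Cmod q < 1)%R ->
  CSeriesZ (fun k => pent_term q k * Cpowz q (0 * k)) = qpoch q q /\
  CSeriesZ (fun k => pent_term q k * Cpowz q (1 * k)) = qpoch q q.
Proof.
intros Hq.
set (w := (- (1 / 2), sqrt 3 / 2)%R : C).
assert (Hw : w ^ 2 + w + 1 = 0).
{ assert (S3 : (sqrt 3 * sqrt 3 = 3)%R) by (apply sqrt_sqrt; lra).
  apply injective_projections; simpl; [|field]; nra. }
assert (Hw' : (w ^ 2) ^ 2 + w ^ 2 + 1 = 0).
{ transitivity ((w ^ 2 + w + 1) * (w ^ 2 - w + 1)); [ring | rewrite Hw; ring]. }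
assert (E1 := pentagonal_aux q w Hq Hw); assert (E2 := pentagonal_aux q _ Hq Hw').
set (A := CSeriesZ (fun k => pent_term q k * Cpowz q (0 * k))) in *.
set (B := CSeriesZ (fun k => pent_term q k * Cpowz q (1 * k))) in *.
set (P := qpoch q q) in *.
assert (D : w - w ^ 2 <> 0).
{ assert (S0 : (0 < sqrt 3)%R) by (apply sqrt_lt_R0; lra).
  intros H; apply (f_equal snd) in H; simpl in H; lra. }
assert (EB : B = P).
{ transitivity (((A + w * B) - (A + w ^ 2 * B)) / (w - w ^ 2)); [field; exact D|].
  rewrite E1, E2; field; exact D. }
split; [|exact EB].
rewrite EB in E1; transitivity (A + w * P - w * P); [ring | rewrite E1; ring].
Qed.

(** The G of the overview: q^(1/5) divided by the Rogers-Ramanujan continued fraction. *)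
Definition RR_ratio (q : C) : C :=
  qpoch (q ^ 2) (q ^ 5) * qpoch (q ^ 3) (q ^ 5)
  / (qpoch q (q ^ 5) * qpoch (q ^ 4) (q ^ 5)).

Lemma qpoch_pow_neq_0 (q : C) (m n : nat) :
  (0 < Cmod q < 1)%R -> (0 < m)%nat -> (0 < n)%nat -> qpoch (q ^ m) (q ^ n) <> 0.
Proof.
intros Hq Hm Hn; apply qpoch_neq_0; [apply Cmod_pow_lt_1; [lra | exact Hn]|].
intros k; rewrite <- Cpow_mult_r, <- Cpow_add_r, <- Cpowz_of_nat.
apply one_minus_Cpowz_neq_0; [exact Hq | lia].
Qed.

(** Up to the factor (q^5;q^5)_oo, the case m = 1 is [RR_ratio q] and the case m = 2 its
    reciprocal. *)
Lemma quint_base_pow (q : C) (m : nat) :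
  (0 < Cmod q < 1)%R -> (m = 1 \/ m = 2)%nat ->
  CSeriesZ (quint_base (q ^ m) (q ^ 5)) =
  qpoch (q ^ 5) (q ^ 5) * (qpoch (q ^ (2 * m)) (q ^ 5) * qpoch (q ^ (5 - 2 * m)) (q ^ 5))
  / (qpoch (q ^ m) (q ^ 5) * qpoch (q ^ (5 - m)) (q ^ 5)).
Proof.
intros Hq Hm; assert (q0 : q <> 0) by (apply Cmod_gt_0; lra).
assert (Qn : forall n, q ^ n <> 0) by (intros; now apply Cpow_nz).
rewrite quintuple_product.
- rewrite <- Cpow_mult_r.
  replace (q ^ 5 / q ^ (m * 2)) with (q ^ (5 - 2 * m)).
  + replace (q ^ 5 / q ^ m) with (q ^ (5 - m)).
    * rewrite (Nat.mul_comm m 2); reflexivity.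
    * destruct Hm as [-> | ->]; simpl; field; auto.
  + destruct Hm as [-> | ->]; simpl; field; auto.
- split; [now apply Cmod_gt_0 | apply Cmod_pow_lt_1; [lra | lia]].
- apply Qn.
- intros k; rewrite <- Cpow_mult_r, <- Cpowz_of_nat, Cpowz_pow, <- Cpowz_add by exact q0.
  apply one_minus_Cpowz_neq_0; [exact Hq | lia].
Qed.

Lemma pent_term_eq (q : C) (k j e : Z) :
  q <> 0 -> (pent k = e)%Z -> (exists i, k = 2 * i + j)%Z ->
  pent_term q k = Cpowz (- (1)) j * Cpowz q e.
Proof.
intros Hq <- [i E]; unfold pent_term; rewrite E at 1.
rewrite Cpowz_add, Cpowz_neg1_even by apply Cneg1_neq_0; ring.
Qed.

Lemma quint_base_pow_term (q : C) (m : nat) (k : Z) :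
  q <> 0 ->
  quint_base (q ^ m) (q ^ 5) k =
  Cpowz (- (1)) k * Cpowz q (5 * pent k + 3 * Z.of_nat m * k)
  + Cpowz (- (1)) k * Cpowz q (5 * pent k + 3 * Z.of_nat m * k + Z.of_nat m + 5 * k).
Proof.
intros Hq; unfold quint_base; rewrite !Cpowz_pow, <- Cpowz_of_nat by exact Hq.
change (Z.of_nat 5) with 5%Z.
replace (Z.of_nat m * (3 * k))%Z with (3 * Z.of_nat m * k)%Z by lia.
rewrite !Cpowz_add by exact Hq; ring.
Qed.

(** The pentagonal numbers k(3k - 1)/2 are 0, 1, 0, 2, 2 modulo 5 for k = 0, ..., 4. The classes 0
    and 2 of k pair up to one quintuple series, 3 and 4 to another, and class 1 reproduces the
    pentagonal series in q^25. *)
Theorem euler_dissection (q : C) :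
  (0 < Cmod q < 1)%R ->
  qpoch q q = qpoch ((q ^ 5) ^ 5) ((q ^ 5) ^ 5)
              * (RR_ratio (q ^ 5) - q - q ^ 2 / RR_ratio (q ^ 5)).
Proof.
intros Hq; assert (q0 : q <> 0) by (apply Cmod_gt_0; lra).
assert (Q0 : q ^ 5 <> 0) by now apply Cpow_nz.
assert (HQ : (0 < Cmod (q ^ 5) < 1)%R).
{ split; [now apply Cmod_gt_0 | apply Cmod_pow_lt_1; [lra | lia]]. }
assert (HQ5 : (0 < Cmod ((q ^ 5) ^ 5) < 1)%R).
{ split; [now apply Cmod_gt_0, Cpow_nz | apply Cmod_pow_lt_1; [lra | lia]]. }
assert (Z0 := pent_term_zdom q 0 Hq).
assert (Zt : zdom (pent_term q)).
{ eapply zdom_le; [|exact Z0]; intros k; right; f_equal; rewrite Z.mul_0_l.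
  change (Cpowz q 0) with (RtoC 1); ring. }
set (Q := q ^ 5) in *.
assert (Pn : forall n, (0 < n)%nat -> qpoch (Q ^ n) (Q ^ 5) <> 0)
  by (intros; apply qpoch_pow_neq_0; auto; lia).
transitivity (CSeriesZ (pent_term q)).
{ rewrite <- (proj1 (pentagonal_number q Hq)); apply CSeriesZ_ext; [|exact Z0].
  intros k; rewrite Z.mul_0_l.
  change (Cpowz q 0) with (RtoC 1); ring. }
rewrite CSeriesZ_split5 by exact Zt; cbn [csum].
change (Z.of_nat 0) with 0%Z; change (Z.of_nat 1) with 1%Z.
change (Z.of_nat 2) with 2%Z; change (Z.of_nat 3) with 3%Z; change (Z.of_nat 4) with 4%Z.
assert (Zp : forall rho, (rho < 5)%nat ->
  zdom (fun k => pent_term q (5 * k + Z.of_nat rho)%Z))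
  by (intros; now apply zdom_progression).
assert (ZP0 := Zp 0%nat ltac:(lia)); assert (ZP1 := Zp 1%nat ltac:(lia)).
assert (ZP2 := Zp 2%nat ltac:(lia)); assert (ZP3 := Zp 3%nat ltac:(lia)).
assert (ZP4 := Zp 4%nat ltac:(lia)); simpl Z.of_nat in ZP0, ZP1, ZP2, ZP3, ZP4.
assert (Zo : forall a, zdom a -> zdom (fun k => a (- k)%Z)).
{ intros a; apply (zdom_comp a Z.opp); intros; lia. }
(* After k -> -k in class 0, the two progressions are the two halves of 1 + z Q^(5k) in [quint_base]
   at z = Q. *)
assert (S02 : CSeriesZ (fun k => pent_term q (5 * k + 0)) + CSeriesZ (fun k => pent_term q (5 * k + 2))
  = qpoch (Q ^ 5) (Q ^ 5) * RR_ratio Q).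
{ rewrite <- (CSeriesZ_opp _ ZP0), <- CSeriesZ_plus by (auto; apply (Zo _ ZP0)).
  transitivity (CSeriesZ (quint_base (Q ^ 1) (Q ^ 5))).
  - apply CSeriesZ_ext; [|apply zdom_plus; [apply (Zo _ ZP0) | exact ZP2]].
    intros k; rewrite quint_base_pow_term by exact Q0; unfold Q.
    rewrite !Cpowz_pow by exact q0; change (Z.of_nat 5) with 5%Z; change (Z.of_nat 1) with 1%Z.
    assert (P1 := pent_double k); assert (P2 := pent_double (5 * - k + 0)).
    assert (P3 := pent_double (5 * k + 2)).
    f_equal; apply pent_term_eq; auto; try lia.
    + exists (- (3 * k))%Z; lia.
    + exists (2 * k + 1)%Z; lia.
  - rewrite (quint_base_pow Q 1) by (auto; lia); unfold RR_ratio.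
    change (2 * 1)%nat with 2%nat; change (5 - 2)%nat with 3%nat.
    change (5 - 1)%nat with 4%nat; rewrite Cpow_1_r.
    assert (P := Pn 1%nat ltac:(lia)); rewrite Cpow_1_r in P.
    assert (P' := Pn 4%nat ltac:(lia)); field; auto. }
(* The same at z = Q^2, after k -> -1 - k in class 4. *)
assert (S34 : CSeriesZ (fun k => pent_term q (5 * k + 3)) + CSeriesZ (fun k => pent_term q (5 * k + 4))
  = - (q ^ 2 * (qpoch (Q ^ 5) (Q ^ 5) / RR_ratio Q))).
{ assert (ZF : zdom (fun k => pent_term q (5 * (- 1 - k) + 4))).
  { apply (zdom_comp (pent_term q) (fun k => (5 * (- 1 - k) + 4)%Z)); [intros; lia|].
    exact Zt. }
  rewrite <- (CSeriesZ_flip _ ZP4 ZF), <- CSeriesZ_plus by auto.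
  transitivity (CSeriesZ (fun k => - q ^ 2 * quint_base (Q ^ 2) (Q ^ 5) k)).
  - apply CSeriesZ_ext; [|now apply zdom_plus].
    intros k; rewrite quint_base_pow_term by exact Q0; unfold Q.
    rewrite !Cpowz_pow by exact q0; change (Z.of_nat 5) with 5%Z; change (Z.of_nat 2) with 2%Z.
    assert (P1 := pent_double k); assert (P2 := pent_double (5 * k + 3)).
    assert (P3 := pent_double (5 * (-1 - k) + 4)).
    rewrite (pent_term_eq q (5 * k + 3) (k + 1)
      (2 + 5 * (5 * pent k + 3 * 2 * k + 2 + 5 * k))) by
      (first [exact q0 | lia | exists (2 * k + 1)%Z; lia]).
    rewrite (pent_term_eq q (5 * (-1 - k) + 4) (k + 1)
      (2 + 5 * (5 * pent k + 3 * 2 * k))) by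
      (first [exact q0 | lia | exists (- (3 * k) - 1)%Z; lia]).
    rewrite Cpowz_succ by apply Cneg1_neq_0.
    rewrite !(Cpowz_add q 2) by exact q0.
    change (Cpowz q 2) with (q ^ 2); ring.
  - rewrite CSeriesZ_scal by (apply quint_base_zdom; [exact HQ5 | now apply Cpow_nz]).
    rewrite (quint_base_pow Q 2) by (auto; lia); unfold RR_ratio.
    change (2 * 2)%nat with 4%nat; change (5 - 4)%nat with 1%nat.
    change (5 - 2)%nat with 3%nat; rewrite Cpow_1_r.
    assert (P := Pn 1%nat ltac:(lia)); rewrite Cpow_1_r in P.
    assert (P' := Pn 4%nat ltac:(lia)); assert (P2 := Pn 2%nat ltac:(lia)).
    assert (P3 := Pn 3%nat ltac:(lia)); field; auto 10. }
assert (S1 : CSeriesZ (fun k => pent_term q (5 * k + 1)) = - q * qpoch (Q ^ 5) (Q ^ 5)).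
{ rewrite <- (proj2 (pentagonal_number (Q ^ 5) HQ5)), <- CSeriesZ_scal
    by now apply pent_term_zdom.
  apply CSeriesZ_ext; [|exact ZP1]; intros k.
  assert (P1 := pent_double k); assert (P2 := pent_double (5 * k + 1)).
  rewrite (pent_term_eq q (5 * k + 1) (k + 1) (1 + 25 * (pent k + 1 * k))) by
    (first [exact q0 | lia | exists (2 * k)%Z; lia]).
  unfold pent_term, Q; rewrite !Cpowz_pow by (auto using Cpow_nz).
  rewrite !Z.mul_assoc; change (Z.of_nat 5) with 5%Z.
  rewrite Cpowz_succ by apply Cneg1_neq_0.
  replace (1 + 25 * (pent k + 1 * k))%Z with (1 + (5 * 5 * pent k + 5 * 5 * 1 * k))%Z by lia.
  rewrite !Cpowz_add by exact q0.
  change (Cpowz q 1) with (q ^ 1); rewrite Cpow_1_r; ring. }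
match goal with
| |- @eq _ (Cplus (Cplus (Cplus (Cplus (Cplus _ ?a) ?b) ?c) ?d) ?e) _ =>
  transitivity ((a + c) + b + (d + e)); [ring|] end.
rewrite S02, S1, S34; unfold Cdiv; ring.
Qed.

(** * Relations between the sums in base Q^15 *)

Lemma theta_refl (q : C) (N n : Z) : theta q N (N - n) = theta q N n.
Proof.
unfold theta; replace (N - (N - n))%Z with n by lia; apply Cmult_comm.
Qed.

Lemma theta_opp (q : C) (N n : Z) :
  (0 < Cmod q < 1)%R -> (0 < N)%Z -> theta q N (- n) = - Cpowz q (- n) * theta q N n.
Proof.
intros Hq HN; assert (q0 : q <> 0) by (apply Cmod_gt_0; lra).
assert (Hp := Cmod_Cpowz_lt_1 q N Hq HN).
unfold theta; rewrite (qpoch_shift (Cpowz q (- n)) _ 1), (qpoch_shift (Cpowz q n) _ 1) by lra.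
cbn [qpoch_fin]; rewrite Cpow_1_r, <- !Cpowz_add by exact q0.
replace (- n + N)%Z with (N - n)%Z by lia; replace (N - - n)%Z with (n + N)%Z by lia.
change (Cpowz q N ^ 0) with (RtoC 1); rewrite !Cpowz_opp by exact q0.
field; now apply Cpowz_neq_0.
Qed.

Lemma theta_self (q : C) (N : Z) :
  (0 < Cmod q < 1)%R -> (0 < N)%Z -> theta q N N = 0.
Proof.
intros Hq HN; unfold theta; rewrite Z.sub_diag.
rewrite (qpoch_shift (Cpowz q 0) _ 1) by (apply Cmod_Cpowz_lt_1; auto).
simpl; ring.
Qed.

Lemma theta'_0 (q : C) (N : Z) : theta' q N 0 = qpoch (Cpowz q N) (Cpowz q N) ^ 2.
Proof. reflexivity. Qed.

Lemma theta'_neq (q : C) (N n : Z) : n <> 0%Z -> theta' q N n = theta q N n.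
Proof. intros H; unfold theta'; destruct (Z.eq_dec n 0); [contradiction | reflexivity]. Qed.

(* The substitution n -> -1 - n. *)
Lemma SigmaZ_flip (q : C) (a b c : Z) :
  (0 < Cmod q < 1)%R -> (0 < c)%Z -> (a mod c <> 0)%Z ->
  SigmaZ q a b c = - Cpowz q (c - a - b) * SigmaZ q (c - a) (c - b) c.
Proof.
intros Hq Hc Ha; assert (q0 : q <> 0) by (apply Cmod_gt_0; lra).
assert (Hp := Cmod_Cpowz_lt_1 q c Hq Hc).
unfold SigmaZ, Sigma.
assert (Za : zdom (fun n => Cpowz (Cpowz q c) (2 * n * (n + 1)) * Cpowz (Cpowz q b) n
  / (1 - Cpowz q a * Cpowz (Cpowz q c) n))).
{ apply Sigma_zdom; try apply Cpowz_neq_0; auto.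
  intros k; now apply progression_neq_0. }
assert (Zb : zdom (fun n => Cpowz (Cpowz q c) (2 * n * (n + 1)) * Cpowz (Cpowz q (c - b)) n
  / (1 - Cpowz q (c - a) * Cpowz (Cpowz q c) n))).
{ apply Sigma_zdom; try apply Cpowz_neq_0; auto.
  intros k; apply progression_neq_0; [exact Hq | now apply mod_opp_neq_0]. }
assert (E : forall n, Cpowz (Cpowz q c) (2 * (- 1 - n) * (- 1 - n + 1))
    * Cpowz (Cpowz q b) (- 1 - n) / (1 - Cpowz q a * Cpowz (Cpowz q c) (- 1 - n))
  = - Cpowz q (c - a - b) * (Cpowz (Cpowz q c) (2 * n * (n + 1))
    * Cpowz (Cpowz q (c - b)) n / (1 - Cpowz q (c - a) * Cpowz (Cpowz q c) n))).
{ intros n; assert (N1 := progression_neq_0 q c a (- 1 - n) Hq Ha).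
  assert (N2 := progression_neq_0 q c (c - a) n Hq (mod_opp_neq_0 _ _ Ha)).
  rewrite <- !Cpowz_mul in * by exact q0.
  rewrite <- !Cpowz_add in * by exact q0.
  replace (c * (2 * (-1 - n) * (-1 - n + 1)))%Z with (c * (2 * n * (n + 1)))%Z by ring.
  set (x := (c - a + c * n)%Z) in *.
  replace (a + c * (-1 - n))%Z with (- x)%Z in * by (unfold x; lia).
  rewrite Cpowz_opp in * by exact q0.
  assert (X0 := Cpowz_neq_0 q x q0).
  replace (c * (2 * n * (n + 1)) + b * (-1 - n))%Z
    with (c * (2 * n * (n + 1)) + (c - b) * n + (c - a - b) - x)%Z by (unfold x; ring).
  rewrite Cpowz_sub, (Cpowz_add q _ (c - a - b)) by exact q0.
  assert (N3 : Cpowz q x - 1 <> 0).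
  { intros H; apply N2; replace (1 - Cpowz q x) with (- (Cpowz q x - 1)) by ring.
    rewrite H; ring. }
  field; auto. }
set (f := fun n => Cpowz (Cpowz q c) (2 * n * (n + 1)) * Cpowz (Cpowz q b) n
  / (1 - Cpowz q a * Cpowz (Cpowz q c) n)) in *.
set (g := fun n => Cpowz (Cpowz q c) (2 * n * (n + 1)) * Cpowz (Cpowz q (c - b)) n
  / (1 - Cpowz q (c - a) * Cpowz (Cpowz q c) n)) in *.
assert (E' : forall n, f (- 1 - n)%Z = - Cpowz q (c - a - b) * g n) by exact E.
assert (Zf : zdom (fun n => f (- 1 - n)%Z)).
{ apply (zdom_le _ (fun n => - Cpowz q (c - a - b) * g n)).
  - intros n; rewrite E'; right; reflexivity.
  - now apply zdom_scal. }
rewrite <- CSeriesZ_scal, <- (CSeriesZ_flip _ Za Zf) by exact Zb.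
now apply CSeriesZ_ext.
Qed.

Lemma theta_15 (q : C) (n : Z) :
  theta q 15 n = qpoch (Cpowz q n) (q ^ 15) * qpoch (Cpowz q (15 - n)) (q ^ 15).
Proof. reflexivity. Qed.

Lemma RR_ratio_theta (q : C) :
  (0 < Cmod q < 1)%R ->
  RR_ratio q = theta q 15 2 * theta q 15 3 * theta q 15 7
               / (theta q 15 1 * theta q 15 4 * theta q 15 6).
Proof.
intros Hq; assert (q0 : q <> 0) by (apply Cmod_gt_0; lra).
assert (E : forall m, qpoch (q ^ m) (q ^ 5) = qpoch (q ^ m) (q ^ 15)
  * qpoch (q ^ (m + 5)) (q ^ 15) * qpoch (q ^ (m + 10)) (q ^ 15)).
{ intros m; rewrite (qpoch_dissect (q ^ m) (q ^ 5) 3) by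
    (try apply Cmod_pow_lt_1; try lra; lia).
  cbn [cprod]; rewrite <- !Cpow_mult_r, <- !Cpow_add_r.
  change (5 * 3)%nat with 15%nat; change (5 * 0)%nat with 0%nat.
  change (5 * 1)%nat with 5%nat; change (5 * 2)%nat with 10%nat.
  rewrite Nat.add_0_r; ring. }
assert (Hp : forall m, (0 < m)%nat -> qpoch (q ^ m) (q ^ 15) <> 0).
{ intros; apply qpoch_pow_neq_0; auto; lia. }
unfold RR_ratio.
replace (qpoch q (q ^ 5)) with (qpoch (q ^ 1) (q ^ 5)) by (rewrite Cpow_1_r; reflexivity).
rewrite !E, !theta_15.
cbn [Nat.add].
change (Cpowz q 1) with (q ^ 1); change (Cpowz q (15 - 1)) with (q ^ 14).
change (Cpowz q 2) with (q ^ 2); change (Cpowz q (15 - 2)) with (q ^ 13).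
change (Cpowz q 3) with (q ^ 3); change (Cpowz q (15 - 3)) with (q ^ 12).
change (Cpowz q 4) with (q ^ 4); change (Cpowz q (15 - 4)) with (q ^ 11).
change (Cpowz q 6) with (q ^ 6); change (Cpowz q (15 - 6)) with (q ^ 9).
change (Cpowz q 7) with (q ^ 7); change (Cpowz q (15 - 7)) with (q ^ 8).
assert (H1 := Hp 1%nat ltac:(lia)); assert (H4 := Hp 4%nat ltac:(lia)).
assert (H6 := Hp 6%nat ltac:(lia)); assert (H9 := Hp 9%nat ltac:(lia)).
assert (H11 := Hp 11%nat ltac:(lia)); assert (H14 := Hp 14%nat ltac:(lia)).
field; auto 10.
Qed.

Lemma eta_quotient_theta (q : C) :
  (0 < Cmod q < 1)%R ->
  qpoch (q ^ 3) (q ^ 3) ^ 3 / qpoch q q =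
  theta q 15 3 ^ 2 * theta q 15 6 ^ 2 * qpoch (Cpowz q 15) (Cpowz q 15) ^ 2
  / (theta q 15 1 * theta q 15 2 * theta q 15 4 * theta q 15 5 * theta q 15 7).
Proof.
intros Hq; assert (q0 : q <> 0) by (apply Cmod_gt_0; lra).
assert (Hp : forall m, (0 < m)%nat -> qpoch (q ^ m) (q ^ 15) <> 0).
{ intros; apply qpoch_pow_neq_0; auto; lia. }
assert (E3 : qpoch (q ^ 3) (q ^ 3) = qpoch (q ^ 3) (q ^ 15) * qpoch (q ^ 6) (q ^ 15)
  * qpoch (q ^ 9) (q ^ 15) * qpoch (q ^ 12) (q ^ 15) * qpoch (q ^ 15) (q ^ 15)).
{ rewrite (qpoch_dissect (q ^ 3) (q ^ 3) 5) by (try apply Cmod_pow_lt_1; try lra; lia).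
  cbn [cprod]; rewrite <- !Cpow_mult_r, <- !Cpow_add_r; cbn [Nat.mul Nat.add]; ring. }
assert (E1 : qpoch q q = qpoch (q ^ 1) (q ^ 15) * qpoch (q ^ 2) (q ^ 15)
  * qpoch (q ^ 3) (q ^ 15) * qpoch (q ^ 4) (q ^ 15) * qpoch (q ^ 5) (q ^ 15)
  * qpoch (q ^ 6) (q ^ 15) * qpoch (q ^ 7) (q ^ 15) * qpoch (q ^ 8) (q ^ 15)
  * qpoch (q ^ 9) (q ^ 15) * qpoch (q ^ 10) (q ^ 15) * qpoch (q ^ 11) (q ^ 15)
  * qpoch (q ^ 12) (q ^ 15) * qpoch (q ^ 13) (q ^ 15) * qpoch (q ^ 14) (q ^ 15)
  * qpoch (q ^ 15) (q ^ 15)).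
{ rewrite (qpoch_dissect q q 15) by (try lra; lia).
  cbn [cprod]; rewrite <- !Cpow_S; ring. }
rewrite E1, E3, !theta_15.
change (Cpowz q 1) with (q ^ 1); change (Cpowz q (15 - 1)) with (q ^ 14).
change (Cpowz q 2) with (q ^ 2); change (Cpowz q (15 - 2)) with (q ^ 13).
change (Cpowz q 3) with (q ^ 3); change (Cpowz q (15 - 3)) with (q ^ 12).
change (Cpowz q 4) with (q ^ 4); change (Cpowz q (15 - 4)) with (q ^ 11).
change (Cpowz q 5) with (q ^ 5); change (Cpowz q (15 - 5)) with (q ^ 10).
change (Cpowz q 6) with (q ^ 6); change (Cpowz q (15 - 6)) with (q ^ 9).
change (Cpowz q 7) with (q ^ 7); change (Cpowz q (15 - 7)) with (q ^ 8).
change (Cpowz q 15) with (q ^ 15).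
pose proof (Hp 1%nat ltac:(lia)); pose proof (Hp 2%nat ltac:(lia)).
pose proof (Hp 3%nat ltac:(lia)); pose proof (Hp 4%nat ltac:(lia)).
pose proof (Hp 5%nat ltac:(lia)); pose proof (Hp 6%nat ltac:(lia)).
pose proof (Hp 7%nat ltac:(lia)); pose proof (Hp 8%nat ltac:(lia)).
pose proof (Hp 9%nat ltac:(lia)); pose proof (Hp 10%nat ltac:(lia)).
pose proof (Hp 11%nat ltac:(lia)); pose proof (Hp 12%nat ltac:(lia)).
pose proof (Hp 13%nat ltac:(lia)); pose proof (Hp 14%nat ltac:(lia)).
pose proof (Hp 15%nat ltac:(lia)).
generalize dependent (qpoch (q ^ 1) (q ^ 15)); generalize dependent (qpoch (q ^ 2) (q ^ 15)).
generalize dependent (qpoch (q ^ 3) (q ^ 15)); generalize dependent (qpoch (q ^ 4) (q ^ 15)).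
generalize dependent (qpoch (q ^ 5) (q ^ 15)); generalize dependent (qpoch (q ^ 6) (q ^ 15)).
generalize dependent (qpoch (q ^ 7) (q ^ 15)); generalize dependent (qpoch (q ^ 8) (q ^ 15)).
generalize dependent (qpoch (q ^ 9) (q ^ 15)); generalize dependent (qpoch (q ^ 10) (q ^ 15)).
generalize dependent (qpoch (q ^ 11) (q ^ 15)); generalize dependent (qpoch (q ^ 12) (q ^ 15)).
generalize dependent (qpoch (q ^ 13) (q ^ 15)); generalize dependent (qpoch (q ^ 14) (q ^ 15)).
generalize dependent (qpoch (q ^ 15) (q ^ 15)).
intros; field; repeat split; assumption.
Qed.

(** The second parameter fits both sides of the argument: it is the linear exponent of the Lambert
    terms split modulo 15, and the one at pole a in the partial fractions when the exponents in As
    minus those in Bs total 3i - 30. *)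
Definition Sig15 (q : C) (i a : Z) : C := SigmaZ q a (4 * a + 3 * i - 30) 15.

Lemma Sig15_flip (q : C) (i a : Z) :
  (0 < Cmod q < 1)%R -> (a mod 15 <> 0)%Z ->
  Sig15 q i a = - Cpowz q (45 - 5 * a - 3 * i) * Sig15 q (5 - i) (15 - a).
Proof.
intros Hq Ha; unfold Sig15; rewrite SigmaZ_flip by (auto; lia).
f_equal; [do 2 f_equal; lia | f_equal; lia].
Qed.

Lemma theta_15_neq_0 (q : C) (n : Z) :
  (0 < Cmod q < 1)%R -> (0 < n < 15)%Z -> theta q 15 n <> 0.
Proof.
intros Hq Hn; apply theta_neq_0; [exact Hq | lia|].
rewrite Z.mod_small; lia.
Qed.

Lemma Sig15_theta_identity (q : C) (j : Z) (As Bs : list Z) :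
  (0 < Cmod q < 1)%R -> length Bs = (length As + 4)%nat ->
  NoDup (map (fun b => b mod 15)%Z Bs) -> (forall b, In b Bs -> (b mod 15 <> 0)%Z) ->
  (zlist_sum As - zlist_sum Bs = 3 * j - 30)%Z ->
  lprod (theta q 15) As / lprod (theta q 15) Bs =
  lsum (fun b => lprod (fun a => theta q 15 (a - b)) As
    / lprod (fun b' => theta' q 15 (b' - b)) Bs * Sig15 q j b) Bs.
Proof.
intros Hq L ND B0 HS; rewrite theta_quotient_partial_fractions by (auto; lia).
apply lsum_ext; intros b _; f_equal; unfold Sig15, SigmaZ; f_equal; f_equal; lia.
Qed.

Ltac eval_exponents H :=
  cbn [lprod lsum] in H;
  repeat match type of H with
  | context [Z.sub (Zpos ?a) (Zpos ?b)] =>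
      let c := eval compute in (Z.sub (Zpos a) (Zpos b)) in
      change (Z.sub (Zpos a) (Zpos b)) with c in H
  end.

(** All thetas are brought to exponents 1 to 7 by the symmetries n -> -n and n -> 15 - n; exponent
    15 gives 0. *)
Ltac reduce_thetas q Hq H :=
  rewrite !theta'_0 in H; rewrite !theta'_neq in H by lia;
  repeat match type of H with
  | context [theta q 15 (Zneg ?p)] =>
      let n := eval compute in (Pos.to_nat p) in
      change (theta q 15 (Zneg p)) with (theta q 15 (- Zpos p)) in H;
      rewrite (theta_opp q 15 (Zpos p) Hq eq_refl) in H;
      change (Cpowz q (- Zpos p)) with (/ q ^ n) in H
  end;
  rewrite ?(theta_refl q 15 1 : theta q 15 14 = _), ?(theta_refl q 15 2 : theta q 15 13 = _),
    ?(theta_refl q 15 3 : theta q 15 12 = _), ?(theta_refl q 15 4 : theta q 15 11 = _),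
    ?(theta_refl q 15 5 : theta q 15 10 = _), ?(theta_refl q 15 6 : theta q 15 9 = _),
    ?(theta_refl q 15 7 : theta q 15 8 = _), ?(theta_self q 15 Hq eq_refl) in H.

(** The poles congruent to 2 modulo 3 are folded onto the classes 1, 4, 7, 10, 13 that occur in the
    Lambert series. *)
Lemma Sig15_flips (q : C) (i : Z) :
  (0 < Cmod q < 1)%R ->
  (Sig15 q i 2 = - Cpowz q (35 - 3 * i) * Sig15 q (5 - i) 13) /\
  (Sig15 q i 5 = - Cpowz q (20 - 3 * i) * Sig15 q (5 - i) 10) /\
  (Sig15 q i 8 = - Cpowz q (5 - 3 * i) * Sig15 q (5 - i) 7) /\
  (Sig15 q i 11 = - Cpowz q (- 10 - 3 * i) * Sig15 q (5 - i) 4) /\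
  (Sig15 q i 14 = - Cpowz q (- 25 - 3 * i) * Sig15 q (5 - i) 1).
Proof. intros Hq; repeat split; apply Sig15_flip; auto; discriminate. Qed.

Lemma eq_of_scaled (k l r x y : C) : l = r -> x - y = k * (r - l) -> x = y.
Proof.
intros -> E; transitivity (x - y + y); [ring | rewrite E; ring].
Qed.

Lemma theta_data (q : C) :
  (0 < Cmod q < 1)%R ->
  q <> 0 /\ qpoch (Cpowz q 15) (Cpowz q 15) <> 0 /\
  theta q 15 1 <> 0 /\ theta q 15 2 <> 0 /\ theta q 15 3 <> 0 /\ theta q 15 4 <> 0 /\
  theta q 15 5 <> 0 /\ theta q 15 6 <> 0 /\ theta q 15 7 <> 0.
Proof.
intros Hq; assert (Hp := Cmod_Cpowz_lt_1 q 15 Hq eq_refl).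
split; [apply Cmod_gt_0; lra|]; split.
- apply qpoch_neq_0; [lra|]; intros k; now apply qpoch_self_factor_neq_0.
- repeat split; apply theta_15_neq_0; auto; lia.
Qed.

(** The factor k contains theta_3 theta_5 theta_6 (q^15;q^15)_oo^2, a common denominator of the
    residues. It reduces their coefficients to monomials with sign, possibly times G or 1/G, and the
    theta quotient on the left to 0 or the eta quotient, possibly times G or 1/G. The thetas are
    then generalized, which leaves a rational identity for [field]. *)
Ltac theta_relation q Hq j As Bs k :=
  let T := fresh "T" in
  assert (T := Sig15_theta_identity q j As Bs Hq eq_refl);
  specialize (T ltac:(vm_compute; repeat constructor; simpl; intuition discriminate));
  specialize (T ltac:(let b := fresh in let Hb := fresh in
    intros b Hb; simpl in Hb; intuition (subst; discriminate)) eq_refl);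
  eval_exponents T; reduce_thetas q Hq T;
  destruct (Sig15_flips q j Hq) as [F2 [F5 [F8 [F11 F14]]]];
  rewrite ?F2, ?F5, ?F8, ?F11, ?F14 in T; clear F2 F5 F8 F11 F14;
  destruct (theta_data q Hq) as [q0 [Hp [H1 [H2 [H3 [H4 [H5 [H6 H7]]]]]]]];
  rewrite ?(RR_ratio_theta q Hq), ?(eta_quotient_theta q Hq);
  apply (eq_of_scaled k _ _ _ _ T); clear T;
  generalize dependent (theta q 15 1); generalize dependent (theta q 15 2);
  generalize dependent (theta q 15 3); generalize dependent (theta q 15 4);
  generalize dependent (theta q 15 5); generalize dependent (theta q 15 6);
  generalize dependent (theta q 15 7);
  generalize dependent (qpoch (Cpowz q 15) (Cpowz q 15));
  intros;
  repeat match goal with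
  | |- context [Sig15 q (5 - ?i) _] =>
      let i' := eval compute in (5 - i)%Z in change (5 - i)%Z with i'
  | |- context [Cpowz q ?e] =>
      let e' := eval compute in e in
      match e' with
      | Z0 => change (Cpowz q e) with (RtoC 1)
      | Zpos ?p => let n := eval compute in (Pos.to_nat p) in change (Cpowz q e) with (q ^ n)
      | Zneg ?p => let n := eval compute in (Pos.to_nat p) in change (Cpowz q e) with (/ q ^ n)
      end
  end;
  field; repeat split; assumption.

(** This relation and the next settle the pair i = 1, 4. Both contain the combination that survives
    in [B_0]; each disposes of four of the other eight sums. The later relations do the same for the
    pairs 2, 3 and 0, 5. *)
Lemma Sig15_relation_1 (q : C) :
  (0 < Cmod q < 1)%R ->
  q ^ 33 * Sig15 q 4 13 + q ^ 8 * Sig15 q 1 7 + q ^ 3 * Sig15 q 1 4 + q * Sig15 q 4 1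
  = - RR_ratio q * (q ^ 25 * Sig15 q 1 13 + q ^ 12 * Sig15 q 4 7).
Proof.
intros Hq.
(* The numerator exponent 15 annihilates the left side, so no eta quotient appears. *)
theta_relation q Hq 1%Z [15; 6]%Z [2; 7; 4; 14; 8; 13]%Z
  (- q * (theta q 15 3 * theta q 15 5 * theta q 15 6 * qpoch (Cpowz q 15) (Cpowz q 15) ^ 2)).
Qed.

Lemma Sig15_relation_2 (q : C) :
  (0 < Cmod q < 1)%R ->
  q ^ 21 * Sig15 q 4 10 + q ^ 15 * Sig15 q 1 10 + Sig15 q 1 1 + q ^ 5 * Sig15 q 4 4
  = (q ^ 25 * Sig15 q 1 13 + q ^ 12 * Sig15 q 4 7) / RR_ratio q
    + qpoch (q ^ 3) (q ^ 3) ^ 3 / qpoch q q.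
Proof.
intros Hq.
theta_relation q Hq 1%Z [12; 9]%Z [5; 10; 1; 11; 8; 13]%Z
  (theta q 15 3 * theta q 15 5 * theta q 15 6 * qpoch (Cpowz q 15) (Cpowz q 15) ^ 2).
Qed.

Lemma Sig15_relation_3 (q : C) :
  (0 < Cmod q < 1)%R ->
  q ^ 10 * Sig15 q 3 7 + q ^ 27 * Sig15 q 2 13 + q ^ 3 * Sig15 q 2 4 + Sig15 q 3 1
  = (Sig15 q 2 1 + q ^ 4 * Sig15 q 3 4) / RR_ratio q.
Proof.
intros Hq.
theta_relation q Hq 2%Z [15; 12]%Z [8; 13; 4; 14; 1; 11]%Z
  (* Here too the left side is 0, because of the exponent 15. *)
  (- (theta q 15 3 * theta q 15 5 * theta q 15 6 * qpoch (Cpowz q 15) (Cpowz q 15) ^ 2)).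
Qed.

Lemma Sig15_relation_4 (q : C) :
  (0 < Cmod q < 1)%R ->
  q ^ 19 * Sig15 q 3 10 + q ^ 17 * Sig15 q 2 10 + q ^ 30 * Sig15 q 3 13 + q ^ 9 * Sig15 q 2 7
  = - RR_ratio q * (Sig15 q 2 1 + q ^ 4 * Sig15 q 3 4)
    + qpoch (q ^ 3) (q ^ 3) ^ 3 / qpoch q q.
Proof.
intros Hq.
theta_relation q Hq 2%Z [9; 3]%Z [5; 10; 2; 7; 1; 11]%Z
  (theta q 15 3 * theta q 15 5 * theta q 15 6 * qpoch (Cpowz q 15) (Cpowz q 15) ^ 2).
Qed.

Lemma Sig15_relation_5 (q : C) :
  (0 < Cmod q < 1)%R ->
  Sig15 q 0 1 + q ^ 6 * Sig15 q 5 4 + q ^ 2 * Sig15 q 0 4 + q * Sig15 q 5 1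
  = - RR_ratio q * (q ^ 23 * Sig15 q 5 10 + q ^ 13 * Sig15 q 0 10
                    - qpoch (q ^ 3) (q ^ 3) ^ 3 / qpoch q q).
Proof.
intros Hq.
theta_relation q Hq 0%Z [3; 12]%Z [1; 11; 4; 14; 5; 10]%Z
  (theta q 15 3 * theta q 15 5 * theta q 15 6 * qpoch (Cpowz q 15) (Cpowz q 15) ^ 2).
Qed.

Lemma Sig15_relation_6 (q : C) :
  (0 < Cmod q < 1)%R ->
  q ^ 35 * Sig15 q 5 13 + q ^ 6 * Sig15 q 0 7 + q ^ 13 * Sig15 q 5 7 + q ^ 22 * Sig15 q 0 13
  = (q ^ 23 * Sig15 q 5 10 + q ^ 13 * Sig15 q 0 10
     - qpoch (q ^ 3) (q ^ 3) ^ 3 / qpoch q q) / RR_ratio q.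
Proof.
intros Hq.
theta_relation q Hq 0%Z [6; 9]%Z [2; 7; 8; 13; 5; 10]%Z
  (- (theta q 15 3 * theta q 15 5 * theta q 15 6 * qpoch (Cpowz q 15) (Cpowz q 15) ^ 2)).
Qed.

(** * The theorem *)

(** The contribution of the monomial x^i, x = q^(3r+1), once the denominator has been completed to 1
    - x^5. *)
Definition lambert_term (q : C) (i r : Z) : C :=
  Cpowz q (6 * r * r + 4 * r + 1 + i * (3 * r + 1)) / (1 - Cpowz q (5 * (3 * r + 1))).

Lemma lambert_term_zdom (q : C) (i : Z) :
  (0 < Cmod q < 1)%R -> zdom (lambert_term q i).
Proof.
intros Hq; assert (q0 : q <> 0) by (apply Cmod_gt_0; lra).
assert (H15 := Cmod_Cpowz_lt_1 q 15 Hq eq_refl).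
assert (H6 := Cmod_Cpowz_lt_1 q 6 Hq eq_refl).
assert (Qn : forall n, Cpowz q n <> 0) by (intros; now apply Cpowz_neq_0).
destruct (inv_one_minus_bounded (Cpowz q 5) (Cpowz q 15) H15 (Qn 5%Z)) as [M HM].
{ intros k; now apply progression_neq_0. }
apply (zdom_le _ (fun r => Cpowz q (1 + i) * (Cpowz (Cpowz q 6) (r * r)
  * Cpowz (Cpowz q (4 + 3 * i)) r * / (1 - Cpowz q 5 * Cpowz (Cpowz q 15) r)))).
- intros r; right; f_equal; unfold lambert_term.
  rewrite <- !Cpowz_mul by exact q0.
  replace (5 * (3 * r + 1))%Z with (5 + 15 * r)%Z by lia.
  replace (6 * r * r + 4 * r + 1 + i * (3 * r + 1))%Z
    with (1 + i + (6 * (r * r) + (4 + 3 * i) * r))%Z by lia.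
  rewrite !(Cpowz_add q (1 + i)), (Cpowz_add q (6 * (r * r))), (Cpowz_add q 5 (15 * r))
    by exact q0.
  unfold Cdiv; ring.
- apply zdom_scal, (zdom_mult_bounded _ _ M HM), gauss_zdom; auto.
Qed.

Lemma lambert_term_sum (q : C) (i : Z) :
  (0 < Cmod q < 1)%R ->
  CSeriesZ (lambert_term q i) =
  csum (fun rho => let r := Z.of_nat rho in
    Cpowz q (6 * r * r + 4 * r + 1 + i * (3 * r + 1)) * Sig15 (q ^ 5) i (3 * r + 1)) 5.
Proof.
intros Hq; assert (q0 : q <> 0) by (apply Cmod_gt_0; lra).
assert (Q0 : q ^ 5 <> 0) by now apply Cpow_nz.
assert (HQ : (0 < Cmod (q ^ 5) < 1)%R).
{ split; [now apply Cmod_gt_0 | apply Cmod_pow_lt_1; [lra | lia]]. }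
assert (Zl := lambert_term_zdom q i Hq).
rewrite CSeriesZ_split5 by exact Zl.
apply csum_ext; intros rho Hrho; cbv zeta.
assert (Ha : ((3 * Z.of_nat rho + 1) mod 15 <> 0)%Z) by (rewrite Z.mod_small; lia).
unfold Sig15, SigmaZ, Sigma.
rewrite <- CSeriesZ_scal.
- apply CSeriesZ_ext; [|now apply zdom_progression].
  intros k; unfold lambert_term; set (r := Z.of_nat rho).
  rewrite <- !(Cpowz_mul (q ^ 5)), <- !(Cpowz_add (q ^ 5)), !Cpowz_pow by assumption.
  change (Z.of_nat 5) with 5%Z.
  replace (5 * (3 * (5 * k + r) + 1))%Z with (5 * (3 * r + 1 + 15 * k))%Z by lia.
  (* The quadratic part 150 k^2 is 5 * 15 * 2k(k + 1) minus 150 k; this is where the -30 in [Sig15]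
     comes from. *)
  replace (6 * (5 * k + r) * (5 * k + r) + 4 * (5 * k + r) + 1
    + i * (3 * (5 * k + r) + 1))%Z
    with (6 * r * r + 4 * r + 1 + i * (3 * r + 1)
      + 5 * (15 * (2 * k * (k + 1)) + (4 * (3 * r + 1) + 3 * i - 30) * k))%Z by lia.
  rewrite Cpowz_add by exact q0; unfold Cdiv; ring.
- apply Sigma_zdom; try (now apply Cpowz_neq_0).
  + exact (Cmod_Cpowz_lt_1 _ 15 HQ eq_refl).
  + intros k; now apply progression_neq_0.
Qed.

(** Reduction modulo the fifth cyclotomic polynomial. With t = zeta + zeta^4 this is t^2 + t - 1 =
    0; its other root is -1 - t. *)
Lemma fifth_root_quadratic (zeta : C) :
  primitive_root 5 zeta -> (zeta + zeta ^ 4) ^ 2 = 1 - (zeta + zeta ^ 4).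
Proof.
intros [_ [H5 Hk]].
assert (N : zeta - 1 <> 0).
{ apply Csub_neq_0; intros E; apply (Hk 1%nat ltac:(lia)); rewrite E; ring. }
assert (Phi : 1 + zeta + zeta ^ 2 + zeta ^ 3 + zeta ^ 4 = 0).
{ transitivity ((zeta ^ 5 - 1) / (zeta - 1)); [field; exact N|].
  rewrite H5; field; exact N. }
transitivity (1 - (zeta + zeta ^ 4) + (1 + zeta + zeta ^ 2 + zeta ^ 3 + zeta ^ 4)
  + (zeta ^ 5 - 1) * (zeta ^ 3 + 2)); [ring|].
rewrite Phi, H5; ring.
Qed.

(** The denominator is 1 - t x + x^2. Its cofactor in 1 - x^5 is (1 - x)(1 + (1 + t) x + x^2) = 1 -
    x^3 + t x - t x^2, and the displayed numerator is this cofactor times 1 - x^2. *)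
Lemma lambert_factor_fifth_root (zeta q : C) (n : Z) :
  (0 < Cmod q < 1)%R -> primitive_root 5 zeta -> n <> 0%Z ->
  let x := Cpowz q n in let t := zeta + zeta ^ 4 in
  lambert_factor zeta q n =
  (1 - x ^ 2 - x ^ 3 + x ^ 5 + t * (x - x ^ 2 - x ^ 3 + x ^ 4)) / (1 - x ^ 5) /\
  (1 - zeta * x) * (1 - / zeta * x) <> 0.
Proof.
intros Hq Hz Hn x t; assert (q0 : q <> 0) by (apply Cmod_gt_0; lra).
assert (T := fifth_root_quadratic zeta Hz); fold t in T.
destruct Hz as [_ [H5 Hk]].
assert (z0 : zeta <> 0).
{ intros E; apply C1_nz; rewrite <- H5, E; ring. }
assert (zi : / zeta = zeta ^ 4).
{ transitivity (zeta ^ 5 / zeta); [rewrite H5; field; exact z0 | field; exact z0]. }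
assert (X5 : 1 - x ^ 5 <> 0).
{ unfold x; rewrite <- Cpowz_of_nat, <- Cpowz_mul by exact q0.
  apply one_minus_Cpowz_neq_0; [exact Hq | lia]. }
assert (D : (1 - zeta * x) * (1 - / zeta * x) = 1 - t * x + x ^ 2).
{ rewrite zi; unfold t.
  transitivity (1 - (zeta + zeta ^ 4) * x + zeta ^ 5 * x ^ 2); [ring | rewrite H5; ring]. }
assert (F : (1 - x ^ 3 + t * x - t * x ^ 2) * (1 - t * x + x ^ 2) = 1 - x ^ 5).
{ transitivity (1 - x ^ 5 + (t ^ 2 - (1 - t)) * (x ^ 3 - x ^ 2)); [ring|].
  rewrite T; ring. }
assert (D0 : 1 - t * x + x ^ 2 <> 0).
{ intros E; apply X5; rewrite <- F, E; ring. }
split; [|rewrite D; exact D0].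
unfold lambert_factor; fold x; rewrite D.
replace (Cpowz q (2 * n)) with (x ^ 2).
2:{ unfold x; rewrite <- (Cpowz_of_nat (Cpowz q n)), <- Cpowz_mul by exact q0.
    f_equal; lia. }
assert (F0 : 1 - x ^ 3 + t * x - t * x ^ 2 <> 0).
{ intros E; apply X5; rewrite <- F, E; ring. }
rewrite <- F; field; auto.
Qed.

Lemma PPt_fifth_root (zeta q : C) :
  (0 < Cmod q < 1)%R -> primitive_root 5 zeta ->
  let t := zeta + zeta ^ 4 in
  let L := fun i => CSeriesZ (lambert_term q i) in
  qpoch q q * PPt zeta q =
  L 0%Z - L 2%Z - L 3%Z + L 5%Z + t * (L 1%Z - L 2%Z - L 3%Z + L 4%Z).
Proof.
intros Hq Hz t L; assert (q0 : q <> 0) by (apply Cmod_gt_0; lra).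
assert (z0 : zeta <> 0).
{ intros E; destruct Hz as [_ [H5 _]]; apply C1_nz; rewrite <- H5, E; ring. }
assert (P := PPt_lambert zeta q Hq z0).
apply (Ccv_unique _ _ _ (P ltac:(intros n; unfold quad; rewrite <- Cpowz_of_nat;
  apply (lambert_factor_fifth_root zeta q (Z.of_nat (S n)) Hq Hz ltac:(lia))))).
assert (c : forall i, Ccv (zsum (lambert_term q i)) (L i)).
{ intros i; now apply zdom_conv, lambert_term_zdom. }
eapply Ccv_ext; [|exact (Ccv_plus _ _ _ _
  (Ccv_plus _ _ _ _ (Ccv_minus _ _ _ _ (Ccv_minus _ _ _ _ (c 0%Z) (c 2%Z)) (c 3%Z)) (c 5%Z))
  (Ccv_scal t _ _ (Ccv_plus _ _ _ _ (Ccv_minus _ _ _ _ (Ccv_minus _ _ _ _ (c 1%Z) (c 2%Z))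
     (c 3%Z)) (c 4%Z))))].
intros K; cbv beta.
transitivity (zsum (fun r => lambert_term q 0 r + - (1) * lambert_term q 2 r
  + - (1) * lambert_term q 3 r + lambert_term q 5 r + t * (lambert_term q 1 r
  + - (1) * lambert_term q 2 r + - (1) * lambert_term q 3 r + lambert_term q 4 r)) K).
- rewrite !zsum_plus, !zsum_scal, !zsum_plus, !zsum_scal; ring.
- apply zsum_ext; intros r _.
  destruct (lambert_factor_fifth_root zeta q (3 * r + 1) Hq Hz ltac:(lia)) as [E _].
  rewrite E; clear E; fold t; unfold lambert_term.
  set (n := (3 * r + 1)%Z); set (x := Cpowz q n).
  assert (Hx : forall i, (0 <= i)%Z -> Cpowz q (i * n) = x ^ Z.to_nat i).
  { intros i Hi; unfold x; rewrite Z.mul_comm, Cpowz_mul by exact q0.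
    rewrite <- (Cpowz_of_nat (Cpowz q n)), Z2Nat.id by exact Hi; reflexivity. }
  rewrite !(Cpowz_add q (6 * r * r + 4 * r + 1)), !Hx by (auto; lia).
  simpl Z.to_nat; change (Pos.to_nat 1) with 1%nat; change (Pos.to_nat 2) with 2%nat.
  change (Pos.to_nat 3) with 3%nat; change (Pos.to_nat 4) with 4%nat.
  change (Pos.to_nat 5) with 5%nat.
  unfold Cdiv; ring.
Qed.

Theorem theorem1p3 (q : C) (hq0 : (0 < Cmod q)%R) (hq1 : (Cmod q < 1)%R)
  (zeta : C) (hzeta : primitive_root 5 zeta) :
  PPt zeta q =
    B_0 zeta (q ^ 5) + q * B_1 (q ^ 5) + q ^ 2 * B_2 zeta (q ^ 5)
    + q ^ 3 * B_3 (q ^ 5) + q ^ 4 * B_4 (q ^ 5).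
Proof.
assert (Hq : (0 < Cmod q < 1)%R) by (split; assumption).
assert (q0 : q <> 0) by now apply Cmod_gt_0.
assert (HQ : (0 < Cmod (q ^ 5) < 1)%R).
{ split; [now apply Cmod_gt_0, Cpow_nz | apply Cmod_pow_lt_1; [lra | lia]]. }
assert (M := PPt_fifth_root zeta q Hq hzeta); cbv beta zeta in M.
rewrite !lambert_term_sum in M by exact Hq; cbn [csum] in M.
assert (R1 := Sig15_relation_1 (q ^ 5) HQ); assert (R2 := Sig15_relation_2 (q ^ 5) HQ).
assert (R3 := Sig15_relation_3 (q ^ 5) HQ); assert (R4 := Sig15_relation_4 (q ^ 5) HQ).
assert (R5 := Sig15_relation_5 (q ^ 5) HQ); assert (R6 := Sig15_relation_6 (q ^ 5) HQ).
assert (D := euler_dissection q Hq).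
assert (G0 : RR_ratio (q ^ 5) <> 0).
{ destruct (theta_data (q ^ 5) HQ) as [_ [_ [H1 [H2 [H3 [H4 [_ [H6 H7]]]]]]]].
  rewrite RR_ratio_theta by exact HQ; apply Cmult_neq_0; [|apply Cinv_neq_0];
    (apply Cmult_neq_0; [apply Cmult_neq_0|]); assumption. }
assert (E0 : qpoch q q <> 0).
{ apply qpoch_neq_0; [lra|]; intros k; now apply qpoch_self_factor_neq_0. }
assert (E1 : qpoch (q ^ 5) (q ^ 5) <> 0).
{ apply qpoch_neq_0; [lra|]; intros k; now apply qpoch_self_factor_neq_0. }
assert (E5 : qpoch ((q ^ 5) ^ 5) ((q ^ 5) ^ 5) <> 0) by (apply qpoch_pow_neq_0; auto; lia).
unfold B_0, B_1, B_2, B_3, B_4.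
change (SigmaZ (q ^ 5) 7 10 15) with (Sig15 (q ^ 5) 4 7).
change (SigmaZ (q ^ 5) 13 25 15) with (Sig15 (q ^ 5) 1 13).
change (SigmaZ (q ^ 5) 10 10 15) with (Sig15 (q ^ 5) 0 10).
change (SigmaZ (q ^ 5) 10 25 15) with (Sig15 (q ^ 5) 5 10).
change (SigmaZ (q ^ 5) 1 (-20) 15) with (Sig15 (q ^ 5) 2 1).
change (SigmaZ (q ^ 5) 4 (-5) 15) with (Sig15 (q ^ 5) 3 4).
repeat match type of M with
| context [Cpowz q ?e] =>
    let e' := eval compute in e in
    match e' with
    | Zpos ?p => let n := eval compute in (Pos.to_nat p) in change (Cpowz q e) with (q ^ n) in M
    end
end.
change (3 * Z.of_nat 0 + 1)%Z with 1%Z in M; change (3 * Z.of_nat 1 + 1)%Z with 4%Z in M.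
change (3 * Z.of_nat 2 + 1)%Z with 7%Z in M; change (3 * Z.of_nat 3 + 1)%Z with 10%Z in M.
change (3 * Z.of_nat 4 + 1)%Z with 13%Z in M.
set (Q := q ^ 5) in *; set (t := zeta + zeta ^ 4) in *.
set (A0 := Q ^ 23 * Sig15 Q 5 10 + Q ^ 13 * Sig15 Q 0 10) in *.
set (A1 := Q ^ 25 * Sig15 Q 1 13 + Q ^ 12 * Sig15 Q 4 7) in *.
set (A2 := Sig15 Q 2 1 + Q ^ 4 * Sig15 Q 3 4) in *.
(* The thirty sums are regrouped by the left sides of the relations. Each bracket then becomes -q
   A0, -q^2 A2 or -A1 times G - q - q^2/G, with an eta quotient times q^2 beside it; these cancel in
   both differences. Only the eta quotient attached to A0 remains. *)
match type of R1 with @eq _ ?l1 _ => match type of R2 with @eq _ ?l2 _ =>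
match type of R3 with @eq _ ?l3 _ => match type of R4 with @eq _ ?l4 _ =>
match type of R5 with @eq _ ?l5 _ => match type of R6 with @eq _ ?l6 _ =>
match type of M with @eq _ _ ?m =>
  assert (M' : m = (q * l5 + q ^ 3 * l6 + q ^ 2 * A0)
    - (q ^ 4 * l3 + q ^ 2 * l4 + q ^ 3 * A2)
    + t * ((l1 + q ^ 2 * l2 + q * A1) - (q ^ 4 * l3 + q ^ 2 * l4 + q ^ 3 * A2)))
    by (unfold A0, A1, A2, Q; ring)
end end end end end end end.
rewrite M', R1, R2, R3, R4, R5, R6 in M.
transitivity (qpoch q q * PPt zeta q / qpoch q q); [field; exact E0|].
rewrite M.
assert (D0 : RR_ratio Q - q - q ^ 2 / RR_ratio Q <> 0).
{ intros H; apply E0; rewrite D, H; ring. }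
rewrite D.
replace (1 + zeta + zeta ^ 4) with (1 + t) by (unfold t; ring).
replace (Q ^ 12 * Sig15 Q 4 7 + Q ^ 25 * Sig15 Q 1 13) with A1 by (unfold A1; ring).
replace (Q ^ 13 * Sig15 Q 0 10 + Q ^ 23 * Sig15 Q 5 10) with A0 by (unfold A0; ring).
fold A2.
(* The nonzero dissection factor with 1/G cleared, in the form of the side condition left by
   [field]. *)
assert (D1 : (RR_ratio Q - q) * RR_ratio Q - q ^ 2 <> 0).
{ intros H; apply D0; transitivity (((RR_ratio Q - q) * RR_ratio Q - q ^ 2)
    / RR_ratio Q); [field; exact G0 | rewrite H; field; exact G0]. }
clearbody A0 A1 A2 t; clear M M' R1 R2 R3 R4 R5 R6 D.
generalize dependent (RR_ratio Q); generalize dependent (qpoch (Q ^ 5) (Q ^ 5)).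
generalize dependent (qpoch Q Q); generalize (qpoch (Q ^ 3) (Q ^ 3)).
intros; field; repeat split; assumption.
Qed.
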